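(* Let $B$ be a closed braid with $b$ strands and writhe $w$. Then $$\frac{w-b}{2}\ \le\ \hat g_{min}(B)\ \le\ \hat g_{max}(B)\ \le\ \frac{w+b}{2}-1 .$$ If moreover $c_+$ and $c_-$ denote the numbers of positive and negative crossings of $B$, respectively, then (for every $n\ge 2$) $$(n-1)(w-b)-2c_-\ \le\ g^{(n)}_{min}(B)\ \le\ g^{(n)}_{max}(B)\ \le\ (n-1)(w+b)+2c_+ .$$ Here the numerical invariants $g^{(n)}_{max},g^{(n)}_{min},\hat g_{max},\hat g_{min}$ are the ones defined in the context from the Khovanov–Rozansky cohomologies $H_n$ and $\hat H$.
   Context: General conventions. For a graded module $M$, $M\{m\}$ is $M$ with degrees raised by $m$ (a degree $i$ element of $M$ has degree $i+m$ in $M\{m\}$); similarly $M\{m,l\}$ for bigraded modules. For $p,q$ in a commutative ring $S$, $(p,q)_S$ denotes the matrix factorization $S\xrightarrow{p}S\xrightarrow{q}S$ (that is $M^0=M^1=S$, $d^0=p$, $d^1=q$). Matrix factorizations over $S$ are tensored over $S$ with the signed Leibniz rule. A positive crossing is one where, when both strands point upward, the strand from bottom left to top right passes over; a negative crossing is the opposite one. The writhe is $c_+-c_-$. Diagrams. A closed planar diagram $\Gamma$ consists of oriented, pairwise disjoint regular edges (circles allowed) and pairwise disjoint wide edges, meeting only at endpoints, each wide edge having exactly two regular edges entering at one endpoint and exactly two exiting from the other. Put markings $x_1,\dots,x_p$ on the regular edges, at least one on each. $L^i_j$ denotes an oriented arc in a regular edge from the mark $x_j$ to the mark $x_i$ with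 no marks inside. For a wide edge $E$ drawn pointing upward, $x_i,x_j$ are the nearest marks on the top left and top right (exiting) edges, $x_k,x_l$ the nearest marks on the bottom left and bottom right (entering) edges. All polynomials below are formed with independent variables, and then coinciding marks are identified. The theory $H_n$ ($n\ge 2$). Let $R'=\mathbb Q[x_1,\dots,x_p]$, $\deg x_i=2$. Put $\pi_{ij}=\sum_{s=0}^n x_i^{s}x_j^{n-s}$ and $C_n(L^i_j)=(R'\xrightarrow{\pi_{ij}}R'\{1-n\}\xrightarrow{x_i-x_j}R')$. Let $g$ be the two-variable polynomial with $g(x+y,xy)=x^{n+1}+y^{n+1}$, and $$u_1=\frac{g(x_i+x_j,x_ix_j)-g(x_k+x_l,x_ix_j)}{x_i+x_j-x_k-x_l},\qquad u_2=\frac{g(x_k+x_l,x_ix_j)-g(x_k+x_l,x_kx_l)}{x_ix_j-x_kx_l}.$$ $C_n(E)$ is the tensor product of $R'\{-1\}\xrightarrow{u_1}R'\{-n\}\xrightarrow{x_i+x_j-x_k-x_l}R'\{-1\}$ and $R'\xrightarrow{u_2}R'\{3-n\}\xrightarrow{x_ix_j-x_kx_l}R'$. $C_n(\Gamma)$ is the tensor product over $R'$ of all $C_n(L^i_j)$ and all $C_n(E)$; its differential $d_{mf}$ squares to $0$ and $H_n(\Gamma)$ is its cohomology, $\mathbb Z$-graded by the quantum grading. For an oriented link diagram $D$, mark it away from the crossings so that each arc between crossings (and each crossingless circle) is marked. Near a crossing drawn upward, let $x_i,x_j$ be the top left and top right marks, $x_k,x_l$ the bottom left and bottom right marks. Its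 $0$-resolution $P_0$ consists of arcs from $x_k$ to $x_i$ and from $x_l$ to $x_j$; its $1$-resolution $P_1$ is a wide edge with these marks. In suitable signed bases, $C_n(P_0)$ has $M^0=R'\oplus R'\{2-2n\}$, $M^1=R'\{1-n\}\oplus R'\{1-n\}$, $d^0=\begin{pmatrix}\pi_{ik}&x_j-x_l\\ \pi_{jl}&-x_i+x_k\end{pmatrix}$, $d^1=\begin{pmatrix}x_i-x_k&x_j-x_l\\ \pi_{jl}&-\pi_{ik}\end{pmatrix}$, and $C_n(P_1)$ has $M^0=R'\{-1\}\oplus R'\{3-2n\}$, $M^1=R'\{-n\}\oplus R'\{2-n\}$, $d^0=\begin{pmatrix}u_1&x_ix_j-x_kx_l\\ u_2&-x_i-x_j+x_k+x_l\end{pmatrix}$, $d^1=\begin{pmatrix}x_i+x_j-x_k-x_l&x_ix_j-x_kx_l\\ u_2&-u_1\end{pmatrix}$. With $a_1=-u_2+(u_1+x_iu_2-\pi_{jl})/(x_i-x_k)$, the maps $\chi^{(n)}_0:C_n(P_0)\to C_n(P_1)$ and $\chi^{(n)}_1:C_n(P_1)\to C_n(P_0)$ of degree $1$ are given on $(M^0,M^1)$ by $$\chi^{(n)}_0:\ \begin{pmatrix}x_k-x_j&0\\ a_1&1\end{pmatrix},\ \begin{pmatrix}x_k&-x_j\\ -1&1\end{pmatrix};\qquad \chi^{(n)}_1:\ \begin{pmatrix}1&0\\ -a_1&x_k-x_j\end{pmatrix},\ \begin{pmatrix}1&x_j\\ 1&x_k\end{pmatrix}.$$ To a positive crossing assign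 the complex $C_n(P_1)\{n\}\xrightarrow{\chi^{(n)}_1}C_n(P_0)\{n-1\}$ in cohomological degrees $-1,0$; to a negative crossing assign $C_n(P_0)\{1-n\}\xrightarrow{\chi^{(n)}_0}C_n(P_1)\{-n\}$ in cohomological degrees $0,1$. $C_n(D)$ is the tensor product over $R'$ of these complexes over all crossings and of the $C_n(L^i_j)$ (in cohomological degree $0$) over all crossingless arcs between consecutive marks. It carries commuting differentials $d_{mf}$ (from the matrix factorizations) and $d_\chi$ (from the $\chi$ maps), and $H_n(D)=H(H(C_n(D),d_{mf}),d_\chi)$. $H_n^{j,k}$ is the part of cohomological degree $j$ and quantum degree $k$. The bigraded isomorphism type of $H_n$ is a link invariant (Khovanov–Rozansky). The theory $\hat H$. Let $R=\mathbb Q[a,x_1,\dots,x_p]$ with $\deg a=(2,0)$, $\deg x_i=(0,2)$ (first component: quantum $a$-grading; second: quantum $x$-grading). Put $C(L^i_j)=(R\xrightarrow{a}R\{-1,1\}\xrightarrow{x_i-x_j}R)$; $C(E)$ is the tensor product of $R\xrightarrow{a}R\{-1,1\}\xrightarrow{x_i+x_j-x_k-x_l}R$ and $R\xrightarrow{0}R\{-1,3\}\xrightarrow{x_ix_j-x_kx_l}R$; $C(\Gamma)$ is the tensor product over $R$ of all $C(L^i_j)$ and all $C(E)$. In suitable signed bases $C(P_0)$ has $M^0=R\oplus R\{-2,2\}$, $M^1=R\{-1,1\}\oplus R\{-1,1\}$, $d^0=\begin{pmatrix}a&x_j-x_l\\ a&-x_i+x_k\end{pmatrix}$, $d^1=\begin{pmatrix}x_i-x_k&x_j-x_l\\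 a&-a\end{pmatrix}$, and $C(P_1)$ has $M^0=R\oplus R\{-2,4\}$, $M^1=R\{-1,1\}\oplus R\{-1,3\}$, $d^0=\begin{pmatrix}a&x_ix_j-x_kx_l\\ 0&-x_i-x_j+x_k+x_l\end{pmatrix}$, $d^1=\begin{pmatrix}x_i+x_j-x_k-x_l&x_ix_j-x_kx_l\\ 0&-a\end{pmatrix}$. The maps $\chi_0:C(P_0)\to C(P_1)$ (bidegree $(0,2)$) and $\chi_1:C(P_1)\to C(P_0)$ (bidegree $(0,0)$) are given on $(M^0,M^1)$ by $$\chi_0:\ \begin{pmatrix}x_k-x_j&0\\ 0&1\end{pmatrix},\ \begin{pmatrix}x_k&-x_j\\ -1&1\end{pmatrix};\qquad \chi_1:\ \begin{pmatrix}1&0\\ 0&x_k-x_j\end{pmatrix},\ \begin{pmatrix}1&x_j\\ 1&x_k\end{pmatrix}.$$ A positive crossing gets $C(P_1)\{0,-2\}\xrightarrow{\chi_1}C(P_0)\{0,-2\}$ in cohomological degrees $0,1$; a negative crossing gets $C(P_0)\{0,2\}\xrightarrow{\chi_0}C(P_1)$ in cohomological degrees $-1,0$. $C(D)$ is the tensor product over $R$ over crossings and crossingless arcs as before, and $H(D)=H(H(C(D),d_{mf}),d_\chi)$, triply graded (cohomological, $a$-, $x$-grading). For a closed braid $B$ with $b$ strands and writhe $w$, $\hat H(B)$ is $H(B)$ with both quantum gradings shifted by $\frac{w+b}{2}$ and the cohomological grading shifted by $-\frac{w+b}{2}$; its triply graded isomorphism type is invariant under Markov moves, hence an invariant of links (Khovanov–Rozansky).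 $\hat H^{j,k,l}$ is the part of cohomological degree $j$, $a$-degree $k$, $x$-degree $l$. Numerical invariants of a link $L$: $g^{(n)}_{max}(L)=\max\{k\mid H_n^{j,k}(L)\ne0\text{ for some }j\}$, $g^{(n)}_{min}(L)=\min\{k\mid H_n^{j,k}(L)\ne0\text{ for some }j\}$, $\hat g_{max}(L)=\max\{k\mid \hat H^{j,k,l}(L)\ne0\text{ for some }j,l\}$, $\hat g_{min}(L)=\min\{k\mid \hat H^{j,k,l}(L)\ne0\text{ for some }j,l\}$. For a closed braid these denote the invariants of the link it represents. *)

(* Defs.v *)
From HB Require Import structures.
From mathcomp Require Import all_boot all_order all_algebra.
From mathcomp Require Import ring.
From mathcomp Require Import mpoly.

Set Implicit Arguments.
Unset Strict Implicit.
Unset Printing Implicit Defensive.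

Import Order.TTheory GRing.Theory Num.Theory.
Local Open Scope ring_scope.

(* Homology is handled through subquotients cyc / bdy of a fixed module, so that
   it can be iterated: if f preserves cyc and bdy, then [homology f Q] is the
   subquotient of V which represents ker / im of the map induced by f on Q. *)
Record subquotient (V : Type) := SubQuotient { cyc : V -> Prop; bdy : V -> Prop }.

Definition whole (V : zmodType) : subquotient V :=
  SubQuotient (fun _ => True) (fun z => z = 0).

Definition homology (V : zmodType) (f : V -> V) (Q : subquotient V) : subquotient V :=
  SubQuotient
    (fun z => cyc Q z /\ bdy Q (f z))
    (fun z => exists y w, [/\ cyc Q y, bdy Q w & z = f y + w]).

Definition part (V : Type) (P : V -> Prop) (Q : subquotient V) : subquotient V :=
  SubQuotient (fun z => cyc Q z /\ P z) (fun z => bdy Q z /\ P z).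

Definition nontrivial (V : Type) (Q : subquotient V) : Prop :=
  exists z, cyc Q z /\ ~ bdy Q z.

(* A matrix factorization on a free graded module: a basis whose elements carry
   a parity (true for M^1) and a quantum degree in G, and a differential whose
   value at the basis vector c is the sum over r of (mdiff r c) *: r. *)
Record mfact (S : pzRingType) (G : zmodType) := MFact {
  mbasis : finType;
  mpar : mbasis -> bool;
  mgr : mbasis -> G;
  mdiff : mbasis -> mbasis -> S }.

(* S --p--> S --q--> S, with the generators of M^0, M^1 in degrees g0, g1. *)
Definition mf1 (S : pzRingType) (G : zmodType) (g0 g1 : G) (p q : S) : mfact S G :=
  MFact id (fun e : bool => if e then g1 else g0)
    (fun r c : bool => if r == ~~ c then (if c then q else p) else 0).

Definition mx2 (S : pzRingType) (a b c d : S) : 'M[S]_2 :=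
  \matrix_(i < 2, j < 2) (if i == 0 then (if j == 0 then a else b)
                          else (if j == 0 then c else d)).

(* M^0 = S{g00} + S{g01}, M^1 = S{g10} + S{g11}, with matrices d0 : M^0 -> M^1
   and d1 : M^1 -> M^0 acting on columns. *)
Definition mf2 (S : pzRingType) (G : zmodType) (g00 g01 g10 g11 : G)
    (d0 d1 : 'M[S]_2) : mfact S G :=
  MFact (fun e : bool * 'I_2 => e.1)
    (fun e => if e.1 then (if e.2 == 0 then g10 else g11)
              else (if e.2 == 0 then g00 else g01))
    (fun r c => if r.1 == ~~ c.1 then (if c.1 then d1 else d0) r.2 c.2 else 0).

(* The map between two factorizations of the form mf2 given by f0 on M^0 and by
   f1 on M^1. *)
Definition map2 (S : pzRingType) (f0 f1 : 'M[S]_2) (r c : bool * 'I_2) : S :=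
  if r.1 == c.1 then (if c.1 then f1 else f0) r.2 c.2 else 0.

Definition mfshift (S : pzRingType) (G : zmodType) (g : G) (M : mfact S G) :
    mfact S G :=
  MFact (@mpar S G M) (fun e => mgr e + g) (@mdiff S G M).

Record mfcomplex (S : pzRingType) (G : zmodType) := MFComplex {
  basis : finType;
  par : basis -> bool;
  coh : basis -> int;
  gr : basis -> G;
  dmf : basis -> basis -> S;
  dchi : basis -> basis -> S }.

Definition mf_single (S : pzRingType) (G : zmodType) (M : mfact S G) :
    mfcomplex S G :=
  MFComplex (@mpar S G M) (fun _ => 0) (@mgr S G M) (@mdiff S G M)
    (fun _ _ => 0).

(* M --f--> N with M in cohomological degree c and N in degree c + 1. *)
Definition mf_arrow (S : pzRingType) (G : zmodType) (c : int) (M N : mfact S G)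
    (f : mbasis N -> mbasis M -> S) : mfcomplex S G :=
  MFComplex
    (fun e : mbasis M + mbasis N =>
       match e with inl u => mpar u | inr v => mpar v end)
    (fun e => match e with inl _ => c | inr _ => c + 1 end)
    (fun e => match e with inl u => mgr u | inr v => mgr v end)
    (fun r s => match r, s with
                | inl u, inl u' => mdiff u u'
                | inr v, inr v' => mdiff v v'
                | _, _ => 0
                end)
    (fun r s => match r, s with inr v, inl u => f v u | _, _ => 0 end).

Definition mf_unit (S : pzRingType) (G : zmodType) : mfcomplex S G :=
  MFComplex (fun _ : unit => false) (fun _ => 0) (fun _ => 0)
    (fun _ _ => 0) (fun _ _ => 0).

(* The signs are those of the parity for dmf and those of the cohomological
   degree for dchi; dmf and dchi commute on the tensor product. *)
Definition mf_tensor (S : pzRingType) (G : zmodType) (C D : mfcomplex S G) :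
    mfcomplex S G :=
  MFComplex
    (fun e : basis C * basis D => par e.1 (+) par e.2)
    (fun e => coh e.1 + coh e.2)
    (fun e => gr e.1 + gr e.2)
    (fun r c => dmf r.1 c.1 *+ (r.2 == c.2)
              + (-1) ^+ par c.1 * dmf r.2 c.2 *+ (r.1 == c.1))
    (fun r c => dchi r.1 c.1 *+ (r.2 == c.2)
              + (-1) ^+ `|coh c.1|%N * dchi r.2 c.2 *+ (r.1 == c.1)).

Definition mf_bigtensor (S : pzRingType) (G : zmodType) (l : seq (mfcomplex S G)) :
    mfcomplex S G :=
  foldr (@mf_tensor S G) (mf_unit S G) l.

Section Cohomology.
Variables (N : nat) (G : zmodType) (wt : 'I_N -> G).
Variable C : mfcomplex {mpoly rat[N]} G.

Definition elt : Type := {ffun basis C -> {mpoly rat[N]}}.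

Definition act (d : basis C -> basis C -> {mpoly rat[N]}) (v : elt) : elt :=
  [ffun r => \sum_c d r c * v c].

(* Homogeneous elements, when the i-th variable has degree wt i. *)
Definition bihomog (j : int) (g : G) (v : elt) : Prop :=
  forall (e : basis C) (m : 'X_{1..N}), m \in msupp (v e) ->
    coh e = j /\ (\sum_(i < N) wt i *+ m i) + gr e = g.

Definition HH : subquotient elt :=
  homology (act (@dchi _ _ C)) (homology (act (@dmf _ _ C)) (whole elt)).

Definition HH_nz (j : int) (g : G) : Prop := nontrivial (part (bihomog j g) HH).
End Cohomology.

(* With positive = true for a positive crossing; tl, tr, bl, br are the marks
   x_i, x_j, x_k, x_l around the crossing drawn upward. *)
Record crossing (p : nat) := Crossing {
  positive : bool; tl : 'I_p; tr : 'I_p; bl : 'I_p; br : 'I_p }.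

(* An arc (i, j) is L^i_j, which goes from the mark x_j to the mark x_i. *)
Record diagram (p : nat) := Diagram {
  crossings : seq (crossing p); arcs : seq ('I_p * 'I_p) }.

(* [psum s t m] is the polynomial in s, t which takes the value x^m + y^m at
   s = x + y, t = x y; the polynomial g is [psum s t n.+1]. *)
Fixpoint psum (A : pzRingType) (s t : A) (m : nat) : A :=
  match m with
  | 0 => 2
  | m'.+1 => match m' with
             | 0 => s
             | m''.+1 => s * psum s t m' - t * psum s t m''
             end
  end.

Arguments psum {A} s t m : simpl never.

Lemma psumSS (A : pzRingType) (s t : A) m :
  psum s t m.+2 = s * psum s t m.+1 - t * psum s t m.
Proof. by []. Qed.

Lemma psumE (A : comPzRingType) (x y : A) m : psum (x + y) (x * y) m = x ^+ m + y ^+ m.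
Proof.
suff: psum (x + y) (x * y) m = x ^+ m + y ^+ m
   /\ psum (x + y) (x * y) m.+1 = x ^+ m.+1 + y ^+ m.+1 by case.
elim: m => [|m [IH1 IH2]]; first by rewrite !expr0 !expr1.
by split=> //; rewrite psumSS IH1 IH2 !exprS; ring.
Qed.

Definition pi_ (A : pzRingType) (n : nat) (x y : A) : A :=
  \sum_(s < n.+1) x ^+ s * y ^+ (n - s).

Definition congr_mod (A : comPzRingType) (d x y : A) : Prop :=
  exists q, q * d = x - y.

Section Congr.
Variables (A : comPzRingType) (d : A).
Local Notation cm := (congr_mod d).

Lemma congr_modxx x : cm x x.
Proof. by exists 0; rewrite mul0r subrr. Qed.

Lemma congr_modD x y x' y' : cm x y -> cm x' y' -> cm (x + x') (y + y').
Proof. by case=> q h [q' h']; exists (q + q'); rewrite mulrDl h h'; ring. Qed.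

Lemma congr_modN x y : cm x y -> cm (- x) (- y).
Proof. by case=> q h; exists (- q); rewrite mulNr h; ring. Qed.

Lemma congr_modM x y x' y' : cm x y -> cm x' y' -> cm (x * x') (y * y').
Proof.
case=> q h [q' h']; exists (q * x' + y * q').
by rewrite mulrDl -mulrA (mulrC x') mulrA h -mulrA h'; ring.
Qed.

Lemma congr_modX x y k : cm x y -> cm (x ^+ k) (y ^+ k).
Proof.
move=> h; elim: k => [|k IH]; first by rewrite !expr0; apply: congr_modxx.
by rewrite !exprS; apply: congr_modM.
Qed.

Lemma congr_psum s t s' t' m : cm s s' -> cm t t' -> cm (psum s t m) (psum s' t' m).
Proof.
move=> hs ht.
suff: cm (psum s t m) (psum s' t' m) /\ cm (psum s t m.+1) (psum s' t' m.+1) by case.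
elim: m => [|m [IH1 IH2]]; first by split=> //; apply: congr_modxx.
split=> //; apply: congr_modD; first exact: congr_modM.
exact/congr_modN/congr_modM.
Qed.
End Congr.

Lemma congr_comp N K (d : {mpoly rat[K]}) (f g : N.-tuple {mpoly rat[K]})
    (p : {mpoly rat[N]}) :
  (forall i, congr_mod d (tnth f i) (tnth g i)) -> congr_mod d (p \mPo f) (p \mPo g).
Proof.
move=> h; rewrite !comp_mpolyE.
apply: (big_ind2 (congr_mod d)); [exact: congr_modxx|exact: congr_modD|].
move=> m _; rewrite -!mul_mpolyC; apply: congr_modM; first exact: congr_modxx.
apply: (big_ind2 (congr_mod d)); [exact: congr_modxx|exact: congr_modM|].
by move=> i _; apply: congr_modX.
Qed.

(* The polynomials u_1, u_2, a_1 in the ring Q[xi, xj, xk, xl], as exact quotients. *)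
Section Local.
Variable n : nat.
Notation A := {mpoly rat[4]}.
Definition xi : A := 'X_(inord 0).
Definition xj : A := 'X_(inord 1).
Definition xk : A := 'X_(inord 2).
Definition xl : A := 'X_(inord 3).

Lemma u1_exists : exists q : A, q * (xi + xj - xk - xl)
  == psum (xi + xj) (xi * xj) n.+1 - psum (xk + xl) (xi * xj) n.+1.
Proof.
have [|q <-] := @congr_psum A (xi + xj - xk - xl) (xi + xj) (xi * xj) (xk + xl)
  (xi * xj) n.+1 _ (congr_modxx _ _); last by exists q.
by exists 1; ring.
Qed.

Definition u1 : A := xchoose u1_exists.

Lemma u1E : u1 * (xi + xj - xk - xl)
  = psum (xi + xj) (xi * xj) n.+1 - psum (xk + xl) (xi * xj) n.+1.
Proof. exact/eqP/(xchooseP u1_exists). Qed.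

Lemma u2_exists : exists q : A, q * (xi * xj - xk * xl)
  == psum (xk + xl) (xi * xj) n.+1 - psum (xk + xl) (xk * xl) n.+1.
Proof.
have [|q <-] := @congr_psum A (xi * xj - xk * xl) (xk + xl) (xi * xj) (xk + xl)
  (xk * xl) n.+1 (congr_modxx _ _) _; last by exists q.
by exists 1; ring.
Qed.

Definition u2 : A := xchoose u2_exists.

Lemma u2E : u2 * (xi * xj - xk * xl)
  = psum (xk + xl) (xi * xj) n.+1 - psum (xk + xl) (xk * xl) n.+1.
Proof. exact/eqP/(xchooseP u2_exists). Qed.

Lemma piE (B : comPzRingType) (x y : B) : pi_ n x y * (x - y) = x ^+ n.+1 - y ^+ n.+1.
Proof.
rewrite [in RHS]subrXX mulrC /pi_; congr (_ * _).
rewrite (reindex_inj rev_ord_inj) /=; apply: eq_bigr => i _.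
by rewrite subSS subKn // -ltnS.
Qed.

Lemma quotient_relation (B : comPzRingType) (v1 v2 yj yk yl : B) :
  v1 * (yk + yj - yk - yl)
    = psum (yk + yj) (yk * yj) n.+1 - psum (yk + yl) (yk * yj) n.+1 ->
  v2 * (yk * yj - yk * yl)
    = psum (yk + yl) (yk * yj) n.+1 - psum (yk + yl) (yk * yl) n.+1 ->
  (v1 + yk * v2 - pi_ n yj yl) * (yj - yl) = 0.
Proof.
move=> h1 h2; rewrite mulrBl piE mulrDl.
have -> : v1 * (yj - yl) = v1 * (yk + yj - yk - yl) by ring.
have -> : yk * v2 * (yj - yl) = v2 * (yk * yj - yk * yl) by ring.
by rewrite h1 h2 !psumE; ring.
Qed.

Lemma a1_exists : exists q : A, q * (xi - xk) == u1 + xi * u2 - pi_ n xj xl.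
Proof.
pose F := u1 + xi * u2 - pi_ n xj xl.
set f : 4.-tuple A := [tuple 'X_i | i < 4].
set f' : 4.-tuple A := [tuple xk; xj; xk; xl].
have cf' (i : 'I_4) : 'X_i \mPo f' = f'`_i by rewrite comp_mpolyXU.
have Ei : xi \mPo f' = xk by rewrite cf' inordK.
have Ej : xj \mPo f' = xj by rewrite cf' inordK.
have Ek : xk \mPo f' = xk by rewrite cf' inordK.
have El : xl \mPo f' = xl by rewrite cf' inordK.
have psum_comp s t m : psum s t m \mPo f' = psum (s \mPo f') (t \mPo f') m.
  suff: psum s t m \mPo f' = psum (s \mPo f') (t \mPo f') m
     /\ psum s t m.+1 \mPo f' = psum (s \mPo f') (t \mPo f') m.+1 by case.
  elim: m => [|m [IH1 IH2]]; first by rewrite /psum rmorph_nat.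
  by split=> //; rewrite !psumSS rmorphB !rmorphM /= IH1 IH2.
have F0 : F \mPo f' = 0.
  have jl0 : xj - xl != 0 :> A.
    rewrite subr_eq0; apply/eqP => /(congr1 (fun p => p@_(U_(inord 1))%MM))/eqP.
    rewrite !mcoeffXU eqxx (_ : (inord 3 == inord 1 :> 'I_4) = false) //.
    by rewrite -val_eqE /= !inordK.
  have pif : pi_ n xj xl \mPo f' = pi_ n xj xl.
    by rewrite /pi_ rmorph_sum /=; apply: eq_bigr => s _; rewrite rmorphM !rmorphXn /= Ej El.
  have h1 : (u1 \mPo f') * (xk + xj - xk - xl)
      = psum (xk + xj) (xk * xj) n.+1 - psum (xk + xl) (xk * xj) n.+1.
    have := congr1 (comp_mpoly f') u1E.
    by rewrite !(rmorphB, rmorphM, rmorphD) /= !psum_comp !(rmorphM, rmorphD) /= Ei Ej Ek El.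
  have h2 : (u2 \mPo f') * (xk * xj - xk * xl)
      = psum (xk + xl) (xk * xj) n.+1 - psum (xk + xl) (xk * xl) n.+1.
    have := congr1 (comp_mpoly f') u2E.
    by rewrite !(rmorphB, rmorphM, rmorphD) /= !psum_comp !(rmorphM, rmorphD) /= Ei Ej Ek El.
  have -> : F \mPo f' = (u1 \mPo f') + xk * (u2 \mPo f') - pi_ n xj xl.
    by rewrite /F rmorphB rmorphD rmorphM /= Ei pif.
  by apply: (mulIf jl0); rewrite mul0r; apply: quotient_relation h1 h2.
have [|q] := @congr_comp 4 4 (xi - xk) f f' F.
  case=> [[|[|[|[|//]]]]] lt_i; rewrite tnth_mktuple (tnth_nth 0) /=.
  - by exists 1; rewrite mul1r; congr ('X_ _ - _); apply: val_inj; rewrite /= inordK.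
  - suff -> : Ordinal lt_i = inord 1 :> 'I_4 by apply: congr_modxx.
    by apply: val_inj; rewrite /= inordK.
  - suff -> : Ordinal lt_i = inord 2 :> 'I_4 by apply: congr_modxx.
    by apply: val_inj; rewrite /= inordK.
  - suff -> : Ordinal lt_i = inord 3 :> 'I_4 by apply: congr_modxx.
    by apply: val_inj; rewrite /= inordK.
by rewrite comp_mpoly_id F0 subr0 => hq; exists q; rewrite hq.
Qed.

Definition a1 : A := - u2 + xchoose a1_exists.

Lemma a1E : (a1 + u2) * (xi - xk) = u1 + xi * u2 - pi_ n xj xl.
Proof. by rewrite /a1 addrAC addNr add0r; exact/eqP/(xchooseP a1_exists). Qed.
End Local.

Section TheoryN.
Variables n p : nat.
Notation S := {mpoly rat[p]}.

Definition arc_n (l : 'I_p * 'I_p) : mfcomplex S int :=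
  mf_single (mf1 0 (1 - n%:Z) (pi_ n 'X_l.1 'X_l.2) ('X_l.1 - 'X_l.2)).

Section Crossing.
Variable c : crossing p.

Definition at_crossing (f : {mpoly rat[4]}) : S :=
  f \mPo [tuple 'X_(tl c); 'X_(tr c); 'X_(bl c); 'X_(br c)].

Let x_i : S := 'X_(tl c).
Let x_j : S := 'X_(tr c).
Let x_k : S := 'X_(bl c).
Let x_l : S := 'X_(br c).
Let v1 : S := at_crossing (u1 n).
Let v2 : S := at_crossing (u2 n).
Let b1 : S := at_crossing (a1 n).

Definition P0_n : mfact S int :=
  mf2 0 (2 - 2 * n%:Z) (1 - n%:Z) (1 - n%:Z)
    (mx2 (pi_ n x_i x_k) (x_j - x_l)
         (pi_ n x_j x_l) (- x_i + x_k))
    (mx2 (x_i - x_k) (x_j - x_l)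
         (pi_ n x_j x_l) (- pi_ n x_i x_k)).

Definition P1_n : mfact S int :=
  mf2 (-1) (3 - 2 * n%:Z) (- n%:Z) (2 - n%:Z)
    (mx2 v1 (x_i * x_j - x_k * x_l)
         v2 (- x_i - x_j + x_k + x_l))
    (mx2 (x_i + x_j - x_k - x_l) (x_i * x_j - x_k * x_l)
         v2 (- v1)).

Definition chi0_n : bool * 'I_2 -> bool * 'I_2 -> S :=
  map2 (mx2 (x_k - x_j) 0
            b1 1)
       (mx2 x_k (- x_j)
            (-1) 1).

Definition chi1_n : bool * 'I_2 -> bool * 'I_2 -> S :=
  map2 (mx2 1 0
            (- b1) (x_k - x_j))
       (mx2 1 x_j
            1 x_k).

Definition crossing_n : mfcomplex S int :=
  if positive c then
    @mf_arrow S int (-1) (mfshift n%:Z P1_n) (mfshift (n%:Z - 1) P0_n) chi1_n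
  else
    @mf_arrow S int 0 (mfshift (1 - n%:Z) P0_n) (mfshift (- n%:Z) P1_n) chi0_n.
End Crossing.

Variable D : diagram p.

Definition C_n : mfcomplex S int :=
  mf_bigtensor ([seq crossing_n c | c <- crossings D] ++ [seq arc_n l | l <- arcs D]).

(* H_n^{j,k}(D) is not 0. *)
Definition H_n_nz (j k : int) : Prop := HH_nz (fun _ => 2) C_n j k.
End TheoryN.

(* In R = Q[a, x_1, ..., x_p] the variable a comes first. *)
Section TheoryHat.
Variable p : nat.
Notation S := {mpoly rat[p.+1]}.
Notation G := (int * int)%type.

Definition va : S := 'X_ord0.
Definition vx (i : 'I_p) : S := 'X_(lift ord0 i).

Definition wt_hat (v : 'I_p.+1) : G := if v == ord0 then (2, 0) else (0, 2).

Definition arc_h (l : 'I_p * 'I_p) : mfcomplex S G :=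
  mf_single (mf1 (0, 0) (-1, 1) va (vx l.1 - vx l.2)).

Section Crossing.
Variable c : crossing p.
Let x_i : S := vx (tl c).
Let x_j : S := vx (tr c).
Let x_k : S := vx (bl c).
Let x_l : S := vx (br c).

Definition P0_h : mfact S G :=
  mf2 (0, 0) (-2, 2) (-1, 1) (-1, 1)
    (mx2 va (x_j - x_l)
         va (- x_i + x_k))
    (mx2 (x_i - x_k) (x_j - x_l)
         va (- va)).

Definition P1_h : mfact S G :=
  mf2 (0, 0) (-2, 4) (-1, 1) (-1, 3)
    (mx2 va (x_i * x_j - x_k * x_l)
         0 (- x_i - x_j + x_k + x_l))
    (mx2 (x_i + x_j - x_k - x_l) (x_i * x_j - x_k * x_l)
         0 (- va)).

Definition chi0_h : bool * 'I_2 -> bool * 'I_2 -> S :=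
  map2 (mx2 (x_k - x_j) 0
            0 1)
       (mx2 x_k (- x_j)
            (-1) 1).

Definition chi1_h : bool * 'I_2 -> bool * 'I_2 -> S :=
  map2 (mx2 1 0
            0 (x_k - x_j))
       (mx2 1 x_j
            1 x_k).

Definition crossing_h : mfcomplex S G :=
  if positive c then
    @mf_arrow S G 0 (mfshift (0, -2) P1_h) (mfshift (0, -2) P0_h) chi1_h
  else
    @mf_arrow S G (-1) (mfshift (0, 2) P0_h) P1_h chi0_h.
End Crossing.

Variable D : diagram p.

Definition C_h : mfcomplex S G :=
  mf_bigtensor ([seq crossing_h c | c <- crossings D] ++ [seq arc_h l | l <- arcs D]).

(* The part of H(D) in cohomological degree j, a-degree k, x-degree l is not 0. *)
Definition H_nz (j k l : int) : Prop := HH_nz wt_hat C_h j (k, l).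
End TheoryHat.

(* (e, i) is the crossing between the strands at the positions i and i + 1,
   positive when e = true; a word is read from bottom to top. *)
Definition braid_word (b : nat) : Type := seq (bool * 'I_b.-1).

Section ClosedBraid.
Variables (b : nat) (B : braid_word b).

Definition c_pos : nat := count (fun s => s.1) B.
Definition c_neg : nat := count (fun s => ~~ s.1) B.
Definition writhe : int := c_pos%:Z - c_neg%:Z.

(* The mark at position s just below the t-th crossing (just above the last
   crossing if t = size B). *)
Definition mark (t : 'I_(size B).+1) (s : 'I_b) : 'I_((size B).+1 * b)%N :=
  mxvec_index t s.

Fact strandR_subproof (i : 'I_b.-1) : (i.+1 < b)%N.
Proof. by rewrite -ltn_predRL. Qed.

Definition strandL (i : 'I_b.-1) : 'I_b := widen_ord (leq_pred b) i.
Definition strandR (i : 'I_b.-1) : 'I_b := Ordinal (strandR_subproof i).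

Definition below (t : 'I_(size B)) : 'I_(size B).+1 := widen_ord (leqnSn _) t.
Definition above (t : 'I_(size B)) : 'I_(size B).+1 := lift ord0 t.
Definition letter (t : 'I_(size B)) : bool * 'I_b.-1 := tnth (in_tuple B) t.

(* The closing arcs go from the top marks to the bottom marks; if B is empty
   they are circles with one mark. *)
Definition closed_braid : diagram ((size B).+1 * b)%N :=
  Diagram
    [seq Crossing (letter t).1
           (mark (above t) (strandL (letter t).2)) (mark (above t) (strandR (letter t).2))
           (mark (below t) (strandL (letter t).2)) (mark (below t) (strandR (letter t).2))
       | t <- enum 'I_(size B)]
    ([seq (mark (above t) s, mark (below t) s)
       | t <- enum 'I_(size B),
         s <- [seq s <- enum 'I_b | s \notin [:: strandL (letter t).2; strandR (letter t).2]]]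
     ++ [seq (mark ord0 s, mark ord_max s) | s <- enum 'I_b]).

(* \hat H^{j,k,l}(B) is not 0; the degrees are half-integers. *)
Definition hatH_nz (j k l : rat) : Prop :=
  exists j' k' l' : int,
    [/\ j = j'%:~R - (writhe%:~R + b%:R) / 2,
        k = k'%:~R + (writhe%:~R + b%:R) / 2,
        l = l'%:~R + (writhe%:~R + b%:R) / 2
      & H_nz closed_braid j' k' l'].
End ClosedBraid.

Definition is_max (d : Order.disp_t) (T : porderType d) (P : T -> Prop) (m : T) : Prop :=
  P m /\ forall k, P k -> (k <= m)%O.
Definition is_min (d : Order.disp_t) (T : porderType d) (P : T -> Prop) (m : T) : Prop :=
  P m /\ forall k, P k -> (m <= k)%O.

Definition is_hat_gmax (b : nat) (B : braid_word b) : rat -> Prop :=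
  is_max (fun k => exists j l, hatH_nz B j k l).
Definition is_hat_gmin (b : nat) (B : braid_word b) : rat -> Prop :=
  is_min (fun k => exists j l, hatH_nz B j k l).
Definition is_gmax (n b : nat) (B : braid_word b) : int -> Prop :=
  is_max (fun k => exists j, H_n_nz n (closed_braid B) j k).
Definition is_gmin (n b : nat) (B : braid_word b) : int -> Prop :=
  is_min (fun k => exists j, H_n_nz n (closed_braid B) j k).

(* Main.v *)
Require Import Defs.
From HB Require Import structures.
From mathcomp Require Import all_boot all_order all_algebra.
From mathcomp Require Import ring zify.
From mathcomp Require Import mpoly.
From Stdlib Require Import Classical.
(* Restores the names of Defs that the libraries above shadow. *)
Import Defs.
Set Implicit Arguments.
Unset Strict Implicit.
Unset Printing Implicit Defensive.
Import Order.TTheory GRing.Theory Num.Theory.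
Local Open Scope ring_scope.

(** Both theories are handled uniformly, through the exactness of complexes of free
    modules modulo ideals of the polynomial ring.

    Bounds: it suffices that H(C, d_mf) vanishes in the forbidden degrees.  The
    matrix factorization of an arc is a Koszul factor, so that it can be removed at
    the cost of adding x_i - x_j to the ideal.  Likewise a wide edge adds
    (x_i + x_j - x_k - x_l, x_i x_j - x_k x_l); modulo the first generator the second
    one is -(x_i - x_k)(x_i - x_l), hence the quotient is an extension of the quotients
    for the two ways of connecting the strands (x_i = x_l, x_j = x_k and, with a shift,
    x_i = x_k, x_j = x_l).  In this way only the closing arcs remain, over polynomials in
    the b bottom variables.  The lower bounds are then the lowest degrees of these
    complexes.  For the upper bounds, x^n (respectively a) is null-homotopic for each
    bottom variable x, through a homotopy of degree n - 1 (respectively of a-degree 1);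
    so the passage to the quotient by x^n raises the top degree of the cohomology by
    n - 1, and modulo all the x^n the top degree is at most 2(n - 1)b.

    Nonvanishing: if the iterated homology were 0, the complex with differential
    d_mf + d_chi (up to signs) would be exact, hence also its reduction modulo the
    variables, one after the other.  But some basis vector is a cycle of the latter and
    its coordinate is 0 on all boundaries. *)

(** * Exactness modulo an ideal *)

Section Matrices.
Variable S : comNzRingType.

(** Once a tensor factor is removed, [dmf] squares on the rest to a potential W which is not 0 and
    only lies in the ideal accumulated so far. Hence no quotient complex is formed: exactness is
    stated for polynomials modulo an ideal, and the membership of W is carried along. At an arc or a
    crossing, regularity is tested modulo kernels of substitutions, which are prime, so it amounts
    to the nonvanishing of an image. A mark is always replaced by marks of lower level, which keeps
    the substitutions idempotent. The closing arcs escape this scheme: both ends have become bottom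
    variables, possibly equal, so x_i - x_j may be 0. What remains is that (n + 1) x^n is congruent
    to the other entry modulo x_i - x_j. Killing b powers costs (n - 1) b of the top degree 2 (n -
    1) b, which leaves (n - 1) b; for the variable a the cost 1 turns the top degree 0 into -1. The
    crossings only contribute shifts: n - 1 or n + 1 for a positive one, 1 - n or - n - 1 for a
    negative one, and 0 in the a-degree. This is where 2 c_+ and 2 c_- come from. *)

Definition ap (T : finType) (d : T -> T -> S) (z : T -> S) (r : T) : S :=
  \sum_c d r c * z c.

Definition cmp (T : finType) (d d' : T -> T -> S) (r c : T) : S :=
  \sum_k d r k * d' k c.

Lemma eq_ap (T : finType) (d : T -> T -> S) z z' r :
  z =1 z' -> ap d z r = ap d z' r.
Proof. by move=> h; apply: eq_bigr => c _; rewrite h. Qed.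

Lemma apB (T : finType) (d : T -> T -> S) z z' r :
  ap d (fun e => z e - z' e) r = ap d z r - ap d z' r.
Proof. by rewrite -sumrB; apply: eq_bigr => c _; rewrite mulrBr. Qed.

Lemma apD (T : finType) (d : T -> T -> S) z z' r :
  ap d (fun e => z e + z' e) r = ap d z r + ap d z' r.
Proof. by rewrite -big_split; apply: eq_bigr => c _; rewrite mulrDr. Qed.

Lemma apZ (T : finType) (d : T -> T -> S) f z r :
  ap d (fun e => f * z e) r = f * ap d z r.
Proof. by rewrite mulr_sumr; apply: eq_bigr => c _; rewrite mulrCA. Qed.

Lemma ap_comp (T : finType) (d d' : T -> T -> S) z r :
  ap d (ap d' z) r = ap (cmp d d') z r.
Proof.
rewrite /ap; under eq_bigr do rewrite mulr_sumr.
rewrite exchange_big; apply: eq_bigr => c _.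
by rewrite mulr_suml; apply: eq_bigr => k _; rewrite mulrA.
Qed.

Lemma ap_diag (T : finType) (d : T -> T -> S) w z r :
  (forall r c, d r c = w *+ (r == c)) -> ap d z r = w * z r.
Proof.
move=> h; rewrite /ap (bigD1 r) //= h eqxx mulr1n big1 ?addr0 // => c /negPf nrc.
by rewrite h eq_sym nrc mul0r.
Qed.

(** One shape for all operators on a tensor product: [s] is the parity sign for [dmf] and the sign
    of the cohomological degree for [dchi]; homotopies are obtained by taking [d1] or [d2] to be
    0. *)
Definition tmx (T1 T2 : finType) (d1 : T1 -> T1 -> S) (s : T1 -> S) (d2 : T2 -> T2 -> S)
    (r c : T1 * T2) : S :=
  d1 r.1 c.1 *+ (r.2 == c.2) + s c.1 * d2 r.2 c.2 *+ (r.1 == c.1).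

Lemma sum_pairl (T1 T2 : finType) (F : T1 * T2 -> S) (b : T2) :
  \sum_k F k *+ (b == k.2) = \sum_a F (a, b).
Proof.
rewrite (eq_bigr (fun k => F (k.1, k.2) *+ (b == k.2))); last by case.
rewrite -(pair_bigA _ (fun x y => F (x, y) *+ (b == y))) /=.
apply: eq_bigr => x _; rewrite (bigD1 b) //= eqxx mulr1n big1 ?addr0 // => y /negPf h.
by rewrite eq_sym h.
Qed.

Lemma sum_pairr (T1 T2 : finType) (F : T1 * T2 -> S) (a : T1) :
  \sum_k F k *+ (a == k.1) = \sum_b F (a, b).
Proof.
rewrite (eq_bigr (fun k => F (k.1, k.2) *+ (a == k.1))); last by case.
rewrite -(pair_bigA _ (fun x y => F (x, y) *+ (a == x))) /= exchange_big /=.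
apply: eq_bigr => x _; rewrite (bigD1 a) //= eqxx mulr1n big1 ?addr0 // => y /negPf h.
by rewrite eq_sym h.
Qed.

Lemma ap_tmx (T1 T2 : finType) (d1 : T1 -> T1 -> S) s (d2 : T2 -> T2 -> S) z r1 r2 :
  ap (tmx d1 s d2) z (r1, r2)
  = ap d1 (fun c => z (c, r2)) r1 + s r1 * ap d2 (fun c => z (r1, c)) r2.
Proof.
rewrite /ap /tmx /=; under eq_bigr do rewrite mulrDl !mulrnAl.
rewrite big_split /= (sum_pairl (fun k => d1 r1 k.1 * z k)).
rewrite (sum_pairr (fun k => s k.1 * d2 r2 k.2 * z k)) /= mulr_sumr.
by congr (_ + _); apply: eq_bigr => c _; rewrite mulrA.
Qed.

(** The two cross terms in the middle cancel in a square when [s] anticommutes with [d1]; they are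
    exchanged by swapping the two operators when each sign commutes with the other operator. *)
Lemma cmp_tmx (T1 T2 : finType) (d1 d1' : T1 -> T1 -> S) s s' (d2 d2' : T2 -> T2 -> S) r c :
  cmp (tmx d1 s d2) (tmx d1' s' d2') r c
  = cmp d1 d1' r.1 c.1 *+ (r.2 == c.2)
    + (d1 r.1 c.1 * s' c.1) * d2' r.2 c.2
    + (s r.1 * d1' r.1 c.1) * d2 r.2 c.2
    + (s r.1 * s' r.1) * cmp d2 d2' r.2 c.2 *+ (r.1 == c.1).
Proof.
case: r c => r1 r2 [c1 c2] /=.
have -> : cmp (tmx d1 s d2) (tmx d1' s' d2') (r1, r2) (c1, c2)
   = ap (tmx d1 s d2) (fun k => tmx d1' s' d2' k (c1, c2)) (r1, r2) by [].
rewrite ap_tmx /tmx /= !apD; rewrite mulrDr.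
have e1 : ap d1 (fun e => d1' e c1 *+ (r2 == c2)) r1 = cmp d1 d1' r1 c1 *+ (r2 == c2).
  by rewrite /ap /cmp -sumrMnl; apply: eq_bigr => i _; rewrite mulrnAr.
have e2 : ap d1 (fun e => s' c1 * d2' r2 c2 *+ (e == c1)) r1 = d1 r1 c1 * s' c1 * d2' r2 c2.
  rewrite /ap (bigD1 c1) //= eqxx big1 ?addr0 ?mulr1n ?mulrA // => e /negPf ->.
  by rewrite mulr0.
have e3 : ap d2 (fun e => d1' r1 c1 *+ (e == c2)) r2 = d1' r1 c1 * d2 r2 c2.
  rewrite /ap (bigD1 c2) //= eqxx big1 ?addr0 ?mulr1n 1?mulrC // => e /negPf ->.
  by rewrite mulr0.
have e4 : ap d2 (fun e => s' c1 * d2' e c2 *+ (r1 == c1)) r2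
    = s' r1 * cmp d2 d2' r2 c2 *+ (r1 == c1).
  rewrite /ap /cmp mulr_sumr -sumrMnl; apply: eq_bigr => i _.
  by case: (eqVneq r1 c1) => [->|_]; rewrite ?mulr0n ?mulr0 // !mulr1n mulrCA.
by rewrite e1 e2 e3 e4 mulrnAr !mulrA !addrA.
Qed.
End Matrices.

Section Ideals.
Variable S : comNzRingType.
Implicit Types (I J : S -> Prop) (f g q : S).

Definition ideal I : Prop :=
  [/\ I 0, forall f g, I f -> I g -> I (f + g) & forall f g, I g -> I (f * g)].

Definition adj I q f : Prop := exists y, I (f - q * y).

Definition regular I q : Prop := forall f, I (q * f) -> I f.

Section One.
Variable I : S -> Prop.
Hypothesis hI : ideal I.

Lemma id0 : I 0. Proof. by case: hI. Qed.
Lemma idD f g : I f -> I g -> I (f + g). Proof. by case: hI => _ h _; apply: h. Qed.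
Lemma idM f g : I g -> I (f * g). Proof. by case: hI => _ _ h; apply: h. Qed.
Lemma idN f : I f -> I (- f). Proof. by rewrite -mulN1r; apply: idM. Qed.
Lemma idB f g : I f -> I g -> I (f - g).
Proof. by move=> hf hg; apply/idD/idN. Qed.
Lemma idDr f g : I (f + g) -> I g -> I f.
Proof. by move=> h hg; rewrite -(addrK g f); apply: idB. Qed.

Lemma id_ap (T : finType) (d : T -> T -> S) z r : (forall c, I (z c)) -> I (ap d z r).
Proof. by move=> h; apply: big_ind => [||i _]; [exact: id0|exact: idD|exact/idM]. Qed.

Lemma ideal_adj q : ideal (adj I q).
Proof.
split; first by exists 0; rewrite mulr0 subrr; apply: id0.
- move=> f g [y hy] [y' hy']; exists (y + y').
  by have := idD hy hy'; congr I; ring.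
- by move=> f g [y hy]; exists (f * y); have := idM f hy; congr I; ring.
Qed.

Lemma adj_sub q f : I f -> adj I q f.
Proof. by move=> h; exists 0; rewrite mulr0 subr0. Qed.

Lemma adj_gen q : adj I q q.
Proof. by exists 1; rewrite mulr1 subrr; apply: id0. Qed.
End One.

(* A cycle and a boundary are understood modulo I, and the condition is imposed
   only on the cycles in Z. *)
Definition exact I (T : finType) (d : T -> T -> S) (Z : (T -> S) -> Prop) : Prop :=
  forall z, Z z -> (forall r, I (ap d z r)) -> exists w, forall r, I (z r - ap d w r).

Lemma eq_exact I I' (T : finType) (d : T -> T -> S) Z :
  (forall f, I f <-> I' f) -> exact I d Z -> exact I' d Z.
Proof.
move=> e h z hz hd; have [|w hw] := h z hz; first by move=> r; apply/e.
by exists w => r; apply/e.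
Qed.

(* If q annihilates the cohomology modulo I, through the homotopy h, then
   multiplication by q vanishes in the long exact sequence of S/I -q-> S/I. *)
Lemma exact_homotopy I q W (T : finType) (d h : T -> T -> S) (Z Z' : (T -> S) -> Prop) :
  ideal I -> regular I q -> I W ->
  (forall r c, cmp d d r c = W *+ (r == c)) ->
  (forall r c, cmp d h r c + cmp h d r c = q *+ (r == c)) ->
  (forall z, Z z -> Z' (ap h z)) ->
  exact (adj I q) d Z' -> exact I d Z.
Proof.
move=> hI reg IW d2 dh hZ ex z zZ dz.
have key r : ap d (ap h z) r + ap h (ap d z) r = q * z r.
  rewrite !ap_comp -(@ap_diag _ _ (fun r c => cmp d h r c + cmp h d r c) q z r dh).
  by rewrite /ap -big_split; apply: eq_bigr => c _; rewrite mulrDl.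
have [r|w hw] := ex _ (hZ _ zZ).
  by exists (z r); rewrite -key opprD addrA subrr add0r; apply: idN => //; apply: id_ap.
have {}hw : forall r, exists y, I (ap h z r - ap d w r - q * y) by move=> r; apply: hw.
have [y hy] := fin_all_exists hw.
exists y => r; apply: reg; rewrite mulrBr -key.
(* Apply d to h z = d w + q y: up to W w and h d z, which vanish modulo I, this says that q (z - d
   y) lies in I. *)
have := id_ap hI d r hy; rewrite !apB apZ (ap_comp d d) (ap_diag _ _ d2) => h1.
have h2 : I (ap h (ap d z) r) by apply: id_ap.
have := idD hI (idD hI h1 (idM hI (w r) IW)) h2; congr I; ring.
Qed.

(** Long exact sequence of 0 -> S/I -> S/I -> S/(I, q) -> 0, the first map being multiplication by
    q: if S/I has no cohomology, neither has the quotient. The nonvanishing argument applies this to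
    one variable at a time. *)
Lemma exact_quotient I q W (T : finType) (d : T -> T -> S) :
  ideal I -> regular I q -> I W ->
  (forall r c, cmp d d r c = W *+ (r == c)) ->
  exact I d (fun _ => True) -> exact (adj I q) d (fun _ => True).
Proof.
move=> hI reg IW d2 ex z _ dz.
have {}dz : forall r, exists y, I (ap d z r - q * y) by move=> r; apply: dz.
have [y hy] := fin_all_exists dz.
have [//|r|w hw] := ex y.
  apply: reg; have := id_ap hI d r hy.
  rewrite apB apZ (ap_comp d d) (ap_diag _ _ d2) => h.
  by have := idB hI (idM hI (z r) IW) h; congr I; ring.
have [//|r|v hv] := ex (fun e => z e - q * w e).
  by rewrite apB apZ; have := idD hI (hy r) (idM hI q (hw r)); congr I; ring.
by exists v => r; exists (w r); have := hv r; congr I; ring.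
Qed.
End Ideals.

(** * Weights, substitutions and monomial ideals *)

Section Weights.
Variables (N : nat) (G : zmodType) (wt : 'I_N -> G).
Notation S := {mpoly rat[N]}.
Implicit Types (f h p q : S) (g : G).

Definition mwt (m : 'X_{1..N}) : G := \sum_(i < N) wt i *+ m i.

Definition hom f g : bool := all (fun m => mwt m == g) (msupp f).

Lemma homE f g m : hom f g -> m \in msupp f -> mwt m = g.
Proof. by move=> /allP h /h /eqP. Qed.

Definition pr g f : S := \sum_(m <- msupp f | mwt m == g) f@_m *: 'X_[m].

Lemma mwtD m m' : mwt (m + m')%MM = mwt m + mwt m'.
Proof. by rewrite -big_split; apply: eq_bigr => i _; rewrite mnmDE mulrnDr. Qed.

Lemma mwtU i : mwt U_(i)%MM = wt i.
Proof.
rewrite /mwt (bigD1 i) //= mnm1E eqxx mulr1n big1 ?addr0 // => j /negPf h.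
by rewrite mnm1E eq_sym h.
Qed.

Lemma mcoeff_pr g f m : (pr g f)@_m = f@_m *+ (mwt m == g).
Proof.
rewrite /pr raddf_sum /=; under eq_bigr do rewrite mcoeffZ mcoeffX.
case: (boolP (m \in msupp f)) => hm.
  rewrite big_mkcond (bigD1_seq m) ?msupp_uniq //= eqxx mulr1 big1_seq ?addr0.
    by case: ifP.
  by move=> k /andP[/negPf-> _]; rewrite mulr0 if_same.
rewrite (memN_msupp_eq0 hm) mul0rn big1_seq // => k /andP[_ hk].
by case: eqVneq => [e|_]; [rewrite -e hk in hm|rewrite mulr0].
Qed.

Lemma homP f g : hom f g <-> pr g f = f.
Proof.
split=> h.
  apply/mpolyP => m; rewrite mcoeff_pr.
  case: (boolP (m \in msupp f)) => hm; first by rewrite (homE h hm) eqxx.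
  by rewrite (memN_msupp_eq0 hm) mul0rn.
apply/allP => m; rewrite mcoeff_msupp -h mcoeff_pr; case: (mwt m =P g) => // _; rewrite mulr0n eqxx.
Qed.

Fact pr_is_additive g : additive (pr g).
Proof.
move=> f h; apply/mpolyP => m; rewrite mcoeffB !mcoeff_pr mcoeffB.
by case: (_ == _); rewrite ?mulr1n ?mulr0n ?subr0.
Qed.

HB.instance Definition _ g :=
  GRing.isZmodMorphism.Build S S (pr g) (pr_is_additive g).

Lemma pr_Z g (c : rat) f : pr g (c *: f) = c *: pr g f.
Proof. by apply/mpolyP => m; rewrite !(mcoeffZ, mcoeff_pr) mulrnAr. Qed.

Lemma hom_pr g f : hom (pr g f) g.
Proof. by apply/homP/mpolyP => m; rewrite !mcoeff_pr; case: (_ == _); rewrite ?mulr1n. Qed.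

Lemma pr_eq0 g g' f : hom f g -> g' != g -> pr g' f = 0.
Proof.
move=> /homP <- ne; apply/mpolyP => m; rewrite !mcoeff_pr mcoeff0.
by case: (mwt m =P g') => [->|_]; rewrite ?mulr0n // (negPf ne) mulr0n mul0rn.
Qed.

Lemma hom0 g : hom 0 g.
Proof. by rewrite /hom msupp0. Qed.

Lemma homD f h g : hom f g -> hom h g -> hom (f + h) g.
Proof. by move=> /homP hf /homP hh; apply/homP; rewrite raddfD /= hf hh. Qed.

Lemma homN f g : hom f g -> hom (- f) g.
Proof. by move=> /homP hf; apply/homP; rewrite raddfN /= hf. Qed.

Lemma homB f h g : hom f g -> hom h g -> hom (f - h) g.
Proof. by move=> hf hh; exact: homD hf (homN hh). Qed.

Lemma homZ (c : rat) f g : hom f g -> hom (c *: f) g.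
Proof. by move=> /homP hf; apply/homP; rewrite pr_Z hf. Qed.

Lemma homMn f g k : hom f g -> hom (f *+ k) g.
Proof. by move=> hf; rewrite -scaler_nat; apply: homZ. Qed.

Lemma hom_sum (T : Type) (r : seq T) (P : pred T) (F : T -> S) g :
  (forall i, P i -> hom (F i) g) -> hom (\sum_(i <- r | P i) F i) g.
Proof. by move=> h; apply: (big_ind (fun x => hom x g)) => //; [apply: hom0|move=> *; apply: homD]. Qed.

Lemma homM f h g g' : hom f g -> hom h g' -> hom (f * h) (g + g').
Proof.
move=> hf hh; apply/allP => m /msuppM_le /allpairsP[[m1 m2] /= [/(homE hf) <- /(homE hh) <- ->]].
by rewrite mwtD.
Qed.

Lemma hom1 : hom 1 0.
Proof.
by rewrite /hom msupp1 /= andbT /mwt big1 // => i _; rewrite mnm0E mulr0n.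
Qed.

Lemma homX i : hom 'X_i (wt i).
Proof. by rewrite /hom msuppX /= mwtU eqxx. Qed.

Lemma homXn f g k : hom f g -> hom (f ^+ k) (g *+ k).
Proof.
move=> hf; elim: k => [|k IH]; first by rewrite expr0 mulr0n; apply: hom1.
by rewrite exprS mulrS; apply: homM.
Qed.

Lemma hom_prod (F : 'I_N -> S) (m : 'X_{1..N}) :
  (forall i, hom (F i) (wt i)) -> hom (\prod_(i < N) F i ^+ m i) (mwt m).
Proof.
move=> h; rewrite /mwt; elim/big_rec2: _ => [|i x y _ IH]; first exact: hom1.
by apply: homM => //; apply: homXn.
Qed.

Lemma pr_mul f h d g : hom f d -> pr (d + g) (f * h) = f * pr g h.
Proof.
move=> hf; apply/mpolyP => m; rewrite mcoeff_pr !mcoeffM -sumrMnl.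
apply: eq_bigr => -[k1 k2] /= /eqP em; rewrite mcoeff_pr (congr1 mwt em) mwtD -mulrnAr.
case: (boolP ((k1 : 'X_{1..N}) \in msupp f)) => hk.
  by rewrite (homE hf hk) (inj_eq (addrI d)).
by rewrite (memN_msupp_eq0 hk) !mul0r.
Qed.

(** The polynomials [u1], [u2], [a1] are known only through the equations which they solve as exact
    quotients; in a domain such an equation determines the degree of the quotient. *)
Lemma hom_factor f h d g : h != 0 -> hom h d -> hom (h * f) (d + g) -> hom f g.
Proof.
move=> h0 hh hfh; apply/homP/(mulfI h0).
by rewrite -(pr_mul _ _ hh); apply/homP.
Qed.

End Weights.

Section Substitution.
Variable N : nat.
Notation S := {mpoly rat[N]}.
Implicit Types (F : 'I_N -> S) (f h p q : S).

Definition sub F p : S := p \mPo [tuple F i | i < N].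

Fact sub_is_additive F : additive (sub F).
Proof. exact: comp_mpoly_is_additive. Qed.

Fact sub_is_multiplicative F : monoid_morphism (sub F).
Proof. by split; [apply: comp_mpoly1|move=> f h; rewrite /sub rmorphM]. Qed.

HB.instance Definition _ F :=
  GRing.isZmodMorphism.Build S S (sub F) (sub_is_additive F).
HB.instance Definition _ F :=
  GRing.isMonoidMorphism.Build S S (sub F) (sub_is_multiplicative F).

Lemma sub_X F i : sub F 'X_i = F i.
Proof. by rewrite /sub comp_mpolyXU -tnth_nth tnth_mktuple. Qed.

Lemma subZ F (c : rat) p : sub F (c *: p) = c *: sub F p.
Proof. exact: comp_mpolyZ. Qed.

Lemma subE F p : sub F p = \sum_(m <- msupp p) p@_m *: \prod_(i < N) F i ^+ m i.
Proof.
rewrite /sub comp_mpolyE; apply: eq_bigr => m _; congr (_ *: _).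
by apply: eq_bigr => i _; rewrite tnth_mktuple.
Qed.

Lemma sub_sub F F' F'' p : (forall i, sub F (F' i) = F'' i) -> sub F (sub F' p) = sub F'' p.
Proof.
move=> h; rewrite (subE F') (subE F'') raddf_sum; apply: eq_bigr => m _ /=.
rewrite subZ rmorph_prod; congr (_ *: _); apply: eq_bigr => i _.
by rewrite rmorphXn /= h.
Qed.

Definition ker F f : Prop := sub F f = 0.

Lemma ideal_ker F : ideal (ker F).
Proof.
rewrite /ker; split; first by rewrite rmorph0.
  by move=> f h hf hh; rewrite rmorphD /= hf hh addr0.
by move=> f h hh; rewrite rmorphM /= hh mulr0.
Qed.

Lemma regular_ker F q : sub F q != 0 -> regular (ker F) q.
Proof.
by move=> q0 f; rewrite /ker rmorphM => /eqP; rewrite mulf_eq0 (negPf q0) => /eqP.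
Qed.

(** A congruence between two substitutions need only be checked on the variables. For f in [ker F']
    it makes [sub F f] a multiple of the image of q, and the idempotence of F lifts this back to f
    modulo [ker F]. *)
Lemma ker_adj F F' q f :
  (forall i, sub F (F i) = F i) -> (forall i, sub F' (F i) = F' i) ->
  sub F' q = 0 -> (forall i, congr_mod (sub F q) (F i) (F' i)) ->
  ker F' f <-> adj (ker F) q f.
Proof.
move=> FF F'F F'q hF; split.
  rewrite /ker => hf.
  have [|y] := @congr_comp N N (sub F q) [tuple F i | i < N] [tuple F' i | i < N] f.
    by move=> i; rewrite !tnth_mktuple.
  rewrite -/(sub F f) -/(sub F' f) hf subr0 => hy; exists y.
  apply/eqP; rewrite rmorphB /= subr_eq0 -{1}(sub_sub f FF) -hy.
  by rewrite !rmorphM /= (sub_sub q FF) mulrC.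
case=> y; rewrite /ker => hy.
have : sub F' (f - q * y) = 0 by rewrite -(sub_sub _ F'F) hy rmorph0.
by rewrite rmorphB rmorphM /= F'q mul0r subr0.
Qed.

Lemma sub_pr (G : zmodType) (wt : 'I_N -> G) F g f :
  (forall i, hom wt (F i) (wt i)) -> sub F (pr wt g f) = pr wt g (sub F f).
Proof.
move=> hF; rewrite (subE F f) (raddf_sum (pr wt g)) /= [in LHS]/pr rmorph_sum /= big_mkcond /=.
apply: eq_bigr => m _.
have hm := hom_prod m hF; rewrite pr_Z.
have -> : sub F (f@_m *: 'X_[m]) = f@_m *: \prod_(i < N) F i ^+ m i.
  rewrite subZ mpolyXE_id rmorph_prod; congr (_ *: _); apply: eq_bigr => i _.
  by rewrite rmorphXn /= sub_X.
case: eqVneq => [e|ne]; first by congr (_ *: _); apply/esym/homP; rewrite -e.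
by rewrite (pr_eq0 hm) ?scaler0 // eq_sym.
Qed.

Lemma hom_sub (G : zmodType) (wt : 'I_N -> G) F f g :
  (forall i, hom wt (F i) (wt i)) -> hom wt f g -> hom wt (sub F f) g.
Proof. by move=> hF /homP hf; apply/homP; rewrite -sub_pr // hf. Qed.

(** The ideal generated by the n-th powers of the variables in K; it is monomial, so membership is
    read off from the support. *)
Definition mon (n : nat) (K : seq 'I_N) f : bool :=
  all (fun m : 'X_{1..N} => has (fun s => (n <= m s)%N) K) (msupp f).

Lemma mon_nil n f : mon n [::] f <-> f = 0.
Proof.
split=> [|->]; last by rewrite /mon msupp0.
by rewrite /mon => h; apply/eqP; rewrite -msupp_eq0; case: (msupp f) h.
Qed.

Lemma ideal_mon n K : ideal (mon n K).
Proof.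
split=> [|f h /allP hf /allP hh|f h /allP hh]; first by rewrite /mon msupp0.
  by apply/allP=> m /msuppD_le; rewrite mem_cat => /orP[/hf|/hh].
apply/allP => m /msuppM_le /allpairsP[[m1 m2] /= [_ /hh + ->]].
by apply: sub_has => s /leq_trans -> //; rewrite mnmDE leq_addl.
Qed.

(** When tau is idempotent and fixes K, this preimage is the sum of the kernel of tau and of the
    ideal generated by the x_s^n for s in K. *)
Definition monker (tau : 'I_N -> 'I_N) n K f : bool := mon n K (sub (fun i => 'X_(tau i)) f).

Section Tau.
Variable tau : 'I_N -> 'I_N.
Local Notation F := (fun i => 'X_(tau i)).

Definition mtau (m : 'X_{1..N}) : 'X_{1..N} := (\sum_(i < N) U_(tau i) *+ m i)%MM.

Lemma mtauE m s : mtau m s = (\sum_(i < N | tau i == s) m i)%N.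
Proof.
rewrite /mtau mnm_sumE [RHS]big_mkcond; apply: eq_bigr => i _.
by rewrite mulmnE mnm1E; case: eqVneq; rewrite ?mul1n ?mul0n.
Qed.

Lemma msupp_tau f m : m \in msupp (sub F f) -> exists2 m', m' \in msupp f & m = mtau m'.
Proof.
rewrite subE => /msupp_sum_le /flattenP[/= _ /mapP[m' hm' ->]].
have -> : \prod_(i < N) F i ^+ m' i = 'X_[mtau m'] :> S.
  by rewrite /mtau (big_morph _ (@mpolyXD _ _) (@mpolyX0 _ _)); apply: eq_bigr => i _; rewrite mpolyXn.
rewrite mem_filter /= in hm'; move/msuppZ_le; rewrite msuppX inE => /eqP ->.
by exists m'.
Qed.

Lemma mon_sub n K f : (forall s, s \in K -> tau s = s) -> mon n K f -> mon n K (sub F f).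
Proof.
move=> hK /allP hf; apply/allP => m /msupp_tau[m' /hf /hasP[s sK hs] ->].
apply/hasP; exists s => //; apply: leq_trans hs _.
by rewrite mtauE (bigD1 s) ?hK //= leq_addr.
Qed.

Lemma ideal_monker n K : ideal (monker tau n K).
Proof.
have [h0 hD hM] := ideal_mon n K; rewrite /monker; split; first by rewrite rmorph0.
  by move=> f h hf hh; rewrite rmorphD; apply: hD.
by move=> f h hh; rewrite rmorphM; apply: hM.
Qed.

Lemma monker_ker n K f : ker F f -> monker tau n K f.
Proof. by rewrite /monker /ker => ->; rewrite /mon msupp0. Qed.

Lemma monker_nil n f : monker tau n [::] f <-> ker F f.
Proof. exact: mon_nil. Qed.

(** Multiplication by x_s^n changes only the exponent of s, on which the variables of K impose no
    condition. *)
Lemma regular_monker n K s : s \notin K -> tau s = s -> regular (monker tau n K) ('X_s ^+ n).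
Proof.
move=> sK ts f; rewrite /monker rmorphM rmorphXn /= sub_X ts mpolyXn mulrC => /allP h; apply/allP => m hm.
have /h/hasP[t tK ht] : (U_(s) *+ n + m)%MM \in msupp (sub F f * 'X_[U_(s) *+ n]).
  by rewrite mcoeff_msupp mcoeffMX -mcoeff_msupp.
apply/hasP; exists t => //; move: ht; rewrite mnmDE mulmnE mnm1E.
by case: eqVneq => [e|_]; rewrite ?mul0n ?add0n //; rewrite e tK in sK.
Qed.

Lemma monker_cons n K s f : (forall i, tau (tau i) = tau i) ->
  (forall t, t \in K -> tau t = t) -> tau s = s ->
  monker tau n (s :: K) f <-> adj (monker tau n K) ('X_s ^+ n) f.
Proof.
move=> tt tK ts; split; last first.
  case=> y; rewrite /monker rmorphB rmorphM rmorphXn /= sub_X ts.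
  move=> /allP h; apply/allP => m; rewrite -{1}(subrK ('X_s ^+ n * sub F y) (sub F f)).
  move=> /msuppD_le; rewrite mem_cat => /orP[/h hK|]; first by rewrite /= hK orbT.
  move=> /msuppM_le /allpairsP[[m1 m2] /= [+ _ ->]].
  rewrite mpolyXn msuppX inE => /eqP ->.
  by rewrite mnmDE mulmnE mnm1E eqxx mul1n leq_addr.
move=> /allP h; set p := sub F f.
(* Write p = x_s^n y + z: [y] takes the monomials divisible by x_s^n, divided by it, and [z] takes
   the others, which must lie in the ideal thanks to K alone. *)
pose y := \sum_(m <- msupp p | (n <= m s)%N) p@_m *: 'X_[(m - U_(s) *+ n)%MM] : S.
pose z := \sum_(m <- msupp p | ~~ (n <= m s)%N) p@_m *: 'X_[m] : S.
exists y; rewrite /monker rmorphB rmorphM rmorphXn /= sub_X ts -/p.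
have Ep : p = 'X_s ^+ n * y + z.
  rewrite {1}(mpolyE p) (bigID (fun m : 'X_{1..N} => (n <= m s)%N)) /=; congr (_ + _).
  rewrite mulr_sumr; apply: eq_bigr => m hm; rewrite -scalerAr mpolyXn -mpolyXD.
  congr (_ *: 'X_[_]); apply/mnmP => i; rewrite mnmDE mnmBE mulmnE mnm1E.
  by case: eqVneq => [<-|_]; rewrite ?mul0n ?subn0 // mul1n subnKC.
have mz : mon n K z.
  apply/allP => m /msupp_sum_le /flattenP[/= _ /mapP[m' + ->]].
  rewrite mem_filter => /andP[hm' /h /=]; rewrite (negPf hm') /=.
  by move=> hK /msuppZ_le; rewrite msuppX inE => /eqP ->.
have Fp : sub F p = p by apply: sub_sub => i; rewrite sub_X tt.
have : sub F p = 'X_s ^+ n * sub F y + sub F z.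
  by rewrite [in LHS]Ep rmorphD rmorphM rmorphXn /= sub_X ts.
by rewrite Fp => ->; rewrite addrC addKr; apply: mon_sub.
Qed.
End Tau.
End Substitution.

(** * Tensor products of complexes *)

Lemma sign_coh (S : comNzRingType) (a : int) :
  (-1) ^+ absz (a + 1) = - (-1) ^+ absz a :> S.
Proof.
rewrite -signr_odd -[in RHS]signr_odd -signrN; congr ((-1) ^+ (nat_of_bool _)).
by lia.
Qed.

Section Complexes.
Variables (N : nat) (G : zmodType) (wt : 'I_N -> G) (delta : G).
Notation S := {mpoly rat[N]}.
Implicit Types (C D : mfcomplex S G) (M : mfact S G) (W : S).

(** The potential W is not 0 in general: the local factors have nonzero potentials, which cancel
    only on the closed diagram. The parameter [delta] is the degree of [dmf]: n + 1 for H_n and (1,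
    1) for the triply graded theory. *)
Record good C W : Prop := Good {
  good_dd : forall r c, cmp (@dmf _ _ C) (@dmf _ _ C) r c = W *+ (r == c);
  good_xx : forall r c, cmp (@dchi _ _ C) (@dchi _ _ C) r c = 0;
  good_dx : forall r c,
    cmp (@dmf _ _ C) (@dchi _ _ C) r c = cmp (@dchi _ _ C) (@dmf _ _ C) r c;
  good_dpar : forall r c : basis C, par r = par c -> dmf r c = 0;
  good_dcoh : forall r c : basis C, coh r != coh c -> dmf r c = 0;
  good_xpar : forall r c : basis C, par r != par c -> dchi r c = 0;
  good_xcoh : forall r c : basis C, coh r != coh c + 1 -> dchi r c = 0;
  good_dhom : forall r c : basis C, hom wt (dmf r c) (gr c + delta - gr r);
  good_xhom : forall r c : basis C, hom wt (dchi r c) (gr c - gr r) }.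

(** The parity sign anticommutes with [dmf] and commutes with [dchi], and the cohomological sign
    does the opposite. So the cross terms of [cmp_tmx] cancel in the two squares and agree in the
    two mixed composites. *)
Lemma good_tensor C D W W' : good C W -> good D W' -> good (mf_tensor C D) (W + W').
Proof.
move=> gC gD.
pose s (c : basis C) : S := (-1) ^+ par c.
pose s' (c : basis C) : S := (-1) ^+ `|coh c|%N.
have Ed : @dmf _ _ (mf_tensor C D) = tmx (@dmf _ _ C) s (@dmf _ _ D) := erefl.
have Ex : @dchi _ _ (mf_tensor C D) = tmx (@dchi _ _ C) s' (@dchi _ _ D) := erefl.
have ss r : s r * s r = 1 by rewrite -expr2 sqrr_sign.
have ss' r : s' r * s' r = 1 by rewrite -expr2 sqrr_sign.
have sd r c : s r * dmf r c = - (dmf r c * s c).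
  rewrite mulrC /s; case: (eqVneq (par r) (par c)) => [/(good_dpar gC) ->|].
    by rewrite !mul0r oppr0.
  by case: (par r) (par c) => [] [] //= _; rewrite ?mulrN1 ?mulr1 ?opprK.
have sx r c : s' r * dchi r c = - (dchi r c * s' c).
  rewrite mulrC /s'; case: (eqVneq (coh r) (coh c + 1)) => [->|/(good_xcoh gC) ->].
    by rewrite sign_coh mulrN.
  by rewrite !mul0r oppr0.
have sx' r c : s r * dchi r c = dchi r c * s c.
  rewrite mulrC /s; case: (eqVneq (par r) (par c)) => [-> //|/(good_xpar gC) ->].
  by rewrite !mul0r.
have sd' r c : s' r * dmf r c = dmf r c * s' c.
  rewrite mulrC /s'; case: (eqVneq (coh r) (coh c)) => [-> //|/(good_dcoh gC) ->].
  by rewrite !mul0r.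
split.
- move=> r c; rewrite Ed cmp_tmx sd ss mul1r (good_dd gC) (good_dd gD) mulNr addrK.
  case: r c => r1 r2 [c1 c2] /=; rewrite xpair_eqE.
  by case: (r1 == c1); case: (r2 == c2); rewrite ?mulr0n ?mulr1n ?addr0 ?mul0rn.
- move=> r c; rewrite Ex cmp_tmx sx ss' mul1r (good_xx gC) (good_xx gD) mulNr addrK.
  by rewrite !mul0rn addr0.
- move=> r c.
  apply: (etrans (cmp_tmx (@dmf _ _ C) (@dchi _ _ C) s s' (@dmf _ _ D) (@dchi _ _ D) r c)).
  apply: (etrans _ (esym (cmp_tmx (@dchi _ _ C) (@dmf _ _ C) s' s (@dchi _ _ D) (@dmf _ _ D) r c))).
  rewrite sx' sd' (good_dx gC) (good_dx gD).
  rewrite (mulrC (s' _) (s _)) -!addrA; congr (_ + _).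
  by rewrite addrCA.
- move=> [r1 r2] [c1 c2] /= h; rewrite -[LHS]/(tmx _ s _ (r1, r2) (c1, c2)) /tmx /=.
  case: (eqVneq r2 c2) h => [-> /addIb h|_ h].
    rewrite (good_dpar gC h) mul0rn add0r; case: (eqVneq r1 c1) => // _.
    by rewrite (good_dpar gD) // mulr0 mul0rn.
  rewrite mulr0n add0r; case: (eqVneq r1 c1) h => // -> /addbI h.
  by rewrite (good_dpar gD) // mulr0 mul0rn.
- move=> [r1 r2] [c1 c2] /= h; rewrite -[LHS]/(tmx _ s _ (r1, r2) (c1, c2)) /tmx /=.
  case: (eqVneq r2 c2) h => [->|_] h.
    rewrite (good_dcoh gC); last by apply: contraNneq h => ->.
    rewrite mul0rn add0r; case: (eqVneq r1 c1) h => // _ _.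
    by rewrite (good_dpar gD) // mulr0 mul0rn.
  rewrite mulr0n add0r; case: (eqVneq r1 c1) h => // -> h.
  rewrite (good_dcoh gD) ?mulr0 ?mul0rn //; by apply: contraNneq h => ->.
- move=> [r1 r2] [c1 c2] /= h; rewrite -[LHS]/(tmx _ s' _ (r1, r2) (c1, c2)) /tmx /=.
  case: (eqVneq r2 c2) h => [->|_] h.
    rewrite (good_xpar gC); last by apply: contraNneq h => ->.
    rewrite mul0rn add0r; case: (eqVneq r1 c1) h => // _ _.
    rewrite (good_xcoh gD) ?mulr0 ?mul0rn //; lia.
  rewrite mulr0n add0r; case: (eqVneq r1 c1) h => // -> h.
  rewrite (good_xpar gD) ?mulr0 ?mul0rn //; by apply: contraNneq h => ->.
- move=> [r1 r2] [c1 c2] /= h; rewrite -[LHS]/(tmx _ s' _ (r1, r2) (c1, c2)) /tmx /=.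
  case: (eqVneq r2 c2) h => [->|_] h.
    rewrite (good_xcoh gC); last by apply: contraNneq h => ->; rewrite addrAC.
    rewrite mul0rn add0r; case: (eqVneq r1 c1) h => // _ _.
    rewrite (good_xcoh gD) ?mulr0 ?mul0rn //; lia.
  rewrite mulr0n add0r; case: (eqVneq r1 c1) h => // -> h.
  rewrite (good_xcoh gD) ?mulr0 ?mul0rn //; by apply: contraNneq h => ->; rewrite addrA.
- move=> [r1 r2] [c1 c2] /=; apply: homD.
    case: (eqVneq r2 c2) => [->|_]; last by rewrite mulr0n hom0.
    have -> : gr c1 + gr c2 + delta - (gr r1 + gr c2) = gr c1 + delta - gr r1.
      by rewrite opprD addrA (addrAC _ (gr c2)) addrAC addrK.
    exact/homMn/(good_dhom gC).
  case: (eqVneq r1 c1) => [->|_]; last by rewrite mulr0n hom0.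
  have -> : gr c1 + gr c2 + delta - (gr c1 + gr r2) = gr c2 + delta - gr r2.
    by rewrite opprD -[X in X + _]addrA addrACA subrr add0r.
  rewrite -signr_odd; case: (odd _); rewrite ?expr1 ?expr0 ?mulN1r ?mul1r.
    exact/homMn/homN/(good_dhom gD).
  exact/homMn/(good_dhom gD).
- move=> [r1 r2] [c1 c2] /=; apply: homD.
    case: (eqVneq r2 c2) => [->|_]; last by rewrite mulr0n hom0.
    rewrite opprD addrACA subrr addr0; exact/homMn/(good_xhom gC).
  case: (eqVneq r1 c1) => [->|_]; last by rewrite mulr0n hom0.
  rewrite opprD addrACA subrr add0r.
  rewrite -signr_odd; case: (odd _); rewrite ?expr1 ?expr0 ?mulN1r ?mul1r.
    exact/homMn/homN/(good_xhom gD).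
  exact/homMn/(good_xhom gD).
Qed.

Lemma good_unit : good (@mf_unit S G) 0.
Proof.
have cmp0 r c : cmp (fun _ _ : unit => 0 : S) (fun _ _ => 0) r c = 0.
  by rewrite /cmp big1 // => i _; rewrite mul0r.
by split=> // r c; rewrite ?mul0rn ?cmp0 // hom0.
Qed.

Lemma good_foldr (T : Type) (F : T -> mfcomplex S G) (w : T -> S) (s : seq T) A W :
  (forall x, good (F x) (w x)) -> good A W ->
  good (foldr (@mf_tensor S G) A (map F s)) (\sum_(x <- s) w x + W).
Proof.
move=> hF hA; elim: s => [|x s IH] /=; first by rewrite big_nil add0r.
by rewrite big_cons -addrA; apply: good_tensor.
Qed.

Record goodmf M W : Prop := GoodMf {
  goodmf_dd : forall r c, cmp (@mdiff _ _ M) (@mdiff _ _ M) r c = W *+ (r == c);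
  goodmf_par : forall r c : mbasis M, mpar r = mpar c -> mdiff r c = 0;
  goodmf_hom : forall r c : mbasis M, hom wt (mdiff r c) (mgr c + delta - mgr r) }.

Lemma cmp0l (T : finType) (d : T -> T -> S) r c : cmp (fun _ _ => 0) d r c = 0.
Proof. by rewrite /cmp big1 // => i _; rewrite mul0r. Qed.

Lemma cmp0r (T : finType) (d : T -> T -> S) r c : cmp d (fun _ _ => 0) r c = 0.
Proof. by rewrite /cmp big1 // => i _; rewrite mulr0. Qed.

Lemma good_single M W : goodmf M W -> good (mf_single M) W.
Proof.
case=> dd pp hh; split=> //= r c; rewrite ?cmp0l ?cmp0r //; exact: hom0.
Qed.

Lemma goodmf_shift g M W : goodmf M W -> goodmf (mfshift g M) W.
Proof.
case=> dd pp hh; split=> //= r c; have := hh r c; congr (is_true (hom _ _ _)).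
by rewrite opprD (addrAC _ g) (addrC (- _)) !addrA addrK.
Qed.

Lemma good_arrow k (M M' : mfact S G) W (f : mbasis M' -> mbasis M -> S) :
  goodmf M W -> goodmf M' W ->
  (forall r c, \sum_i mdiff r i * f i c = \sum_i f r i * mdiff i c) ->
  (forall r c, mpar r != mpar c -> f r c = 0) ->
  (forall r c, hom wt (f r c) (mgr c - mgr r)) ->
  good (mf_arrow k f) W.
Proof.
move=> [dd pp hh] [dd' pp' hh'] fd fp fh; split.
- case=> r [] c; rewrite /cmp big_sumType /=.
  + rewrite [X in _ + X]big1 ?addr0; last by move=> i _; rewrite mul0r.
    exact: dd.
  + by rewrite !big1 ?addr0 // => i _; rewrite ?mul0r ?mulr0.
  + by rewrite !big1 ?addr0 // => i _; rewrite ?mul0r ?mulr0.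
  + rewrite [X in X + _]big1 ?add0r; last by move=> i _; rewrite mul0r.
    exact: dd'.
- by case=> r [] c; rewrite /cmp big_sumType /= !big1 ?addr0 // => i _; rewrite ?mul0r ?mulr0.
- case=> r [] c; rewrite /cmp !big_sumType /=.
  + by rewrite !big1 ?addr0 // => i _; rewrite ?mul0r ?mulr0.
  + by rewrite !big1 ?addr0 // => i _; rewrite ?mul0r ?mulr0.
  + rewrite [X in X + _]big1 ?add0r; last by move=> i _; rewrite mul0r.
    rewrite [X in _ + X]big1 ?addr0; last by move=> i _; rewrite mul0r.
    exact: fd.
  + by rewrite !big1 ?addr0 // => i _; rewrite ?mul0r ?mulr0.
- by case=> r [] c //=; [apply: pp|apply: pp'].
- by case=> r [] c //=; rewrite eqxx.
- by case=> r [] c //=; apply: fp.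
- by case=> r [] c //=; rewrite eqxx.
- by case=> r [] c //=; apply: hom0.
- by case=> r [] c //=; apply: hom0.
Qed.
End Complexes.

(** * Factorizations with two generators of each parity *)

Section TwoByTwo.
Variable S : comNzRingType.

Definition odd2 (d0 d1 : 'M[S]_2) (r c : bool * 'I_2) : S :=
  if r.1 == ~~ c.1 then (if c.1 then d1 else d0) r.2 c.2 else 0.

Lemma sum_bool2 (F : bool * 'I_2 -> S) :
  \sum_k F k = \sum_j F (true, j) + \sum_j F (false, j).
Proof.
rewrite (eq_bigr (fun k => F (k.1, k.2))); last by case.
by rewrite -(pair_bigA _ (fun x y => F (x, y))) /= big_bool.
Qed.

Lemma cmp_odd_odd d0 d1 e0 e1 r c :
  cmp (odd2 d0 d1) (odd2 e0 e1) r c = map2 (d1 *m e0) (d0 *m e1) r c.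
Proof.
rewrite /cmp sum_bool2 /odd2 /map2; case: r c => [[] r] [[] c] /=; rewrite ?mxE;
  first [ by rewrite [X in X + _]big1 ?add0r // => i _; rewrite ?mul0r ?mulr0
        | by rewrite [X in _ + X]big1 ?addr0 // => i _; rewrite ?mul0r ?mulr0
        | by rewrite !big1 ?addr0 // => i _; rewrite ?mul0r ?mulr0 ].
Qed.

Lemma cmp_odd_map d0 d1 e0 e1 r c :
  cmp (odd2 d0 d1) (map2 e0 e1) r c = odd2 (d0 *m e0) (d1 *m e1) r c.
Proof.
rewrite /cmp sum_bool2 /odd2 /map2; case: r c => [[] r] [[] c] /=; rewrite ?mxE;
  first [ by rewrite [X in X + _]big1 ?add0r // => i _; rewrite ?mul0r ?mulr0
        | by rewrite [X in _ + X]big1 ?addr0 // => i _; rewrite ?mul0r ?mulr0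
        | by rewrite !big1 ?addr0 // => i _; rewrite ?mul0r ?mulr0 ].
Qed.

Lemma cmp_map_odd d0 d1 e0 e1 r c :
  cmp (map2 d0 d1) (odd2 e0 e1) r c = odd2 (d1 *m e0) (d0 *m e1) r c.
Proof.
rewrite /cmp sum_bool2 /odd2 /map2; case: r c => [[] r] [[] c] /=; rewrite ?mxE;
  first [ by rewrite [X in X + _]big1 ?add0r // => i _; rewrite ?mul0r ?mulr0
        | by rewrite [X in _ + X]big1 ?addr0 // => i _; rewrite ?mul0r ?mulr0
        | by rewrite !big1 ?addr0 // => i _; rewrite ?mul0r ?mulr0 ].
Qed.

Lemma mx2_mul (a b c d a' b' c' d' : S) :
  mx2 a b c d *m mx2 a' b' c' d'
  = mx2 (a * a' + b * c') (a * b' + b * d') (c * a' + d * c') (c * b' + d * d').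
Proof.
apply/matrixP => i j; rewrite !mxE !big_ord_recl big_ord0 !mxE /= addr0.
by case: (i == 0); case: (j == 0).
Qed.

Lemma mx2_scalar (w : S) : mx2 w 0 0 w = w%:M.
Proof.
apply/matrixP => i j; rewrite !mxE.
by case: i j => [[|[|//]] hi] [[|[|//]] hj].
Qed.

Lemma map2_scalar (w : S) (r c : bool * 'I_2) :
  map2 (mx2 w 0 0 w) (mx2 w 0 0 w) r c = w *+ (r == c).
Proof.
case: r c => r1 r2 [c1 c2]; rewrite /map2 xpair_eqE /= if_same mx2_scalar mxE.
by case: (r1 == c1).
Qed.

Lemma mx2_ind (P : S -> 'I_2 -> 'I_2 -> Prop) a b c d :
  P a 0 0 -> P b 0 1 -> P c 1 0 -> P d 1 1 -> forall i j, P (mx2 a b c d i j) i j.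
Proof.
move=> ha hb hc hd i j; rewrite mxE.
have o2 (k : 'I_2) : (k = 0) \/ (k = 1).
  by case: k => [[|[|//]] hk]; [left|right]; apply: val_inj.
by case: (o2 i) => ->; case: (o2 j) => ->.
Qed.
End TwoByTwo.

(** * Elimination of arcs and crossings *)

Section Adjoin.
Variable S : comNzRingType.
Implicit Types (I J : S -> Prop) (f q u : S).

Lemma adj_congr I q q' u f : ideal I -> I (q - u * q') -> adj I q f -> adj I q' f.
Proof.
move=> hI hq [y hy]; exists (u * y).
by have := idD hI hy (idM hI y hq); congr I; ring.
Qed.

Lemma eq_adj I J q f : (forall f, I f <-> J f) -> adj I q f <-> adj J q f.
Proof. by move=> e; split=> -[y hy]; exists y; apply/e. Qed.
End Adjoin.

Section Elimination.
Variables (N : nat) (G : zmodType) (wt : 'I_N -> G) (delta : G).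
Notation S := {mpoly rat[N]}.
Implicit Types (A C : mfcomplex S G) (M : mfact S G) (W : S) (I : S -> Prop).

(** Only homogeneous cycles of degree g are tested, but their preimages need not be homogeneous;
    components can be taken afterwards with [pr]. *)
Definition exactg I C (g : G) : Prop :=
  exact I (@dmf _ _ C) (fun z => forall e, hom wt (z e) (g - gr e)).

Lemma eq_exactg I J C g : (forall f, I f <-> J f) -> exactg I C g -> exactg J C g.
Proof. exact: eq_exact. Qed.

Lemma ap_single M A z r1 r2 :
  ap (@dmf _ _ (mf_tensor (mf_single M) A)) z (r1, r2)
  = \sum_c mdiff r1 c * z (c, r2)
    + (-1) ^+ mpar r1 * ap (@dmf _ _ A) (fun c => z (r1, c)) r2.
Proof. exact: (ap_tmx (@mdiff _ _ M) (fun c => (-1) ^+ mpar c)). Qed.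

(** On [mf_arrow] the differential [dmf] is block diagonal and ignores f, so the two ends can be
    treated separately. *)
Lemma exact_arrow I k (M M' : mfact S G) (f : mbasis M' -> mbasis M -> S) A g :
  exactg I (mf_tensor (mf_single M) A) g -> exactg I (mf_tensor (mf_single M') A) g ->
  exactg I (mf_tensor (mf_arrow k f) A) g.
Proof.
move=> ex ex'; pose s (c : basis (mf_arrow k f)) : S := (-1) ^+ par c.
have Ed : @dmf _ _ (mf_tensor (mf_arrow k f) A) = tmx (@dmf _ _ (mf_arrow k f)) s (@dmf _ _ A).
  by [].
have apE z r1 r2 : ap (@dmf _ _ (mf_tensor (mf_arrow k f) A)) z (r1, r2)
    = match r1 with
      | inl u => ap (@dmf _ _ (mf_tensor (mf_single M) A)) (fun p => z (inl p.1, p.2)) (u, r2)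
      | inr v => ap (@dmf _ _ (mf_tensor (mf_single M') A)) (fun p => z (inr p.1, p.2)) (v, r2)
      end.
  rewrite Ed ap_tmx /ap big_sumType /=.
  case: r1 => u; rewrite [RHS](ap_single) /=.
    by rewrite [X in _ + X + _]big1 ?addr0 // => i _; rewrite mul0r.
  by rewrite [X in X + _ + _]big1 ?add0r // => i _; rewrite mul0r.
move=> z hz dz.
have [||w hw] := ex (fun p => z (inl p.1, p.2)).
- by move=> [u e]; apply: (hz (inl u, e)).
- by move=> [u e]; have := dz (inl u, e); rewrite apE.
have [||w' hw'] := ex' (fun p => z (inr p.1, p.2)).
- by move=> [u e]; apply: (hz (inr u, e)).
- by move=> [u e]; have := dz (inr u, e); rewrite apE.
exists (fun p => match p.1 with inl u => w (u, p.2) | inr v => w' (v, p.2) end).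
move=> [[u|v] e]; rewrite apE /=.
  have := hw (u, e); congr (I (_ - _)); apply: eq_ap; by case.
have := hw' (v, e); congr (I (_ - _)); apply: eq_ap; by case.
Qed.

(** The coordinates on the even generator form a cycle of A modulo (I, q). Once a boundary is
    subtracted they vanish modulo I, and then the cycle condition says that q times the odd
    coordinates lies in I. *)
Lemma exact_mf1 I (g0 g1 : G) (p q : S) A W g :
  ideal I -> regular I q -> I W ->
  good wt delta (mf_tensor (mf_single (mf1 g0 g1 p q)) A) W ->
  exactg (adj I q) A (g - g0) -> exactg I (mf_tensor (mf_single (mf1 g0 g1 p q)) A) g.
Proof.
move=> hI reg IW gT ex; set T := mf_tensor _ A.
have dd := good_dd gT.
have apF z e : ap (@dmf _ _ T) z (false, e)
    = q * z (true, e) + ap (@dmf _ _ A) (fun c => z (false, c)) e.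
  by rewrite ap_single big_bool /= mul0r addr0 mul1r.
move=> z hz dz.
have [e|e|w hw] := ex (fun e => z (false, e)).
- by have := hz (false, e); congr (is_true (hom _ _ _)); rewrite /= opprD addrA.
- exists (- z (true, e)); have := dz (false, e); rewrite apF; congr I; ring.
have [y hy] := fin_all_exists hw.
pose v (p : bool * basis A) := if p.1 then y p.2 else w p.2.
exists v; set z' := fun e => z e - ap (@dmf _ _ T) v e.
have dz' r : I (ap (@dmf _ _ T) z' r).
  by rewrite apB ap_comp (ap_diag _ _ dd); apply: idB => //; rewrite mulrC; apply: idM.
have zF e : I (z' (false, e)).
  by have := hy e; rewrite /z' apF /v /= (eq_ap _ _ (z' := w)) //; congr I; ring.
move=> [[] e]; last exact: zF.
apply: reg; have := dz' (false, e); rewrite apF => h.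
by apply: (idDr hI h); apply: id_ap.
Qed.

(** A Koszul factor for the regular sequence q, r: [(false, 0)] carries the quotient by both,
    [(true, 0)] and [(true, 1)] are the generators attached to q and r, and [(false, 1)] is their
    product. The coordinates are cleared in this order. *)
Lemma exact_mf2 I (s h00 h01 h10 h11 : G) (a b c d q r q' : S) A W g :
  ideal I -> regular I q -> regular (adj I q) r -> q' = - q -> I W ->
  let M := mfshift s (mf2 h00 h01 h10 h11 (mx2 a r b q') (mx2 q r c d)) in
  good wt delta (mf_tensor (mf_single M) A) W ->
  exactg (adj (adj I q) r) A (g - (h00 + s)) -> exactg I (mf_tensor (mf_single M) A) g.
Proof.
move=> hI regq regr -> IW M gT ex; set T := mf_tensor _ A in gT *.
have dd := good_dd gT.
have sum2 (F : 'I_2 -> S) : \sum_i F i = F 0 + F 1.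
  by rewrite !big_ord_recl big_ord0 addr0; congr (_ + F _); apply: val_inj.
have apF z e : ap (@dmf _ _ T) z ((false, 0), e)
    = q * z ((true, 0), e) + r * z ((true, 1), e)
      + ap (@dmf _ _ A) (fun c => z ((false, 0), c)) e.
  rewrite ap_single sum_bool2 !sum2 /= !mxE /= expr0 mul1r; congr (_ + _).
  by rewrite !mul0r !addr0.
have apT z e : ap (@dmf _ _ T) z ((true, 1), e)
    = b * z ((false, 0), e) - q * z ((false, 1), e)
      - ap (@dmf _ _ A) (fun c => z ((true, 1), c)) e.
  rewrite ap_single sum_bool2 !sum2 /= !mxE /= expr1 mulN1r mulNr; congr (_ - _).
  by rewrite !mul0r !add0r.
have pass z w : (forall e, I (ap (@dmf _ _ T) z e)) ->
    forall e, I (ap (@dmf _ _ T) (fun e => z e - ap (@dmf _ _ T) w e) e).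
  move=> dz e; rewrite apB ap_comp (ap_diag _ _ dd); apply: idB => //.
  by rewrite mulrC; apply: idM.
move=> z hz dz.
have [e|e|w hw] := ex (fun e => z ((false, 0), e)).
- by have := hz ((false, 0), e); congr (is_true (hom _ _ _)); rewrite /= opprD addrA.
- exists (- z ((true, 1), e)), (- z ((true, 0), e)).
  by have := dz ((false, 0), e); rewrite apF; congr I; ring.
have [y1 hy1] := fin_all_exists hw; have [y0 hy0] := fin_all_exists hy1.
pose v (p : bool * 'I_2 * basis A) :=
  if p.1.1 then (if p.1.2 == 0 then y0 p.2 else y1 p.2)
  else (if p.1.2 == 0 then w p.2 else 0).
pose z1 e := z e - ap (@dmf _ _ T) v e.
have dz1 := pass z v dz; rewrite -/z1 in dz1.
have z1F e : I (z1 ((false, 0), e)).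
  have := hy0 e; rewrite /z1 apF /v /= (eq_ap _ _ (z' := w)) //; congr I; ring.
have rel e : I (q * z1 ((true, 0), e) + r * z1 ((true, 1), e)).
  have := dz1 ((false, 0), e); rewrite apF => h.
  by apply: (idDr hI h); apply: id_ap.
(* Modulo I every relation between q and r is a multiple of the Koszul one; the multiplier [t],
   placed on [(false, 1)], bounds the two odd coordinates. *)
have syzygy x y : I (q * x + r * y) -> exists t, I (x - r * t) /\ I (y + q * t).
  move=> hxy; have [|t ht] := regr y; first by exists (- x); move: hxy; congr I; ring.
  exists (- t); split; last by move: ht; congr I; ring.
  by apply: regq; have := idB hI hxy (idM hI r ht); congr I; ring.
have [t ht] := fin_all_exists (fun e => syzygy _ _ (rel e)).
pose v' (p : bool * 'I_2 * basis A) := if (p.1.1 == false) && (p.1.2 == 1) then t p.2 else 0.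
pose z2 e := z1 e - ap (@dmf _ _ T) v' e.
have dz2 := pass z1 v' dz1; rewrite -/z2 in dz2.
have apv' e : ap (@dmf _ _ A) (fun _ => 0) e = 0 by rewrite /ap big1 // => i _; rewrite mulr0.
have z2F e : I (z2 ((false, 0), e)).
  by rewrite /z2 apF /v' /= apv' !mulr0 !addr0 subr0.
have z2T0 e : I (z2 ((true, 0), e)).
  have [h _] := ht e; rewrite /z2 ap_single sum_bool2 !sum2 /= !mxE /v' /= apv'.
  by move: h; congr I; ring.
have z2T1 e : I (z2 ((true, 1), e)).
  have [_ h] := ht e; rewrite /z2 apT /v' /= apv'.
  by move: h; congr I; ring.
have z2F1 e : I (z2 ((false, 1), e)).
  apply: regq; have := dz2 ((true, 1), e); rewrite apT => h.
  have h1 : I (ap (@dmf _ _ A) (fun c => z2 ((true, 1), c)) e) by apply: id_ap.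
  have sum3 x y u : I (x - y - u) -> I x -> I u -> I y.
    by move=> hxyu hx hu; have := idB hI (idB hI hx hu) hxyu; congr I; ring.
  exact: sum3 h (idM hI b (z2F e)) h1.
exists (fun e => v e + v' e) => -[[i j] e].
have -> : z (i, j, e) - ap (@dmf _ _ T) (fun e => v e + v' e) (i, j, e) = z2 (i, j, e).
  by rewrite apD opprD addrA.
have [->|->] : j = 0 \/ j = 1.
- by case: j => [[|[|//]] hj]; [left|right]; apply: val_inj.
- by case: i.
- by case: i.
Qed.

Lemma pr_ap C (d : basis C -> basis C -> S) (e : G) w g r :
  (forall r c, hom wt (d r c) (gr c + e - gr r)) ->
  pr wt (g - gr r) (ap d w r) = ap d (fun c => pr wt (g - e - gr c) (w c)) r.
Proof.
move=> hd; rewrite raddf_sum /=; apply: eq_bigr => c _.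
rewrite -(pr_mul _ _ (hd r c)); congr (pr _ _ _).
by rewrite -(addrA g) -opprD (addrC e) [RHS]addrC addrA addrNK.
Qed.

(* S/(I, rho kappa) is an extension of S/(I, rho) by S/(I, kappa), the latter being
   embedded by the multiplication by rho. *)
Lemma exact_extension I (rho kappa : S) (wrho : G) A W g :
  ideal I -> (forall g f, I f -> I (pr wt g f)) ->
  hom wt rho wrho -> regular I rho -> adj I (rho * kappa) W -> good wt delta A W ->
  exactg (adj I rho) A g -> exactg (adj I kappa) A (g - wrho) ->
  exactg (adj I (rho * kappa)) A g.
Proof.
move=> hI prI hrho reg [t ht] gA ex ex' z hz dz.
have dd := good_dd gA.
have [s hs] := fin_all_exists dz.
have [r|w hw] := ex z hz.
  by exists (kappa * s r); have := hs r; congr I; ring.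
have [y hy] := fin_all_exists hw.
pose w' e := pr wt (g - delta - gr e) (w e).
pose y' e := pr wt (g - wrho - gr e) (y e).
(* The hypothesis on kappa accepts homogeneous vectors only, so the relation is projected to the
   degree of z; the factor rho accounts for the shift by [wrho]. *)
have hy' e : I (z e - ap (@dmf _ _ A) w' e - rho * y' e).
  have := prI (g - gr e) _ (hy e); rewrite !raddfB /= (pr_ap _ _ _ (good_dhom gA)).
  have /homP -> := hz e; congr (I (_ - _ - _)).
  rewrite -(pr_mul _ _ hrho); congr (pr _ _ _).
  by rewrite addrA (addrC wrho) addrNK.
have [e|e|v hv] := ex' y'; first exact: hom_pr.
  (* Apply [dmf] and use W = rho kappa t modulo I: rho times d y' is rho kappa (s - t w'), and rho
     cancels. *)
  exists (s e - t * w' e); apply: reg.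
  have := id_ap hI (@dmf _ _ A) e hy'.
  rewrite !apB apZ ap_comp (ap_diag _ _ dd) => h1.
  have := idB hI (hs e) (idD hI h1 (idM hI (w' e) ht)); congr I; ring.
have [u hu] := fin_all_exists hv.
exists (fun e => w' e + rho * v e) => e; exists (u e).
rewrite apD apZ; have := idD hI (hy' e) (idM hI rho (hu e)); congr I; ring.
Qed.

Lemma X_inj (u v : 'I_N) : 'X_u = 'X_v :> S -> u = v.
Proof.
move/(congr1 (fun p : S => p@_U_(v))); rewrite !mcoeffXU eqxx.
by case: eqVneq => // _ /eqP; rewrite eq_sym oner_eq0.
Qed.

Lemma X_sub_neq0 (u v : 'I_N) : u != v -> 'X_u - 'X_v != 0 :> S.
Proof. by rewrite subr_eq0; apply: contraNneq => /X_inj ->. Qed.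

Lemma eq_ker (F F' : 'I_N -> S) f : F =1 F' -> ker F f <-> ker F' f.
Proof.
move=> e; rewrite /ker !subE; suff -> : \sum_(m <- msupp f) f@_m *: \prod_(i < N) F i ^+ m i
  = \sum_(m <- msupp f) f@_m *: \prod_(i < N) F' i ^+ m i by [].
by apply: eq_bigr => m _; congr (_ *: _); apply: eq_bigr => i _; rewrite e.
Qed.

Section Tau.
Variable tau : 'I_N -> 'I_N.
Hypothesis tauK : forall v, tau (tau v) = tau v.
Hypothesis wt_tau : forall v, wt (tau v) = wt v.

Definition xtau (t : 'I_N -> 'I_N) (v : 'I_N) : S := 'X_(t v).

Definition merge (i k : 'I_N) v := if tau v == i then tau k else tau v.

Lemma ker_merge i k f : tau i = i -> tau k != i ->
  ker (xtau (merge i k)) f <-> adj (ker (xtau tau)) ('X_i - 'X_k) f.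
Proof.
move=> ti tk; apply: ker_adj => [v|v||v].
- by rewrite sub_X /xtau tauK.
- by rewrite sub_X /xtau /merge tauK.
- rewrite rmorphB /= !sub_X /xtau /merge ti eqxx.
  by rewrite (negPf tk) subrr.
- rewrite rmorphB /= !sub_X /xtau /merge ti.
  by case: eqVneq => [->|_]; [exists 1; rewrite mul1r|exists 0; rewrite mul0r subrr].
Qed.

Lemma exact_arc (i k : 'I_N) (g0 g1 : G) (p : S) A W g :
  tau i = i -> tau k != i -> ker (xtau tau) W ->
  let M := mf1 g0 g1 p ('X_i - 'X_k) in
  good wt delta (mf_tensor (mf_single M) A) W ->
  exactg (ker (xtau (merge i k))) A (g - g0) ->
  exactg (ker (xtau tau)) (mf_tensor (mf_single M) A) g.
Proof.
move=> ti tk kW M gT ex; apply: exact_mf1 gT _ => //; first exact: ideal_ker.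
  by apply: regular_ker; rewrite rmorphB /= !sub_X /xtau ti X_sub_neq0 // eq_sym.
by apply: eq_exactg ex => f; apply: ker_merge.
Qed.

Section Pair.
Variables i j : 'I_N.
Hypotheses (ti : tau i = i) (tj : tau j = j) (nij : i != j).

Definition merge2 (k l v : 'I_N) :=
  if tau v == i then tau k else if tau v == j then tau l else tau v.

Variables k l : 'I_N.
Hypotheses (tki : tau k != i) (tkj : tau k != j) (tli : tau l != i) (tlj : tau l != j).
Variables (s h00 h01 h10 h11 : G) (A : mfcomplex S G) (W : S) (g : G).
Hypothesis kW : ker (xtau tau) W.

Lemma exact_P0 (a b c d : S) :
  let M := mfshift s (mf2 h00 h01 h10 h11 (mx2 a ('X_j - 'X_l) b (- 'X_i + 'X_k))
                          (mx2 ('X_i - 'X_k) ('X_j - 'X_l) c d)) in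
  good wt delta (mf_tensor (mf_single M) A) W ->
  exactg (ker (xtau (merge2 k l))) A (g - (h00 + s)) ->
  exactg (ker (xtau tau)) (mf_tensor (mf_single M) A) g.
Proof.
move=> M gT ex.
have kE f := ker_merge f ti tki.
have regr : regular (adj (ker (xtau tau)) ('X_i - 'X_k)) ('X_j - 'X_l).
  move=> f /kE; rewrite /ker => h; apply/kE; move: h; apply: regular_ker.
  rewrite rmorphB /= !sub_X /xtau /merge tj (eq_sym j) (negPf nij) (negPf tli).
  by rewrite X_sub_neq0 // eq_sym.
apply: exact_mf2 gT _ => //; first exact: ideal_ker.
- by apply: regular_ker; rewrite rmorphB /= !sub_X /xtau ti X_sub_neq0 // eq_sym.
- by rewrite opprB addrC.
apply: eq_exactg ex => f; rewrite -(eq_adj _ _ kE); apply: ker_adj => [v|v||v].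
- rewrite sub_X /xtau /merge; case: (eqVneq (tau v) i) => [_|n].
    by rewrite tauK (negPf tki).
  by rewrite tauK (negPf n).
- rewrite sub_X /xtau /merge2 /merge; case: (eqVneq (tau v) i) => [_|n].
    by rewrite tauK (negPf tki) (negPf tkj).
  by rewrite tauK (negPf n).
- rewrite rmorphB /= !sub_X /xtau /merge2 tj eqxx (eq_sym j) (negPf nij).
  by rewrite (negPf tli) (negPf tlj) subrr.
- rewrite rmorphB /= !sub_X /xtau /merge2 /merge tj (eq_sym j) (negPf nij) (negPf tli).
  case: eqVneq => [_|_]; first by exists 0; rewrite mul0r subrr.
  by case: eqVneq => [->|_]; [exists 1; rewrite mul1r|exists 0; rewrite mul0r subrr].
Qed.

(** The linear relation of a wide edge solves for x_j only, and x_i stays free until the quadratic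
    relation is split. This is therefore not an identification of variables. *)
Definition wide_subst (v : 'I_N) : S :=
  if tau v == j then 'X_(tau k) + 'X_(tau l) - 'X_i else 'X_(tau v).

Lemma wide_substK v : sub wide_subst (wide_subst v) = wide_subst v.
Proof.
rewrite {2 3}/wide_subst; case: (eqVneq (tau v) j) => [_|n].
  rewrite rmorphB rmorphD /= !sub_X /wide_subst !tauK ti.
  by rewrite (negPf tkj) (negPf tlj) (negPf nij).
by rewrite sub_X /wide_subst tauK (negPf n).
Qed.

Lemma ker_wide f :
  ker wide_subst f <-> adj (ker (xtau tau)) ('X_i + 'X_j - 'X_k - 'X_l) f.
Proof.
have Eq : sub (xtau tau) ('X_i + 'X_j - 'X_k - 'X_l) = 'X_i + 'X_j - 'X_(tau k) - 'X_(tau l).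
  by rewrite !rmorphB rmorphD /= !sub_X /xtau ti tj.
apply: ker_adj => [v|v||v].
- by rewrite sub_X /xtau tauK.
- by rewrite sub_X /wide_subst tauK.
- rewrite !rmorphB rmorphD /= !sub_X /wide_subst ti tj eqxx (negPf nij).
  by rewrite (negPf tkj) (negPf tlj); ring.
- rewrite Eq /xtau /wide_subst; case: eqVneq => [->|_]; last by exists 0; rewrite mul0r subrr.
  by exists 1; ring.
Qed.
End Pair.

(** Under x_i = x_k the linear relation forces x_j = x_l, so a mere identification of variables is
    recovered. *)
Lemma ker_wide_merge i j k l f :
  tau i = i -> tau j = j -> i != j -> tau k != i -> tau k != j -> tau l != i -> tau l != j ->
  ker (xtau (merge2 i j k l)) f <-> adj (ker (wide_subst i j k l)) ('X_i - 'X_k) f.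
Proof.
move=> ti tj nij tki tkj tli tlj.
have Eq : sub (wide_subst i j k l) ('X_i - 'X_k) = 'X_i - 'X_(tau k).
  by rewrite rmorphB /= !sub_X /wide_subst ti (negPf nij) (negPf tkj).
apply: ker_adj => [v|v||v].
- exact: wide_substK.
- rewrite /wide_subst; case: (eqVneq (tau v) j) => [e|n].
    rewrite rmorphB rmorphD /= !sub_X /xtau /merge2 !tauK ti eqxx e eqxx (eq_sym j).
    by rewrite (negPf nij) (negPf tki) (negPf tkj) (negPf tli) (negPf tlj) addrC addKr.
  by rewrite sub_X /xtau /merge2 tauK.
- by rewrite rmorphB /= !sub_X /xtau /merge2 ti eqxx (negPf tki) (negPf tkj) subrr.
- rewrite Eq /xtau /wide_subst /merge2; case: (eqVneq (tau v) j) => [->|n].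
    by rewrite (eq_sym j) (negPf nij); exists (-1); ring.
  by case: eqVneq => [->|_]; [exists 1; rewrite mul1r|exists 0; rewrite mul0r subrr].
Qed.

Lemma exact_P1 i j k l (s h00 h01 h10 h11 wx : G) A WA W g (v1 v2 c d : S) :
  tau i = i -> tau j = j -> i != j -> tau k != i -> tau k != j -> tau l != i -> tau l != j ->
  wt i = wx -> wt j = wx -> wt k = wx -> wt l = wx ->
  ker (xtau tau) W ->
  let quad := 'X_i * 'X_j - 'X_k * 'X_l in
  let lin := 'X_i + 'X_j - 'X_k - 'X_l in
  W = v1 * lin + v2 * quad + WA ->
  let M := mfshift s (mf2 h00 h01 h10 h11 (mx2 v1 quad v2 (- 'X_i - 'X_j + 'X_k + 'X_l))
                          (mx2 lin quad c d)) in
  good wt delta (mf_tensor (mf_single M) A) W -> good wt delta A WA ->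
  exactg (ker (xtau (merge2 i j l k))) A (g - (h00 + s)) ->
  exactg (ker (xtau (merge2 i j k l))) A (g - (h00 + s) - wx) ->
  exactg (ker (xtau tau)) (mf_tensor (mf_single M) A) g.
Proof.
move=> ti tj nij tki tkj tli tlj wi wj wk wl kW quad lin EW M gT gA ex ex'.
have hI := ideal_ker (xtau tau).
set psi := wide_subst i j k l; have hP := ideal_ker psi.
have kE := @ker_wide i j ti tj nij k l tkj tlj.
have psiX v : sub psi 'X_v = psi v by apply: sub_X.
have pi : psi i = 'X_i by rewrite /psi /wide_subst ti (negPf nij).
have pj : psi j = 'X_(tau k) + 'X_(tau l) - 'X_i by rewrite /psi /wide_subst tj eqxx.
have pk : psi k = 'X_(tau k) by rewrite /psi /wide_subst (negPf tkj).
have pl : psi l = 'X_(tau l) by rewrite /psi /wide_subst (negPf tlj).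
have Equad : sub psi quad = - (('X_i - 'X_(tau l)) * ('X_i - 'X_(tau k))).
  by rewrite rmorphB !rmorphM /= !psiX pi pj pk pl; ring.
have Erho : sub psi ('X_i - 'X_l) = 'X_i - 'X_(tau l) by rewrite rmorphB /= !psiX pi pl.
have Ekap : sub psi ('X_i - 'X_k) = 'X_i - 'X_(tau k) by rewrite rmorphB /= !psiX pi pk.
have rho0 : 'X_i - 'X_(tau l) != 0 :> S by rewrite X_sub_neq0 // eq_sym.
have kap0 : 'X_i - 'X_(tau k) != 0 :> S by rewrite X_sub_neq0 // eq_sym.
have quadE : ker psi (quad - (-1) * (('X_i - 'X_l) * ('X_i - 'X_k))).
  by rewrite /ker rmorphB !rmorphM rmorphN rmorph1 /= Equad Erho Ekap; ring.
have quadE' : ker psi (('X_i - 'X_l) * ('X_i - 'X_k) - (-1) * quad).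
  by rewrite /ker rmorphB !rmorphM rmorphN rmorph1 /= Equad Erho Ekap; ring.
have adjE f : adj (ker psi) quad f <-> adj (ker psi) (('X_i - 'X_l) * ('X_i - 'X_k)) f.
  by split; [apply: (adj_congr hP quadE)|apply: (adj_congr hP quadE')].
apply: exact_mf2 gT _ => //.
- apply: regular_ker; rewrite !rmorphB rmorphD /= !sub_X /xtau ti tj.
  apply/eqP => /(congr1 (fun p : S => p@_U_(i))).
  rewrite !(mcoeffB, mcoeffD) !mcoeffXU eqxx (eq_sym j) (negPf nij) (negPf tki) (negPf tli).
  by rewrite mcoeff0 addr0 !subr0 => /eqP; rewrite oner_eq0.
- move=> f /kE h; apply/kE; move: h; apply: regular_ker.
  by rewrite Equad oppr_eq0 mulf_neq0.
- by rewrite /lin; ring.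
have psih v : hom wt (psi v) (wt v).
  rewrite /psi /wide_subst; case: eqVneq => [e|_]; last by rewrite -(wt_tau v) homX.
  rewrite -(wt_tau v) e wj.
  apply: homB; last by rewrite -wi homX.
  by apply: homD; [rewrite -wk -wt_tau homX|rewrite -wl -wt_tau homX].
apply: (@eq_exactg (adj (ker psi) (('X_i - 'X_l) * ('X_i - 'X_k)))).
  by move=> f; rewrite -adjE; apply: eq_adj.
apply: (@exact_extension (ker psi) _ _ wx _ WA) => //.
- by move=> g' f; rewrite /ker sub_pr // => ->; rewrite raddf0.
- by apply: homB; [rewrite -wi homX|rewrite -wl homX].
- by apply: regular_ker; rewrite Erho.
(* W is 0 in the quotient and both v1 lin and v2 quad lie in the ideal, so the potential WA of the
   remaining factors lies there as well. *)
- apply/adjE; have hJ := ideal_adj hP quad.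
  have -> : WA = W - (v1 * lin + v2 * quad) by rewrite EW; ring.
  have hl : ker psi lin by apply/kE/adj_gen.
  apply: (idB hJ); first by apply: adj_sub => //; apply/kE/adj_sub.
  apply: (idD hJ); first by apply: adj_sub => //; apply: idM.
  exact/(idM hJ)/adj_gen.
(* The linear relation is symmetric in k and l, so the same substitution also serves the crossed
   connection. *)
- apply: eq_exactg ex => f.
  have kw := @ker_wide_merge i j l k f ti tj nij tli tlj tki tkj; rewrite kw.
  apply: eq_adj => f'; apply: eq_ker => v.
  by rewrite /psi /wide_subst; case: ifP => // _; rewrite (addrC 'X_(tau l)).
- by apply: eq_exactg ex' => f; apply: ker_wide_merge.
Qed.
End Tau.
End Elimination.

(** * Iterated homology and the total complex *)

Section Nonvanishing.
Variables (N : nat) (G : zmodType) (wt : 'I_N -> G) (delta : G).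
Notation S := {mpoly rat[N]}.
Variable C : mfcomplex S G.
Local Notation d := (@dmf _ _ C).
Local Notation x := (@dchi _ _ C).
Implicit Types z y u w : basis C -> S.

Definition HHcycle z : Prop :=
  (forall r, ap d z r = 0) /\ exists y, forall r, ap x z r = ap d y r.

Definition HHboundary z : Prop :=
  exists y u, (forall r, ap d y r = 0) /\ forall r, z r = ap x y r + ap d u r.

Lemma actE dd (v : elt C) r : act dd v r = ap dd v r.
Proof. by rewrite ffunE. Qed.

Lemma cyc_HH (v : elt C) : cyc (HH C) v <-> HHcycle v.
Proof.
split=> [[[_ dv] [y [w [_ -> e]]]]|[dv [y hy]]].
  split=> [r|]; first by rewrite -actE dv ffunE.
  by exists y => r; rewrite -actE e addr0 actE.
split; first by split=> //; apply/ffunP => r; rewrite actE dv ffunE.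
exists (finfun y), 0; split=> //; apply/ffunP => r.
by rewrite addr0 !actE hy; apply: eq_ap => e; rewrite ffunE.
Qed.

Lemma bdy_HH (v : elt C) : bdy (HH C) v <-> HHboundary v.
Proof.
split=> [[y [w [[_ dy] [u [w' [_ -> ->]]] ->]]]|[y [u [dy hv]]]].
  exists y, u; split=> r; first by rewrite -actE dy ffunE.
  by rewrite addr0 ffunE !actE.
exists (finfun y), (act d (finfun u)); split.
- split=> //; apply/ffunP => r; rewrite actE ffunE -(dy r).
  by apply: eq_ap => e; rewrite ffunE.
- by exists (finfun u), 0; rewrite addr0.
apply/ffunP => r; rewrite hv [in RHS]ffunE !actE; congr (_ + _).
  by apply: eq_ap => e; rewrite ffunE.
by apply: eq_ap => e; rewrite ffunE.
Qed.

Lemma HH_bound j g : exactg wt (fun f => f = 0) C g -> ~ HH_nz wt C j g.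
Proof.
move=> ex [z [[/cyc_HH[dz _] hz] nb]]; apply: nb; split=> //; apply/bdy_HH.
have [e|//|w hw] := ex z.
  by apply/allP => m /hz[_ <-]; rewrite /mwt addrK eqxx.
exists (fun _ => 0), w; split=> r; first by rewrite /ap big1 // => i _; rewrite mulr0.
rewrite -(subrK (ap d w r) (z r)) hw; congr (_ + _).
by rewrite /ap big1 // => i _; rewrite mulr0.
Qed.

Variable W : S.
Hypothesis gC : good wt delta C W.

Definition component (j : int) (g : G) z (e : basis C) : S :=
  if coh e == j then pr wt (g - gr e) (z e) else 0.

Lemma ap_component (dd : basis C -> basis C -> S) (a : int) (de : G) j g z r :
  (forall r c, coh r != coh c + a -> dd r c = 0) ->
  (forall r c, hom wt (dd r c) (gr c + de - gr r)) ->
  ap dd (component j g z) r = component (j + a) (g + de) (ap dd z) r.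
Proof.
move=> hc hd; rewrite /component; case: (eqVneq (coh r) (j + a)) => [e|n].
  rewrite (pr_ap _ _ _ hd) addrK; apply: eq_bigr => c _.
  case: (eqVneq (coh c) j) => // n; rewrite (hc r c) ?mul0r //.
  by rewrite e (inj_eq (addIr a)) eq_sym.
rewrite /ap big1 // => c _; case: (eqVneq (coh c) j) => [e|_]; last by rewrite mulr0.
by rewrite (hc r c) ?mul0r // e.
Qed.

Lemma ap_component_d j g z r :
  ap d (component j g z) r = component j (g + delta) (ap d z) r.
Proof.
rewrite (@ap_component _ 0 delta) ?addr0 //; last exact: (good_dhom gC).
by move=> r' c; rewrite addr0; apply: (good_dcoh gC).
Qed.

Lemma ap_component_x j g z r :
  ap x (component j g z) r = component (j + 1) g (ap x z) r.
Proof.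
rewrite (@ap_component _ 1 0) ?addr0 //; first exact: (good_xcoh gC).
by move=> r' c; rewrite addr0; apply: (good_xhom gC).
Qed.

Lemma eq_component j g z z' : z =1 z' -> component j g z =1 component j g z'.
Proof. by move=> e r; rewrite /component e. Qed.

Lemma component0 j g : component j g (fun _ => 0) =1 fun _ => 0.
Proof. by move=> r; rewrite /component raddf0 if_same. Qed.

Lemma HHcycle_component j g z : HHcycle z -> HHcycle (component j g z).
Proof.
move=> [dz [y hy]]; split=> [r|].
  by rewrite ap_component_d (eq_component _ _ dz) component0.
exists (component (j + 1) (g - delta) y) => r.
by rewrite ap_component_x ap_component_d (eq_component _ _ hy) subrK.
Qed.

Lemma sum_component z : exists s : seq (int * G),
  forall e, z e = \sum_(p <- s) component p.1 p.2 z e.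
Proof.
exists (undup [seq (coh e, mwt wt m + gr e) | e <- enum (basis C), m <- msupp (z e)]).
move=> e; apply/mpolyP => m; rewrite raddf_sum /=; case: (boolP (m \in msupp (z e))) => hm.
  rewrite (bigD1_seq (coh e, mwt wt m + gr e)) ?undup_uniq //=; last first.
    by rewrite mem_undup; apply/allpairsPdep; exists e, m; rewrite mem_enum.
  rewrite {1}/component eqxx addrK mcoeff_pr eqxx mulr1n big1 ?addr0 //.
  move=> [j g] /= n; rewrite /component; case: eqVneq => [ej|_]; last by rewrite mcoeff0.
  rewrite mcoeff_pr; case: eqVneq => [eg|_]; last by rewrite mulr0n.
  by case/negP: n; rewrite ej eg subrK.
rewrite (memN_msupp_eq0 hm) big1 // => p _; rewrite /component; case: ifP => _.
  by rewrite mcoeff_pr (memN_msupp_eq0 hm) mul0rn.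
by rewrite mcoeff0.
Qed.

(** Both differentials are homogeneous, so the components of an iterated cycle are iterated cycles,
    and only finitely many of them are nonzero. Vanishing in every bidegree thus passes to arbitrary
    cycles. *)
Lemma HHboundary_of_homogeneous z : (forall j g, ~ HH_nz wt C j g) -> HHcycle z -> HHboundary z.
Proof.
move=> nz cz.
have hb j g : HHboundary (component j g z).
  apply: NNPP => nb; apply: (nz j g); exists (finfun (component j g z)).
  have eqf : finfun (component j g z) =1 component j g z by move=> e; rewrite ffunE.
  split; last first.
    case=> /bdy_HH[y [u [dy hy]]] _; apply: nb; exists y, u; split=> // r.
    by rewrite -hy eqf.
  split; last first.
    move=> e m; rewrite eqf /component; case: eqVneq => [ej|_]; last by rewrite msupp0.
    by move/(homE (hom_pr _ _ _)); rewrite /mwt => ->; rewrite subrK.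
  apply/cyc_HH; have [h [y hy]] := HHcycle_component j g cz.
  split=> [r|]; first by rewrite -(h r); apply: eq_ap.
  by exists y => r; rewrite -hy; apply: eq_ap.
have [s hs] := sum_component z.
suff [y [u [dy hy]]] : HHboundary (fun e => \sum_(p <- s) component p.1 p.2 z e).
  by exists y, u; split=> // r; rewrite hs hy.
elim: s {hs} => [|p s [y [u [dy hy]]]].
  exists (fun _ => 0), (fun _ => 0); split=> r.
    by rewrite /ap big1 // => i _; rewrite mulr0.
  by rewrite big_nil /ap !big1 ?addr0 // => i _; rewrite mulr0.
have [y' [u' [dy' hy']]] := hb p.1 p.2.
exists (fun e => y' e + y e), (fun e => u' e + u e); split=> r.
  by rewrite apD dy dy' addr0.
by rewrite big_cons hy hy' !apD addrACA.
Qed.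

(** Since [dmf] and [dchi] commute, the parity sign makes them anticommute, and the square of the
    sum is again W. *)
Definition total (r c : basis C) : S := d r c + (-1) ^+ par c * x r c.

Let s (e : basis C) : S := (-1) ^+ par e.

Let ss e : s e * s e = 1. Proof. by rewrite -expr2 sqrr_sign. Qed.

Let sd r c : s r * d r c = - (s c * d r c).
Proof.
rewrite /s; case: (eqVneq (par r) (par c)) => [/(good_dpar gC) ->|].
  by rewrite !mulr0 oppr0.
by case: (par r) (par c) => [] [] //= _; rewrite ?mulN1r ?mul1r ?opprK.
Qed.

Let sx r c : s r * x r c = s c * x r c.
Proof.
rewrite /s; case: (eqVneq (par r) (par c)) => [-> //|/(good_xpar gC) ->].
by rewrite !mulr0.
Qed.

Lemma ap_total z r : ap total z r = ap d z r + s r * ap x z r.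
Proof.
rewrite /ap mulr_sumr -big_split /=; apply: eq_bigr => c _.
by rewrite mulrDl mulrA sx.
Qed.

Lemma ap_d_sign z r : ap d (fun e => s e * z e) r = - (s r * ap d z r).
Proof.
rewrite /ap mulr_sumr -sumrN; apply: eq_bigr => c _.
by rewrite mulrCA !mulrA sd mulNr opprK.
Qed.

Lemma ap_x_sign z r : ap x (fun e => s e * z e) r = s r * ap x z r.
Proof.
rewrite /ap mulr_sumr; apply: eq_bigr => c _.
by rewrite mulrCA !mulrA sx.
Qed.

Lemma total_square r c : cmp total total r c = W *+ (r == c).
Proof.
have -> : cmp total total r c = ap total (total^~ c) r by [].
rewrite ap_total !apD -(good_dd gC).
have -> : ap d (fun r => (-1) ^+ par c * x r c) r = s c * cmp d x r c by apply: apZ.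
have -> : ap x (fun r => (-1) ^+ par c * x r c) r = s c * cmp x x r c by apply: apZ.
have -> : ap x (d^~ c) r = cmp x d r c by [].
have -> : s r * (cmp x d r c + s c * cmp x x r c) = - (s c * cmp x d r c).
  rewrite (good_xx gC) mulr0 addr0 /cmp !mulr_sumr -sumrN; apply: eq_bigr => k _.
  by rewrite mulrA sx mulrAC sd mulNr mulrAC mulrA.
by rewrite (good_dx gC) addrK.
Qed.

Definition restrict (j : int) z (e : basis C) : S := if coh e == j then z e else 0.

Lemma ap_restrict (dd : basis C -> basis C -> S) (a : int) j z r :
  (forall r c, coh r != coh c + a -> dd r c = 0) ->
  ap dd (restrict j z) r = restrict (j + a) (ap dd z) r.
Proof.
move=> hc; rewrite /restrict; case: (eqVneq (coh r) (j + a)) => [e|n].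
  apply: eq_bigr => c _; case: (eqVneq (coh c) j) => // n; rewrite (hc r c) ?mul0r //.
  by rewrite e (inj_eq (addIr a)) eq_sym.
rewrite /ap big1 // => c _; case: (eqVneq (coh c) j) => [e|_]; last by rewrite mulr0.
by rewrite (hc r c) ?mul0r // e.
Qed.

Lemma ap_d_restrict j z r : ap d (restrict j z) r = restrict j (ap d z) r.
Proof.
rewrite (@ap_restrict _ 0) ?addr0 // => r' c.
by rewrite addr0; apply: (good_dcoh gC).
Qed.

Lemma ap_x_restrict j z r : ap x (restrict j z) r = restrict (j + 1) (ap x z) r.
Proof. by apply: ap_restrict; apply: (good_xcoh gC). Qed.

(** A spectral sequence argument for the bounded filtration by cohomological degree: the lowest
    component of a total cycle is a cycle of the iterated homology, hence a boundary there, and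
    subtracting a total boundary raises the lowest degree. *)
Lemma total_exact : W = 0 -> (forall z, HHcycle z -> HHboundary z) ->
  exact (fun f => f = 0) total (fun _ => True).
Proof.
move=> W0 hb z _; have [m hm] : exists m : nat, forall e : basis C, (absz (coh e) < m)%N.
  exists (\sum_(e : basis C) absz (coh e)).+1 => e.
  by rewrite ltnS (bigD1 e) //= leq_addr.
(* Induction on the length n of the range of cohomological degrees j, ..., j + n - 1 which may
   support z. *)
suff : forall (n : nat) (j : int) z, (forall e : basis C, (coh e < j)%R -> z e = 0) ->
    (forall e : basis C, (coh e < j + n%:Z)%R) ->
    (forall r, ap total z r = 0) -> exists w, forall r, z r - ap total w r = 0.
  by move=> /(_ (m + m)%N (- m%:Z) z); apply=> e; have := hm e; lia.
elim=> [|n IH] j {}z hz hj dz.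
  exists (fun _ => 0) => r; rewrite hz; last by have := hj r; rewrite addr0.
  by rewrite /ap big1 ?subr0 // => i _; rewrite mulr0.
have dz' r : ap d z r = - (s r * ap x z r).
  by apply/eqP; rewrite -addr_eq0 -ap_total dz.
have xz0 r : (coh r <= j)%R -> ap x z r = 0.
  move=> hr; rewrite /ap big1 // => c _; case: (eqVneq (coh r) (coh c + 1)) => [e|n'].
    by rewrite hz ?mulr0 //; lia.
  by rewrite (good_xcoh gC) ?mul0r.
have [|y [u [dy hy]]] := hb (restrict j z).
  split=> [r|].
    rewrite ap_d_restrict /restrict; case: eqVneq => // e.
    by rewrite dz' xz0 ?mulr0 ?oppr0 // e.
  exists (fun e => s e * restrict (j + 1) z e) => r.
  rewrite ap_d_sign ap_d_restrict ap_x_restrict /restrict; case: eqVneq => // _.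
    by rewrite dz' mulrN opprK mulrA ss mul1r.
  by rewrite mulr0 oppr0.
(* [dchi] carries [y] from degree j - 1 to j, and [dmf] acts on [u] inside degree j; as d y = 0, the
   only other term lands in degree j + 1. The sign on [y] cancels the one in [total]. *)
pose v e := s e * restrict (j - 1) y e + restrict j u e.
pose z' e := z e - ap total v e.
have vE r : ap total v r = restrict j (ap x y) r + restrict j (ap d u) r
    + s r * restrict (j + 1) (ap x u) r.
  rewrite ap_total !apD ap_d_sign ap_x_sign !ap_d_restrict !ap_x_restrict subrK.
  rewrite mulrDr mulrA ss mul1r.
  have -> : restrict (j - 1) (ap d y) r = 0 by rewrite /restrict dy if_same.
  by rewrite mulr0 oppr0 add0r addrCA addrA.
have [e he|e|r|w hw] := IH (j + 1) z'.
- rewrite /z' vE {3}/restrict ifN ?mulr0 ?addr0; last by lia.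
  have := hy e; rewrite /restrict; case: (eqVneq (coh e) j) => [_ ->|n' _].
    by rewrite subrr.
  by rewrite addr0 subr0 hz //; lia.
- by have := hj e; lia.
- by rewrite /z' apB dz ap_comp (ap_diag _ _ total_square) W0 mul0r subrr.
by exists (fun e => v e + w e) => r; rewrite apD opprD addrA; apply: hw.
Qed.
End Nonvanishing.

(** * Basis vectors which survive modulo the variables *)

Section Special.
Variables (N : nat) (G : zmodType) (wt : 'I_N -> G).
Notation S := {mpoly rat[N]}.
Implicit Types (C D : mfcomplex S G).

(** No constant term, that is, membership in the ideal generated by all the variables. *)
Definition small (f : S) : bool := mon 1 (enum 'I_N) f.

Lemma small0 : small 0. Proof. exact: (id0 (ideal_mon 1 (enum 'I_N))). Qed.
Lemma smallD f g : small f -> small g -> small (f + g).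
Proof. by move=> hf hg; exact: (idD (ideal_mon 1 (enum 'I_N)) hf hg). Qed.
Lemma smallM f g : small g -> small (f * g).
Proof. by move=> hg; exact: (idM (ideal_mon 1 (enum 'I_N)) f hg). Qed.
Lemma smallMn f k : small f -> small (f *+ k).
Proof. by move=> h; rewrite -mulr_natl smallM. Qed.

Lemma hom_small g f : g != 0 -> hom wt f g -> small f.
Proof.
move=> g0 hf; apply/allP => m hm; apply: contraNT g0 => /hasPn h.
rewrite -(homE hf hm) /mwt big1 // => i _.
by have := h i; rewrite mem_enum -ltnNge ltnS leqn0 => /(_ isT)/eqP ->; rewrite mulr0n.
Qed.

(* Such a basis vector survives in the reduction of the complex modulo all the
   variables, where it is a cycle on which every boundary has coordinate 0. *)
Definition isolated C (r : basis C) : Prop :=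
  forall c, [/\ small (dmf r c), small (dmf c r), small (dchi r c) & small (dchi c r)].

Lemma isolated_tensor C D (r : basis C) (r' : basis D) :
  isolated r -> isolated r' -> @isolated (mf_tensor C D) (r, r').
Proof.
move=> h h' [c c']; have [h1 h2 h3 h4] := h c; have [h1' h2' h3' h4'] := h' c'.
by split; apply: smallD; apply: smallMn => //; apply: smallM.
Qed.

Lemma isolated_foldr (T : Type) (F : T -> mfcomplex S G) (s : seq T) A :
  (forall x, exists r : basis (F x), isolated r) -> (exists r : basis A, isolated r) ->
  exists r : basis (foldr (@mf_tensor S G) A (map F s)), isolated r.
Proof.
move=> hF hA; elim: s => [|x s [r hr]] //=.
by have [r' hr'] := hF x; exists (r', r); apply: isolated_tensor.
Qed.

Lemma ker_id f : ker (xtau (fun v : 'I_N => v)) f <-> f = 0.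
Proof. by rewrite /ker /sub comp_mpoly_id. Qed.

Lemma HH_nz_exists C delta (r : basis C) : good wt delta C 0 -> isolated r ->
  exists j g, HH_nz wt C j g.
Proof.
move=> gC hr; apply: NNPP => nz.
have ex0 : exact (fun f => f = 0) (@total _ _ C) (fun _ => True).
  apply: (total_exact gC) => // z; apply: (HHboundary_of_homogeneous gC) => j g h.
  by apply: nz; exists j, g.
have monE K f : monker (fun v : 'I_N => v) 1 K f = mon 1 K f.
  by rewrite /monker /sub comp_mpoly_id.
have exK K : uniq K ->
    exact (monker (fun v : 'I_N => v) 1 K) (@total _ _ C) (fun _ => True).
  elim: K => [_|v K IH /= /andP[vK /IH ex]].
    by apply: eq_exact ex0 => f; rewrite monE; split=> /mon_nil.
  apply: (@eq_exact _ (adj (monker (fun v => v) 1 K) ('X_v ^+ 1))).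
    by move=> f; rewrite -monker_cons.
  apply: exact_quotient ex; first exact: ideal_monker.
  - exact: regular_monker.
  - exact: id0 (ideal_monker _ _ _).
  - by move=> r' c; rewrite (total_square gC).
have tot c : small (total r c) /\ small (total c r).
  by have [h1 h2 h3 h4] := hr c; split; apply: smallD => //; apply: smallM.
(* Exactness is tested on the indicator of r: modulo all the variables it is a cycle, but a preimage
   would make 1 a polynomial without constant term. *)
have [//|e|w /(_ r)] := exK _ (enum_uniq 'I_N) (fun e => (e == r)%:R).
  rewrite monE /ap (bigD1 r) //= eqxx mulr1 big1 ?addr0; first by have [] := tot e.
  by move=> c /negPf ->; rewrite mulr0.
rewrite eqxx monE => h; have : small (1 : S).
  rewrite -(subrK (ap (@total _ _ C) w r) 1); apply: smallD => //.
  apply: (big_ind (fun f => small f)); [exact: small0|exact: smallD|].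
  by move=> c _; rewrite mulrC; apply: smallM; have [] := tot c.
rewrite /small /mon msupp1 /= andbT => /hasP[v _].
by rewrite mnm0E.
Qed.
End Special.

(** * Null-homotopies and reduction modulo powers of variables *)

Section ClosingArcs.
Variables (N : nat) (G : zmodType) (wt : 'I_N -> G) (delta : G).
Notation S := {mpoly rat[N]}.
Implicit Types (A C : mfcomplex S G) (M : mfact S G).

Definition null_homotopic C (f : S) (e : G) : Prop :=
  exists h : basis C -> basis C -> S,
    (forall r c, cmp (@dmf _ _ C) h r c + cmp h (@dmf _ _ C) r c = f *+ (r == c)) /\
    (forall r c, hom wt (h r c) (gr c + e - gr r)).

(** The parity sign of C makes the extended homotopy anticommute with the differential of C, so only
    the contribution of A is left. *)
Lemma null_tensor_r C A f e W : good wt delta C W ->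
  null_homotopic A f e -> null_homotopic (mf_tensor C A) f e.
Proof.
move=> gC [h [dh hh]]; pose s (c : basis C) : S := (-1) ^+ par c.
have ss r : s r * s r = 1 by rewrite -expr2 sqrr_sign.
have sd r c : s r * dmf r c = - (dmf r c * s c).
  rewrite mulrC /s; case: (eqVneq (par r) (par c)) => [/(good_dpar gC) ->|].
    by rewrite !mul0r oppr0.
  by case: (par r) (par c) => [] [] //= _; rewrite ?mulrN1 ?mulr1 ?opprK.
exists (tmx (fun _ _ => 0) s h); split=> [[r1 r2] [c1 c2]|[r1 r2] [c1 c2]].
  have E1 := cmp_tmx (@dmf _ _ C) (fun _ _ => 0) s s (@dmf _ _ A) h (r1, r2) (c1, c2).
  have E2 := cmp_tmx (fun _ _ => 0) (@dmf _ _ C) s s h (@dmf _ _ A) (r1, r2) (c1, c2).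
  apply: (etrans (congr2 +%R E1 E2)).
  rewrite /= cmp0l cmp0r !mul0rn ss sd xpair_eqE.
  case: (r1 == c1).
    by rewrite /= !mulr1n -(dh r2 c2); ring.
  by rewrite /= !mulr0n; ring.
rewrite /tmx /= mul0rn add0r; case: (eqVneq r1 c1) => [->|_]; last by rewrite mulr0n hom0.
have -> : gr c1 + gr c2 + e - (gr c1 + gr r2) = gr c2 + e - gr r2.
  by rewrite opprD -[X in X + _]addrA addrACA subrr add0r.
rewrite /s -signr_odd; case: (odd _); rewrite ?expr1 ?expr0 ?mulN1r ?mul1r.
  by apply: homMn; apply: homN.
exact: homMn.
Qed.

(** The homotopy goes by alpha from M^1 to M^0 and by beta back: on such a factor every combination
    of the two entries is null-homotopic. *)
Lemma null_mf1 (g0 g1 e : G) (p q alpha beta : S) A :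
  hom wt alpha (g1 + e - g0) -> hom wt beta (g0 + e - g1) ->
  null_homotopic (mf_tensor (mf_single (mf1 g0 g1 p q)) A) (alpha * p + beta * q) e.
Proof.
move=> ha hb; set M := mf1 g0 g1 p q.
pose s (c : bool) : S := (-1) ^+ c.
pose h (r c : bool) : S := if r == ~~ c then (if c then alpha else beta) else 0.
exists (tmx h (fun _ => 0) (fun _ _ => 0)); split=> [[r1 r2] [c1 c2]|[r1 r2] [c1 c2]].
  have E1 := cmp_tmx (@mdiff _ _ M) h s (fun _ => 0) (@dmf _ _ A) (fun _ _ => 0) (r1, r2) (c1, c2).
  have E2 := cmp_tmx h (@mdiff _ _ M) (fun _ => 0) s (fun _ _ => 0) (@dmf _ _ A) (r1, r2) (c1, c2).
  apply: (etrans (congr2 +%R E1 E2)).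
  rewrite /= cmp0l cmp0r /cmp !big_bool xpair_eqE /= /h /s.
  by case: r1 c1 {E1 E2} => [] []; case: (r2 == c2);
    rewrite /= ?expr0 ?expr1 ?mulr1n ?mulr0n ?mul0rn; ring.
rewrite /tmx /= mulr0 mul0rn addr0; case: (eqVneq r2 c2) => [->|_]; last by rewrite mulr0n hom0.
apply: homMn; rewrite opprD addrA.
have -> : (if c1 then g1 else g0) + gr c2 + e - (if r1 then g1 else g0) - gr c2
   = (if c1 then g1 else g0) + e - (if r1 then g1 else g0).
  by rewrite (addrAC _ (gr c2)) (addrAC _ (gr c2)) addrK.
by rewrite /h; case: r1 c1 => [] [] //=; apply: hom0.
Qed.

Variable tau : 'I_N -> 'I_N.
Hypothesis tauK : forall v, tau (tau v) = tau v.

(* Each step trades the variable [v], whose n-th power acts by 0 on the cohomology,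
   for a shift of the degree by e. *)
Lemma exact_mod_powers n C W e (K : seq 'I_N) g :
  good wt delta C W -> ker (xtau tau) W -> uniq K ->
  (forall v, v \in K -> tau v = v) ->
  (forall v, v \in K -> null_homotopic C ('X_v ^+ n) e) ->
  exactg wt (monker tau n K) C (g + e *+ size K) -> exactg wt (ker (xtau tau)) C g.
Proof.
move=> gC kW; elim: K g => [|v K IH] g /=.
  by move=> _ _ _; rewrite mulr0n addr0; apply: eq_exactg => f; apply: monker_nil.
move=> /andP[vK uK] hK hn ex; apply: IH => // [u uK'|u uK'|].
- by apply: hK; rewrite inE uK' orbT.
- by apply: hn; rewrite inE uK' orbT.
have [h [dh hh]] := hn v (mem_head _ _).
have tv : tau v = v by apply: hK; apply: mem_head.
have hI := ideal_monker tau n K.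
set g' := g + e *+ size K.
apply: (exact_homotopy (Z' := fun z => forall r : basis C, hom wt (z r) (g' + e - gr r))
  hI (regular_monker vK tv) _ (good_dd gC) dh).
- exact: (monker_ker n K kW).
- move=> z hz r; rewrite /ap; apply: hom_sum => c _.
  have -> : g' + e - gr r = gr c + e - gr r + (g' - gr c).
    by rewrite [RHS]addrC -(addrA (gr c)) [RHS]addrA addrNK addrA.
  by apply: homM.
move: ex; rewrite mulrSr addrA; apply: eq_exactg.
by move=> f; apply: monker_cons => // t tK; apply: hK; rewrite inE tK orbT.
Qed.
End ClosingArcs.

(** * Elimination along a braid *)

Section ListElimination.
Variables (N p : nat) (G : zmodType) (wt : 'I_N -> G) (delta : G).
Notation S := {mpoly rat[N]}.
(** The data common to both theories: [mk] places the marks among the variables (a may be an extra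
    one), [lev] is the height of a variable in the braid, and [pot] is the contribution of one mark
    to the potential, x^(n+1) or a x. *)
Variables (mk : 'I_p -> 'I_N) (lev : 'I_N -> nat) (pot : 'I_N -> S).
Hypothesis sub_pot : forall tau, (forall v, wt (tau v) = wt v) ->
  forall v, sub (xtau tau) (pot v) = pot (tau v).

(* [U] lists the variables which are still to be eliminated; the others have been
   replaced by their images, of lower or equal level. *)
Record elimination (tau : 'I_N -> 'I_N) (U : seq 'I_N) : Prop := {
  elim_idem : forall v, tau (tau v) = tau v;
  elim_wt : forall v, wt (tau v) = wt v;
  elim_lev : forall v, (lev (tau v) <= lev v)%N;
  elim_base : forall v, lev v = 0%N -> tau v = v;
  elim_todo : forall v, v \in U -> tau v = v;
  elim_done : forall v, tau v = v -> v \in U \/ lev v = 0%N }.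

(** As a and b are strictly lower than i and j, their images under tau are neither i nor j; hence
    the new substitution is idempotent and never raises a level. *)
Lemma elimination_merge2 tau i j a b U :
  elimination tau (i :: j :: U) -> uniq (i :: j :: U) ->
  (lev a < lev i)%N -> (lev a < lev j)%N -> (lev b < lev i)%N -> (lev b < lev j)%N ->
  wt a = wt i -> wt b = wt j ->
  elimination (merge2 tau i j a b) U.
Proof.
move=> [idem wtau ltau base todo fin] /=; rewrite inE negb_or => /and3P[/andP[nij iU] jU _].
move=> ai aj bi bj wa wb.
have ne u v : (lev u < lev v)%N -> tau u != v.
  by move=> h; apply: contraTneq h => <-; rewrite -leqNgt.
have Tne v : merge2 tau i j a b v != i /\ merge2 tau i j a b v != j.
  rewrite /merge2; case: (eqVneq (tau v) i) => [_|n]; first by rewrite !ne.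
  by case: (eqVneq (tau v) j) => [_|n'] //; rewrite !ne.
split=> v.
- rewrite {2 3}/merge2; case: eqVneq => [_|n].
    by rewrite /merge2 idem (negPf (ne _ _ ai)) (negPf (ne _ _ aj)).
  case: eqVneq => [_|n'].
    by rewrite /merge2 idem (negPf (ne _ _ bi)) (negPf (ne _ _ bj)).
  by rewrite /merge2 idem (negPf n) (negPf n').
- rewrite /merge2; case: eqVneq => [e|n]; first by rewrite wtau wa -e wtau.
  by case: eqVneq => [e|n']; rewrite wtau // wb -e wtau.
- rewrite /merge2; have := ltau v; case: eqVneq => [->|n] h.
    by rewrite (leq_trans (ltau a)) // (leq_trans (ltnW ai)).
  move: h; case: eqVneq => [->|//] h.
  by rewrite (leq_trans (ltau b)) // (leq_trans (ltnW bj)).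
- move=> v0; have lt0 u w : (lev u < lev w)%N -> v != w.
    by move=> h; apply: contraTneq h => <-; rewrite v0.
  by rewrite /merge2 base // (negPf (lt0 _ _ ai)) (negPf (lt0 _ _ aj)).
- move=> vU; have tv : tau v = v by apply: todo; rewrite !inE vU !orbT.
  rewrite /merge2 tv; case: eqVneq => [e|_]; first by rewrite -e vU in iU.
  by case: eqVneq => [e|_] //; rewrite -e vU in jU.
- move=> e; have [vi vj] := Tne v; rewrite e in vi vj.
  have tv : tau v = v.
    move: e; rewrite /merge2; case: eqVneq => [_ <-|_]; first exact: idem.
    by case: eqVneq => [_ <-|_ //]; apply: idem.
  have [|h] := fin v tv; last by right.
  by rewrite !inE (negPf vi) (negPf vj); left.
Qed.

Lemma elimination_merge tau i a U :
  elimination tau (i :: U) -> uniq (i :: U) -> (lev a < lev i)%N -> wt a = wt i ->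
  elimination (merge tau i a) U.
Proof.
move=> [idem wtau ltau base todo fin] /= /andP[iU _] ai wa.
have na : tau a != i by apply: contraTneq ai => <-; rewrite -leqNgt.
split=> v.
- rewrite {2 3}/merge; case: eqVneq => [_|n]; rewrite /merge idem ?(negPf na) //.
  by rewrite (negPf n).
- by rewrite /merge; case: eqVneq => [e|n]; rewrite wtau // wa -e wtau.
- rewrite /merge; have := ltau v; case: eqVneq => [->|n] h //.
  by rewrite (leq_trans (ltau a)) // (leq_trans (ltnW ai)).
- move=> v0; have ni : v != i by apply: contraTneq ai => <-; rewrite v0.
  by rewrite /merge base // (negPf ni).
- move=> vU; have tv : tau v = v by apply: todo; rewrite !inE vU !orbT.
  by rewrite /merge tv; case: eqVneq => [e|_] //; rewrite -e vU in iU.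
- move=> e; have vi : v != i by rewrite -e /merge; case: (eqVneq (tau v) i).
  have tv : tau v = v by move: e; rewrite /merge; case: eqVneq => [_ <-|//]; apply: idem.
  have [|h] := fin v tv; last by right.
  by rewrite inE (negPf vi); left.
Qed.

Variables (T : eqType) (cr : T -> crossing p).
Variables (X : crossing p -> mfcomplex S G) (Y : 'I_p * 'I_p -> mfcomplex S G).
Variable shifts : crossing p -> seq G.

Definition pot_crossing (c : crossing p) : S :=
  pot (mk (tl c)) + pot (mk (tr c)) - pot (mk (bl c)) - pot (mk (br c)).
Definition pot_arc (l : 'I_p * 'I_p) : S := pot (mk l.1) - pot (mk l.2).

Definition upward (c : crossing p) : bool :=
  [&& (lev (mk (bl c)) < lev (mk (tl c)))%N, (lev (mk (bl c)) < lev (mk (tr c)))%N,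
      (lev (mk (br c)) < lev (mk (tl c)))%N & (lev (mk (br c)) < lev (mk (tr c)))%N].

Hypothesis wt_mk : forall i j, wt (mk i) = wt (mk j).
Hypothesis good_X : forall t, good wt delta (X (cr t)) (pot_crossing (cr t)).
Hypothesis good_Y : forall l, good wt delta (Y l) (pot_arc l).

Hypothesis exact_X : forall tau c A WA W g,
  let i := mk (tl c) in let j := mk (tr c) in let k := mk (bl c) in let l := mk (br c) in
  (forall v, tau (tau v) = tau v) -> (forall v, wt (tau v) = wt v) ->
  tau i = i -> tau j = j -> i != j -> tau k != i -> tau k != j -> tau l != i -> tau l != j ->
  ker (xtau tau) W -> W = pot_crossing c + WA -> good wt delta A WA ->
  (forall s, s \in shifts c ->
    exactg wt (ker (xtau (merge2 tau i j k l))) A (g - s) /\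
    exactg wt (ker (xtau (merge2 tau i j l k))) A (g - s)) ->
  exactg wt (ker (xtau tau)) (mf_tensor (X c) A) g.

Hypothesis exact_Y : forall tau l A W g,
  (forall v, tau (tau v) = tau v) -> tau (mk l.1) = mk l.1 -> tau (mk l.2) != mk l.1 ->
  ker (xtau tau) W -> good wt delta (mf_tensor (Y l) A) W ->
  exactg wt (ker (xtau (merge tau (mk l.1) (mk l.2)))) A g ->
  exactg wt (ker (xtau tau)) (mf_tensor (Y l) A) g.

(** All total degree shifts which arise from one choice in [shifts] at every crossing; their extreme
    values enter the bounds. *)
Fixpoint shift_sums (cs : seq T) : seq G :=
  if cs is t :: cs' then [seq s + u | s <- shifts (cr t), u <- shift_sums cs'] else [:: 0].

Definition crossing_tops (cs : seq T) : seq 'I_N :=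
  flatten [seq [:: mk (tl (cr t)); mk (tr (cr t))] | t <- cs].
Definition arc_tops (ls : seq ('I_p * 'I_p)) : seq 'I_N := [seq mk l.1 | l <- ls].

Lemma ker_pot_merge (tau tau' : 'I_N -> 'I_N) f :
  (forall v, tau' (tau v) = tau' v) -> ker (xtau tau) f -> ker (xtau tau') f.
Proof.
rewrite /ker => h hf; rewrite -(@sub_sub _ (xtau tau') (xtau tau)) ?hf ?rmorph0 // => v.
by rewrite sub_X /xtau h.
Qed.

Lemma exact_crossings A WA : good wt delta A WA ->
  forall cs U tau g, (forall t, t \in cs -> upward (cr t)) ->
  uniq (crossing_tops cs ++ U) -> elimination tau (crossing_tops cs ++ U) ->
  ker (xtau tau) (\sum_(t <- cs) pot_crossing (cr t) + WA) ->
  (forall tau' s, elimination tau' U -> ker (xtau tau') WA -> s \in shift_sums cs ->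
    exactg wt (ker (xtau tau')) A (g - s)) ->
  exactg wt (ker (xtau tau)) (foldr (@mf_tensor S G) A [seq X (cr t) | t <- cs]) g.
Proof.
move=> gA; elim=> [|t cs IH] U tau g up; rewrite /= ?big_nil ?big_cons ?add0r.
  by move=> _ hel kW /(_ tau 0 hel kW (mem_head _ _)); rewrite subr0.
rewrite -addrA; set WA' := \sum_(t <- cs) _ + WA; move=> un hel kW hA.
have /and4P[ki kj li lj] := up t (mem_head _ _).
have [idem wtau ltau base todo fin] := hel.
have ne u v : (lev u < lev v)%N -> tau u != v.
  by move=> h; apply: contraTneq h => <-; rewrite -leqNgt.
move: un; rewrite /= inE negb_or -andbA => /and4P[nij iU jU un].
have un' : uniq (mk (tl (cr t)) :: mk (tr (cr t)) :: (crossing_tops cs ++ U)).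
  by rewrite /= inE negb_or nij iU jU.
have ti : tau (mk (tl (cr t))) = mk (tl (cr t)) by apply: todo; rewrite !inE eqxx.
have tj : tau (mk (tr (cr t))) = mk (tr (cr t)) by apply: todo; rewrite !inE eqxx orbT.
have gA' : good wt delta (foldr (@mf_tensor S G) A [seq X (cr t) | t <- cs]) WA'.
  exact: (@good_foldr _ _ _ _ _ (fun t => X (cr t)) (fun t => pot_crossing (cr t))).
have step a b s : s \in shifts (cr t) ->
    (a, b) = (mk (bl (cr t)), mk (br (cr t))) \/ (a, b) = (mk (br (cr t)), mk (bl (cr t))) ->
    exactg wt (ker (xtau (merge2 tau (mk (tl (cr t))) (mk (tr (cr t))) a b)))
      (foldr (@mf_tensor S G) A [seq X (cr t) | t <- cs]) (g - s).
  move=> hs hab.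
  have [ai [aj [bi bj]]] : (lev a < lev (mk (tl (cr t))))%N /\ (lev a < lev (mk (tr (cr t))))%N /\
      (lev b < lev (mk (tl (cr t))))%N /\ (lev b < lev (mk (tr (cr t))))%N.
    by case: hab => -[-> ->].
  have wab : wt a = wt (mk (tl (cr t))) /\ wt b = wt (mk (tr (cr t))).
    by case: hab => -[-> ->]; split; apply: wt_mk.
  have hel' := elimination_merge2 hel un' ai aj bi bj wab.1 wab.2.
  have k' : ker (xtau (merge2 tau (mk (tl (cr t))) (mk (tr (cr t))) a b))
      (pot_crossing (cr t) + WA').
    by apply: ker_pot_merge kW => v; rewrite /merge2 idem.
  apply: (IH U) => //; first by move=> t' ht'; apply: up; rewrite inE ht' orbT.
    (* Both ways of connecting the strands make the potential of this crossing vanish, so the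
       potential of the remaining factors is in the new kernel. *)
    apply: (idDr (ideal_ker _) (g := pot_crossing (cr t))); first by rewrite addrC.
    rewrite /ker /pot_crossing !rmorphB rmorphD /= !(sub_pot (elim_wt hel')).
    rewrite {1 2}/merge2 ti tj eqxx eq_sym (negPf nij) eqxx.
    have mk1 u : tau u != mk (tl (cr t)) -> tau u != mk (tr (cr t)) ->
        merge2 tau (mk (tl (cr t))) (mk (tr (cr t))) a b u = tau u.
      by rewrite /merge2 => /negPf -> /negPf ->.
    rewrite !mk1 ?ne //.
    by case: hab => -[-> ->]; ring.
  move=> tau' s' hel'' kA hs'; rewrite -addrA -opprD; apply: hA => //.
  by apply/allpairsP; exists (s, s').
apply: (exact_X (c := cr t) idem wtau ti tj _ _ _ _ _ kW erefl gA'); rewrite ?ne //.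
by move=> s hs; split; apply: step => //; [left|right].
Qed.

Lemma exact_arcs A WA : good wt delta A WA ->
  forall ls tau g, (forall l, l \in ls -> lev (mk l.2) < lev (mk l.1))%N ->
  uniq (arc_tops ls) -> elimination tau (arc_tops ls) ->
  ker (xtau tau) (\sum_(l <- ls) pot_arc l + WA) ->
  (forall tau', elimination tau' [::] -> ker (xtau tau') WA -> exactg wt (ker (xtau tau')) A g) ->
  exactg wt (ker (xtau tau)) (foldr (@mf_tensor S G) A [seq Y l | l <- ls]) g.
Proof.
move=> gA; elim=> [|l ls IH] tau g up; rewrite /= ?big_nil ?big_cons ?add0r.
  by move=> _ hel kW; apply.
rewrite -addrA; set WA' := \sum_(l <- ls) _ + WA; move=> /andP[iU un] hel kW hA.
have lt := up l (mem_head _ _).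
have [idem wtau ltau base todo fin] := hel.
have ne u v : (lev u < lev v)%N -> tau u != v.
  by move=> h; apply: contraTneq h => <-; rewrite -leqNgt.
have un' : uniq (mk l.1 :: arc_tops ls) by rewrite /= iU.
have ti : tau (mk l.1) = mk l.1 by apply: todo; rewrite !inE eqxx.
have gA' : good wt delta (foldr (@mf_tensor S G) A [seq Y l | l <- ls]) WA'.
  exact: good_foldr.
have hel' := elimination_merge hel un' lt (wt_mk _ _).
have k' : ker (xtau (merge tau (mk l.1) (mk l.2))) (pot_arc l + WA').
  by apply: ker_pot_merge kW => v; rewrite /merge idem.
apply: (exact_Y idem ti (ne _ _ lt) kW); first exact: good_tensor.
apply: IH => //; first by move=> l' hl'; apply: up; rewrite inE hl' orbT.
apply: (idDr (ideal_ker _) (g := pot_arc l)); first by rewrite addrC.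
rewrite /ker /pot_arc !rmorphB /= !(sub_pot (elim_wt hel')).
by rewrite /merge ti eqxx (negPf (ne _ _ lt)) subrr.
Qed.

(** The arcs in [cl] serve for no elimination: they are handed over, for every final substitution
    and every total shift, to a separate argument. *)
Lemma exact_closure cs ls cl g :
  (forall t, t \in cs -> upward (cr t)) ->
  (forall l, l \in ls -> lev (mk l.2) < lev (mk l.1))%N ->
  uniq (crossing_tops cs ++ arc_tops ls) ->
  (forall v, v \in crossing_tops cs ++ arc_tops ls \/ lev v = 0%N) ->
  \sum_(t <- cs) pot_crossing (cr t) + \sum_(l <- ls ++ cl) pot_arc l = 0 ->
  (forall tau s, elimination tau [::] -> ker (xtau tau) (\sum_(l <- cl) pot_arc l) ->
    s \in shift_sums cs ->
    exactg wt (ker (xtau tau)) (mf_bigtensor [seq Y l | l <- cl]) (g - s)) ->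
  exactg wt (fun f => f = 0)
    (mf_bigtensor ([seq X (cr t) | t <- cs] ++ [seq Y l | l <- ls ++ cl])) g.
Proof.
move=> upc upl un all_tops W0 hA.
rewrite /mf_bigtensor map_cat !foldr_cat -/(mf_bigtensor _).
have gcl : good wt delta (mf_bigtensor [seq Y l | l <- cl]) (\sum_(l <- cl) pot_arc l).
  by rewrite -[X in good _ _ _ X]addr0; apply: good_foldr => //; apply: good_unit.
have gls := good_foldr ls good_Y gcl.
apply: (@eq_exactg _ _ _ (ker (xtau (fun v => v)))); first exact: ker_id.
apply: (exact_crossings gls upc un).
- by split=> // v _; apply: all_tops.
- by apply/ker_id; rewrite big_cat /= in W0.
move=> tau s hel kW hs; apply: (exact_arcs gcl upl) => //.
  by move: un; rewrite cat_uniq => /and3P[].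
by move=> tau' hel' kW'; apply: hA.
Qed.

Lemma HH_nz_closure cs ls :
  \sum_(t <- cs) pot_crossing (cr t) + \sum_(l <- ls) pot_arc l = 0 ->
  (forall t, exists r : basis (X (cr t)), isolated r) ->
  (forall l, exists r : basis (Y l), isolated r) ->
  exists j g, HH_nz wt (mf_bigtensor ([seq X (cr t) | t <- cs] ++ [seq Y l | l <- ls])) j g.
Proof.
move=> W0 hX hY; rewrite /mf_bigtensor foldr_cat.
have gls := good_foldr ls good_Y (good_unit wt delta).
have gcs := @good_foldr _ _ _ _ _ (fun t => X (cr t)) _ cs _ _ good_X gls.
have [r hr] : exists r : basis (@mf_unit S G), isolated r.
  by exists tt => c; split; apply: small0.
have [r' hr'] := isolated_foldr ls hY (ex_intro _ r hr).
have [r'' hr''] := @isolated_foldr _ _ _ (fun t => X (cr t)) cs _ hX (ex_intro _ r' hr').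
by apply: HH_nz_exists hr''; move: gcs; rewrite addr0 W0; apply.
Qed.
End ListElimination.

(** * The local factorizations *)

Section MfLemmas.
Variables (N : nat) (G : zmodType) (wt : 'I_N -> G) (delta : G).
Notation S := {mpoly rat[N]}.

Lemma hom_cast (f : S) (g g' : G) : hom wt f g -> g = g' -> hom wt f g'.
Proof. by move=> h <-. Qed.

Lemma goodmf_mf1 (g0 g1 : G) (p q : S) :
  hom wt p (g0 + delta - g1) -> hom wt q (g1 + delta - g0) ->
  goodmf wt delta (mf1 g0 g1 p q) (p * q).
Proof.
move=> hp hq; split=> /=.
- by move=> r c; rewrite /cmp big_bool /=; case: r c => [] [] /=; rewrite ?mulr1n ?mulr0n; ring.
- by move=> r c ->; case: c.
- by move=> [] [] /=; rewrite ?hom0.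
Qed.

Lemma goodmf_mf2 (g00 g01 g10 g11 : G) (a b c d a' b' c' d' W : S) :
  mx2 a' b' c' d' *m mx2 a b c d = mx2 W 0 0 W ->
  mx2 a b c d *m mx2 a' b' c' d' = mx2 W 0 0 W ->
  hom wt a (g00 + delta - g10) -> hom wt b (g01 + delta - g10) ->
  hom wt c (g00 + delta - g11) -> hom wt d (g01 + delta - g11) ->
  hom wt a' (g10 + delta - g00) -> hom wt b' (g11 + delta - g00) ->
  hom wt c' (g10 + delta - g01) -> hom wt d' (g11 + delta - g01) ->
  goodmf wt delta (mf2 g00 g01 g10 g11 (mx2 a b c d) (mx2 a' b' c' d')) W.
Proof.
move=> e1 e2 ha hb hc hd ha' hb' hc' hd'; split.
- move=> r s; have := cmp_odd_odd (mx2 a b c d) (mx2 a' b' c' d')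
    (mx2 a b c d) (mx2 a' b' c' d') r s.
  by rewrite e1 e2 map2_scalar.
- by move=> [r1 r2] [c1 c2] /= ->; rewrite eq_sym; case: c1.
- move=> [r1 r2] [c1 c2] /=; case: r1 c1 => [] [] /=; rewrite ?hom0 //.
  + apply: (mx2_ind (P := fun x i j =>
      hom wt x ((if j == 0 then g00 else g01) + delta - (if i == 0 then g10 else g11)))) => //.
  + apply: (mx2_ind (P := fun x i j =>
      hom wt x ((if j == 0 then g10 else g11) + delta - (if i == 0 then g00 else g01)))) => //.
Qed.

Lemma good_arrow2 k (gr gr' : bool * 'I_2 -> G)
    (d0 d1 e0 e1 : 'M[S]_2) (a b c d a' b' c' d' W : S) :
  let M := MFact (fun e : bool * 'I_2 => e.1) gr (odd2 d0 d1) in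
  let M' := MFact (fun e : bool * 'I_2 => e.1) gr' (odd2 e0 e1) in
  goodmf wt delta M W -> goodmf wt delta M' W ->
  e0 *m mx2 a b c d = mx2 a' b' c' d' *m d0 ->
  e1 *m mx2 a' b' c' d' = mx2 a b c d *m d1 ->
  hom wt a (gr (false, 0) - gr' (false, 0)) -> hom wt b (gr (false, 1) - gr' (false, 0)) ->
  hom wt c (gr (false, 0) - gr' (false, 1)) -> hom wt d (gr (false, 1) - gr' (false, 1)) ->
  hom wt a' (gr (true, 0) - gr' (true, 0)) -> hom wt b' (gr (true, 1) - gr' (true, 0)) ->
  hom wt c' (gr (true, 0) - gr' (true, 1)) -> hom wt d' (gr (true, 1) - gr' (true, 1)) ->
  good wt delta (@mf_arrow S G k M M' (map2 (mx2 a b c d) (mx2 a' b' c' d'))) W.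
Proof.
move=> M M' gM gM' h0 h1 ha hb hc hd ha' hb' hc' hd'.
apply: good_arrow => //.
- move=> r t; have := cmp_odd_map e0 e1 (mx2 a b c d) (mx2 a' b' c' d') r t.
  by rewrite h0 h1 -cmp_map_odd.
- by move=> [r1 r2] [c1 c2] /=; rewrite /map2 /= => /negPf ->.
- move=> [r1 r2] [c1 c2] /=; rewrite /map2 /=; case: r1 c1 => [] [] /=; rewrite ?hom0 //.
    exact: (mx2_ind (P := fun x i j => hom wt x (gr (true, j) - gr' (true, i)))).
  exact: (mx2_ind (P := fun x i j => hom wt x (gr (false, j) - gr' (false, i)))).
Qed.

(* The relations between the entries of chi_0, chi_1 and the differentials all follow
   from the equality of the potentials and the definition of a_1. *)
Section Relations.
Variables A B v1 v2 b1 yi yj yk yl : S.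
Hypothesis potE : v1 * (yi + yj - yk - yl) + v2 * (yi * yj - yk * yl)
  = A * (yi - yk) + B * (yj - yl).
Hypothesis b1E : (b1 + v2) * (yi - yk) = v1 + yi * v2 - B.
Hypothesis ik : yi - yk != 0.

Let lin := yi + yj - yk - yl.
Let quad := yi * yj - yk * yl.
Let W := A * (yi - yk) + B * (yj - yl).
Let D0 := mx2 A (yj - yl) B (- yi + yk).
Let D1 := mx2 (yi - yk) (yj - yl) B (- A).
Let E0 := mx2 v1 quad v2 (- yi - yj + yk + yl).
Let E1 := mx2 lin quad v2 (- v1).

Lemma v1_rel : v1 = b1 * (yi - yk) + B - v2 * yk.
Proof.
have -> : v1 = (b1 + v2) * (yi - yk) - yi * v2 + B by rewrite b1E; ring.
ring.
Qed.

Lemma A_rel : A = v1 + v2 * yj + b1 * (yj - yl).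
Proof.
apply: (mulIf ik); have -> : A * (yi - yk) = v1 * lin + v2 * quad - B * (yj - yl).
  by rewrite potE; ring.
by rewrite v1_rel /lin /quad; ring.
Qed.

Lemma P0_square : D1 *m D0 = mx2 W 0 0 W /\ D0 *m D1 = mx2 W 0 0 W.
Proof. by rewrite !mx2_mul /W; split; congr mx2; ring. Qed.

Lemma P1_square : E1 *m E0 = mx2 W 0 0 W /\ E0 *m E1 = mx2 W 0 0 W.
Proof. by rewrite !mx2_mul /W -potE /lin /quad; split; congr mx2; ring. Qed.

Let f0 := mx2 (yk - yj) 0 b1 1.
Let f1 := mx2 yk (- yj) (-1) 1.
Let h0 := mx2 1 0 (- b1) (yk - yj).
Let h1 := mx2 1 yj 1 yk.

Lemma chi0_chain : E0 *m f0 = f1 *m D0 /\ E1 *m f1 = f0 *m D1.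
Proof. by rewrite !mx2_mul /lin /quad; split; congr mx2; rewrite ?A_rel ?v1_rel; ring. Qed.

Lemma chi1_chain : D0 *m h0 = h1 *m E0 /\ D1 *m h1 = h0 *m E1.
Proof. by rewrite !mx2_mul /lin /quad; split; congr mx2; rewrite ?A_rel ?v1_rel; ring. Qed.
End Relations.
End MfLemmas.

(** * Degrees of the polynomials u_1, u_2 and a_1 *)

Section Graded4.
Variable n : nat.
Local Notation A := {mpoly rat[4]}.
Local Notation h4 := (hom (fun _ : 'I_4 => 2 : int)).

Lemma hom_comp K N (G : zmodType) (wt : 'I_N -> G) (wt' : 'I_K -> G) (t : K.-tuple {mpoly rat[N]})
    (f : {mpoly rat[K]}) g :
  (forall i, hom wt (tnth t i) (wt' i)) -> hom wt' f g -> hom wt (f \mPo t) g.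
Proof.
move=> ht hf; rewrite comp_mpolyE big_seq; apply: hom_sum => m hm.
rewrite -(homE hf hm) /mwt; apply: homZ.
elim/big_rec2: _ => [|i x y _ IH]; first exact: hom1.
by apply: homM => //; apply: homXn.
Qed.

Lemma hom_psum N (wt : 'I_N -> int) (s t : {mpoly rat[N]}) m :
  hom wt s 2 -> hom wt t 4 -> hom wt (psum s t m) (2 * m%:Z).
Proof.
move=> hs ht.
suff: hom wt (psum s t m) (2 * m%:Z) /\ hom wt (psum s t m.+1) (2 * m.+1%:Z) by case.
elim: m => [|m [IH1 IH2]].
  by split; [apply: (hom_cast (homMn 2 (hom1 wt)))|apply: (hom_cast hs)].
split=> //; rewrite psumSS; apply: homB.
  by apply: hom_cast (homM hs IH2) _; lia.
by apply: hom_cast (homM ht IH1) _; lia.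
Qed.

Lemma hom_pi N (wt : 'I_N -> int) (x y : {mpoly rat[N]}) :
  hom wt x 2 -> hom wt y 2 -> hom wt (pi_ n x y) (2 * n%:Z).
Proof.
move=> hx hy; apply: hom_sum => s _.
by apply: hom_cast (homM (homXn s hx) (homXn (n - s) hy)) _; have := ltn_ord s; lia.
Qed.

Let hx i : h4 ('X_i) 2. Proof. exact: homX. Qed.
Let hxx i j : h4 ('X_i * 'X_j) 4. Proof. exact: hom_cast (homM (hx i) (hx j)) _. Qed.

Lemma hom_u1 : h4 (u1 n) (2 * n%:Z).
Proof.
have l0 : xi + xj - xk - xl != 0.
  apply/eqP => /(congr1 (fun p : A => p@_U_(inord 0))).
  rewrite !(mcoeffD, mcoeffN) !mcoeffXU -!val_eqE /= !inordK //= mcoeff0.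
  by rewrite ?addr0 ?subr0 ?oppr0 ?addr0 => /eqP; rewrite oner_eq0.
have hl : h4 (xi + xj - xk - xl) 2 by do ?[apply: homB|apply: homD]; apply: hx.
apply: (hom_factor l0 hl); rewrite mulrC u1E.
have -> : 2 + 2 * n%:Z = 2 * n.+1%:Z by lia.
by apply: homB; apply: hom_psum; rewrite ?hxx //; apply: homD; apply: hx.
Qed.

Lemma hom_u2 : h4 (u2 n) (2 * n%:Z - 2).
Proof.
have l0 : xi * xj - xk * xl != 0.
  rewrite subr_eq0; apply/eqP => /(congr1 (comp_mpoly [tuple 1; 1; 0; 0 : A])).
  rewrite !rmorphM /= !comp_mpolyXU !inordK //= mulr0 mulr1 => /eqP.
  by rewrite oner_eq0.
have hl : h4 (xi * xj - xk * xl) 4 by apply: homB; apply: hxx.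
apply: (hom_factor l0 hl); rewrite mulrC u2E.
have -> : 4 + (2 * n%:Z - 2) = 2 * n.+1%:Z by lia.
by apply: homB; apply: hom_psum; rewrite ?hxx //; apply: homD; apply: hx.
Qed.

Lemma hom_a1 : h4 (a1 n) (2 * n%:Z - 2).
Proof.
have l0 : xi - xk != 0.
  by apply: X_sub_neq0; rewrite -val_eqE /= !inordK.
have hl : h4 (xi - xk) 2 by apply: homB; apply: hx.
rewrite -(addrK (u2 n) (a1 n)); apply: homB; last exact: hom_u2.
apply: (hom_factor l0 hl); rewrite mulrC a1E.
have -> : 2 + (2 * n%:Z - 2) = 2 * n%:Z by lia.
apply: homB; last by apply: hom_pi; apply: hx.
apply: homD; first exact: hom_u1.
by apply: hom_cast (homM (hx _) hom_u2) _; lia.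
Qed.

Lemma comp_psum K N (t : K.-tuple {mpoly rat[N]}) (s u : {mpoly rat[K]}) m :
  psum s u m \mPo t = psum (s \mPo t) (u \mPo t) m.
Proof.
suff: psum s u m \mPo t = psum (s \mPo t) (u \mPo t) m
   /\ psum s u m.+1 \mPo t = psum (s \mPo t) (u \mPo t) m.+1 by case.
elim: m => [|m [IH1 IH2]]; first by rewrite /psum rmorph_nat.
by split=> //; rewrite !psumSS rmorphB !rmorphM /= IH1 IH2.
Qed.

Lemma comp_pi K N (t : K.-tuple {mpoly rat[N]}) (x y : {mpoly rat[K]}) :
  pi_ n x y \mPo t = pi_ n (x \mPo t) (y \mPo t).
Proof.
by rewrite /pi_ rmorph_sum; apply: eq_bigr => s _; rewrite rmorphM !rmorphXn.
Qed.
End Graded4.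

(** * Local factorizations of the theory H_n *)

Section TheoryNFacts.
Variables n p : nat.
Hypothesis n2 : (2 <= n)%N.
Notation S := {mpoly rat[p]}.
Local Notation wt2 := (fun _ : 'I_p => 2 : int).
Local Notation dn := (n%:Z + 1).
Implicit Types (c : crossing p) (l : 'I_p * 'I_p).

Definition pot_n (v : 'I_p) : S := 'X_v ^+ n.+1.

Lemma sub_pot_n (tau : 'I_p -> 'I_p) : (forall v, wt2 (tau v) = wt2 v) ->
  forall v, sub (xtau tau) (pot_n v) = pot_n (tau v).
Proof. by move=> _ v; rewrite rmorphXn /= sub_X. Qed.

Let wX v : hom wt2 ('X_v : S) 2. Proof. exact: homX. Qed.
Let wB u v : hom wt2 ('X_u - 'X_v : S) 2. Proof. exact: homB. Qed.
Let wpi u v : hom wt2 (pi_ n 'X_u 'X_v : S) (2 * n%:Z). Proof. exact: hom_pi. Qed.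
Let w1 : hom wt2 (1 : S) 0. Proof. exact: hom1. Qed.

Lemma goodmf_arc_n l :
  goodmf wt2 dn (mf1 0 (1 - n%:Z) (pi_ n 'X_l.1 'X_l.2) ('X_l.1 - 'X_l.2)) (pot_arc id pot_n l).
Proof.
rewrite /pot_arc /pot_n -piE; apply: goodmf_mf1; first by apply: hom_cast (wpi _ _) _; clear; rewrite /=; lia.
by apply: hom_cast (wB _ _) _; clear; rewrite /=; lia.
Qed.

Lemma good_arc_n l : good wt2 dn (arc_n n l) (pot_arc id pot_n l).
Proof. exact/good_single/goodmf_arc_n. Qed.

Section Crossing.
Variable c : crossing p.
Let yi : S := 'X_(tl c).
Let yj : S := 'X_(tr c).
Let yk : S := 'X_(bl c).
Let yl : S := 'X_(br c).
Let v1 : S := at_crossing c (u1 n).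
Let v2 : S := at_crossing c (u2 n).
Let b1 : S := at_crossing c (a1 n).
Let A : S := pi_ n yi yk.
Let B : S := pi_ n yj yl.
Let W : S := pot_crossing id pot_n c.

Let t4 : 4.-tuple S := [tuple yi; yj; yk; yl].

Let at_xi : xi \mPo t4 = yi. Proof. by rewrite comp_mpolyXU inordK. Qed.
Let at_xj : xj \mPo t4 = yj. Proof. by rewrite comp_mpolyXU inordK. Qed.
Let at_xk : xk \mPo t4 = yk. Proof. by rewrite comp_mpolyXU inordK. Qed.
Let at_xl : xl \mPo t4 = yl. Proof. by rewrite comp_mpolyXU inordK. Qed.

Lemma crossing_pot : W = A * (yi - yk) + B * (yj - yl).
Proof. by rewrite /A /B !piE /W /pot_crossing /pot_n -/yi -/yj -/yk -/yl; ring. Qed.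

(** The two differences telescope through g(x_k + x_l, x_i x_j), which leaves two sums of (n+1)-st
    powers. *)
Lemma crossing_potE : v1 * (yi + yj - yk - yl) + v2 * (yi * yj - yk * yl) = W.
Proof.
have E1 := congr1 (comp_mpoly t4) (u1E n); have E2 := congr1 (comp_mpoly t4) (u2E n).
rewrite !rmorphM !rmorphB !rmorphD /= !comp_psum !rmorphD !rmorphM /= in E1.
rewrite at_xi at_xj at_xk at_xl in E1.
rewrite !rmorphM !rmorphB !rmorphM /= !comp_psum !rmorphD !rmorphM /= in E2.
rewrite at_xi at_xj at_xk at_xl in E2.
apply: (etrans (congr2 +%R E1 E2)).
rewrite addrA subrK (psumE yi yj) (psumE yk yl).
by rewrite /W /pot_crossing /pot_n opprD addrA.
Qed.

Lemma crossing_a1E : (b1 + v2) * (yi - yk) = v1 + yi * v2 - B.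
Proof.
have := congr1 (comp_mpoly t4) (a1E n).
rewrite !rmorphM !rmorphB (rmorphD _ (a1 n)) (rmorphD _ (u1 n)) rmorphM /= comp_pi.
by rewrite at_xi at_xj at_xk at_xl.
Qed.

Let at_hom f g : hom (fun _ : 'I_4 => 2 : int) f g -> hom wt2 (at_crossing c f) g.
Proof.
apply: hom_comp => i; rewrite (tnth_nth 0).
by case: i => [[|[|[|[|//]]]] hi] /=; apply: wX.
Qed.

Let wv1 : hom wt2 v1 (2 * n%:Z). Proof. exact/at_hom/hom_u1. Qed.
Let wv2 : hom wt2 v2 (2 * n%:Z - 2). Proof. exact/at_hom/hom_u2. Qed.
Let wb1 : hom wt2 b1 (2 * n%:Z - 2). Proof. exact/at_hom/hom_a1. Qed.
Let wquad : hom wt2 (yi * yj - yk * yl) 4.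
Proof. by apply: homB; [apply: hom_cast (homM (wX _) (wX _)) _|apply: hom_cast (homM (wX _) (wX _)) _]. Qed.
Let wlin : hom wt2 (yi + yj - yk - yl) 2.
Proof. by do ?[apply: homB|apply: homD]; apply: wX. Qed.
Let wlin' : hom wt2 (- yi - yj + yk + yl) 2.
Proof. by do ?[apply: homD|apply: homN]; apply: wX. Qed.
Let wq' : hom wt2 (- yi + yk) 2.
Proof. by do ?[apply: homD|apply: homN]; apply: wX. Qed.
Let wN f g : hom wt2 f g -> hom wt2 (- f) g. Proof. exact: homN. Qed.

Lemma goodmf_P0_n : goodmf wt2 dn (P0_n n c) W.
Proof.
have [e0 e1] := P0_square A B yi yj yk yl; rewrite -crossing_pot in e0 e1.
apply: goodmf_mf2 => //.
- by apply: hom_cast (wpi _ _) _; clear; rewrite /=; lia.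
- by apply: hom_cast (wB _ _) _; clear; rewrite /=; lia.
- by apply: hom_cast (wpi _ _) _; clear; rewrite /=; lia.
- by apply: hom_cast wq' _; clear; rewrite /=; lia.
- by apply: hom_cast (wB _ _) _; clear; rewrite /=; lia.
- by apply: hom_cast (wB _ _) _; clear; rewrite /=; lia.
- by apply: hom_cast (wpi _ _) _; clear; rewrite /=; lia.
- by apply: hom_cast (wN (wpi _ _)) _; clear; rewrite /=; lia.
Qed.

Lemma goodmf_P1_n : goodmf wt2 dn (P1_n n c) W.
Proof.
have [e0 e1] := P1_square (etrans crossing_potE crossing_pot); rewrite -crossing_pot in e0 e1.
apply: goodmf_mf2 => //.
- by apply: hom_cast wv1 _; clear; rewrite /=; lia.
- by apply: hom_cast wquad _; clear; rewrite /=; lia.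
- by apply: hom_cast wv2 _; clear; rewrite /=; lia.
- by apply: hom_cast wlin' _; clear; rewrite /=; lia.
- by apply: hom_cast wlin _; clear; rewrite /=; lia.
- by apply: hom_cast wquad _; clear; rewrite /=; lia.
- by apply: hom_cast wv2 _; clear; rewrite /=; lia.
- by apply: hom_cast (wN wv1) _; clear; rewrite /=; lia.
Qed.

Lemma good_crossing_n : tl c != bl c -> good wt2 dn (crossing_n n c) W.
Proof.
move=> nik; have ik : yi - yk != 0 by apply: X_sub_neq0.
have hW := etrans crossing_potE crossing_pot.
rewrite /crossing_n; case: ifP => _.
  have [e0 e1] := chi1_chain hW crossing_a1E ik.
  apply: good_arrow2 => //; try exact: (goodmf_shift _ goodmf_P0_n); try exact: (goodmf_shift _ goodmf_P1_n).
  - by apply: hom_cast w1 _; clear; rewrite /=; lia.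
  - exact: hom0.
  - by apply: hom_cast (wN wb1) _; clear; rewrite /=; lia.
  - by apply: hom_cast (wB _ _) _; clear; rewrite /=; lia.
  - by apply: hom_cast w1 _; clear; rewrite /=; lia.
  - by apply: hom_cast (wX _) _; clear; rewrite /=; lia.
  - by apply: hom_cast w1 _; clear; rewrite /=; lia.
  - by apply: hom_cast (wX _) _; clear; rewrite /=; lia.
have [e0 e1] := chi0_chain hW crossing_a1E ik.
apply: good_arrow2 => //; try exact: (goodmf_shift _ goodmf_P0_n); try exact: (goodmf_shift _ goodmf_P1_n).
- by apply: hom_cast (wB _ _) _; clear; rewrite /=; lia.
- exact: hom0.
- by apply: hom_cast wb1 _; clear; rewrite /=; lia.
- by apply: hom_cast w1 _; clear; rewrite /=; lia.
- by apply: hom_cast (wX _) _; clear; rewrite /=; lia.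
- by apply: hom_cast (wN (wX _)) _; clear; rewrite /=; lia.
- by apply: hom_cast (wN w1) _; clear; rewrite /=; lia.
- by apply: hom_cast w1 _; clear; rewrite /=; lia.
Qed.

Let small_of f g : g != 0 -> hom wt2 f g -> small f. Proof. exact: hom_small. Qed.
Let s2 : (2 : int) != 0. Proof. by []. Qed.
Let s4 : (4 : int) != 0. Proof. by []. Qed.
Let s2n : 2 * n%:Z != 0. Proof. by clear -n2; lia. Qed.
Let s2n2 : 2 * n%:Z - 2 != 0. Proof. by clear -n2; lia. Qed.

Lemma isolated_crossing_n : exists r : basis (crossing_n n c), isolated r.
Proof.
have sX v : small ('X_v : S) by apply: small_of (wX v).
have sB u v : small ('X_u - 'X_v : S) by apply: small_of (wB u v).
have sq : small (yi * yj - yk * yl) by apply: small_of wquad.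
have sl : small (yi + yj - yk - yl) by apply: small_of wlin.
have sl' : small (- yi - yj + yk + yl) by apply: small_of wlin'.
have sv1 : small v1 by apply: small_of wv1.
have sv1' : small (- v1) by apply: small_of (wN wv1).
have sv2 : small v2 by apply: small_of wv2.
have s0 : small (0 : S) := @small0 p.
have d1 (i j : 'I_2) : small (mx2 v1 (yi * yj - yk * yl) v2 (- yi - yj + yk + yl) i j).
  exact: (mx2_ind (P := fun x _ _ => small x)).
have d2 (i j : 'I_2) : small (mx2 (yi + yj - yk - yl) (yi * yj - yk * yl) v2 (- v1) i j).
  exact: (mx2_ind (P := fun x _ _ => small x)).
rewrite /crossing_n; case: ifP => _.
  (* The vector lies in the source of chi_1, in the column with entries 0 and x_k - x_j, which
     avoids the constant entries. *)
  exists (inl (false, 1)) => -[[[] j]|[[] j]]; split; rewrite /= ?s0 //.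
  - exact: d2.
  - exact: d1.
  - by rewrite /chi1_n /map2 /= mxE /=; case: ifP.
(* Here the vector lies in the target of chi_0, in the row with entries x_k - x_j and 0. *)
exists (inr (false, 0)) => -[[[] j]|[[] j]]; split; rewrite /= ?s0 //.
- by rewrite /chi0_n /map2 /= mxE /=; case: ifP.
- exact: d2.
- exact: d1.
Qed.
End Crossing.

Lemma isolated_arc_n l : exists r : basis (arc_n n l), isolated r.
Proof.
exists false => -[]; split; rewrite /= ?small0 //.
  by apply: (@hom_small _ _ wt2 2) => //; apply: wB.
by apply: (@hom_small _ _ wt2 (2 * n%:Z)) => //; clear -n2; lia.
Qed.

Lemma exact_arc_n (tau : 'I_p -> 'I_p) l C W g :
  (forall v, tau (tau v) = tau v) -> tau l.1 = l.1 -> tau l.2 != l.1 ->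
  ker (xtau tau) W -> good wt2 dn (mf_tensor (arc_n n l) C) W ->
  exactg wt2 (ker (xtau (merge tau l.1 l.2))) C g ->
  exactg wt2 (ker (xtau tau)) (mf_tensor (arc_n n l) C) g.
Proof. by move=> idem t1 t2 kW gT ex; apply: exact_arc gT _ => //; rewrite subr0. Qed.

(** At a positive crossing P_0 is shifted by n - 1 and P_1 by n. The generator of P_1 which carries
    the quotient has degree -1, and multiplication by x_i - x_l adds 2 for one of the two
    connections, whence n - 1 and n + 1. At a negative crossing the shifts are 1 - n and - n. *)
Definition shifts_n c : seq int :=
  if positive c then [:: n%:Z - 1; n%:Z + 1] else [:: 1 - n%:Z; - n%:Z - 1].

Lemma exact_crossing_n (tau : 'I_p -> 'I_p) c C WA W g :
  (forall v, tau (tau v) = tau v) ->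
  tau (tl c) = tl c -> tau (tr c) = tr c -> tl c != tr c ->
  tau (bl c) != tl c -> tau (bl c) != tr c -> tau (br c) != tl c -> tau (br c) != tr c ->
  ker (xtau tau) W -> W = pot_crossing id pot_n c + WA -> good wt2 dn C WA ->
  (forall s, s \in shifts_n c ->
    exactg wt2 (ker (xtau (merge2 tau (tl c) (tr c) (bl c) (br c)))) C (g - s) /\
    exactg wt2 (ker (xtau (merge2 tau (tl c) (tr c) (br c) (bl c)))) C (g - s)) ->
  exactg wt2 (ker (xtau tau)) (mf_tensor (crossing_n n c) C) g.
Proof.
move=> idem ti tj nij tki tkj tli tlj kW EW gC ex.
have gT s M : goodmf wt2 dn M (pot_crossing id pot_n c) ->
    good wt2 dn (mf_tensor (mf_single (mfshift s M)) C) W.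
  by move=> gM; rewrite EW; apply: good_tensor => //; apply/good_single/goodmf_shift.
have exP0 s : s \in shifts_n c ->
    exactg wt2 (ker (xtau tau)) (mf_tensor (mf_single (mfshift s (P0_n n c))) C) g.
  move=> hs; apply: exact_P0 (gT _ _ (goodmf_P0_n c)) _ => //.
  by rewrite add0r; apply: (ex s hs).1.
have exP1 s : s - 1 \in shifts_n c -> s + 1 \in shifts_n c ->
    exactg wt2 (ker (xtau tau)) (mf_tensor (mf_single (mfshift s (P1_n n c))) C) g.
  move=> hs hs'; apply: (@exact_P1 _ _ wt2 dn _ idem _ _ _ _ _ _ _ _ _ _ 2 _ WA W _ _ _ _ _
    ti tj nij tki tkj tli tlj _ _ _ _ kW _ (gT _ _ (goodmf_P1_n c)) gC) => //.
  - by rewrite EW -crossing_potE.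
  - by rewrite (addrC (-1)); apply: (ex _ hs).2.
  - have -> : g - (-1 + s) - 2 = g - (s + 1) by clear; lia.
    exact: (ex _ hs').1.
rewrite /crossing_n; move: exP0 exP1; rewrite /shifts_n; case: ifP => _ exP0 exP1.
  apply: exact_arrow; [apply: exP1|apply: exP0]; rewrite !inE; clear; apply/orP; lia.
apply: exact_arrow; [apply: exP0|apply: exP1]; rewrite !inE; clear; apply/orP; lia.
Qed.
End TheoryNFacts.

(** * Local factorizations of the triply graded theory *)

Section TheoryHatFacts.
Variable p : nat.
Notation S := {mpoly rat[p.+1]}.
Notation G := (int * int)%type.
Local Notation wth := (@wt_hat p).
Local Notation dh := ((1, 1) : G).
Local Notation mk := (lift ord0 : 'I_p -> 'I_p.+1).
Implicit Types (c : crossing p) (l : 'I_p * 'I_p).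

Definition pot_h (v : 'I_p.+1) : S := va p * 'X_v.

Lemma wt_hat0 v : wth v = (2, 0) -> v = ord0.
Proof. by rewrite /wt_hat; case: eqVneq. Qed.

(** The variable a is the only one of its degree, so a degree-preserving identification of variables
    must fix it. *)
Lemma fix_a (tau : 'I_p.+1 -> 'I_p.+1) : (forall v, wth (tau v) = wth v) -> tau ord0 = ord0.
Proof. by move=> h; apply: wt_hat0; rewrite h. Qed.

Lemma sub_pot_h (tau : 'I_p.+1 -> 'I_p.+1) : (forall v, wth (tau v) = wth v) ->
  forall v, sub (xtau tau) (pot_h v) = pot_h (tau v).
Proof. by move=> h v; rewrite rmorphM /= !sub_X /xtau (fix_a h). Qed.

Let wa : hom wth (va p) (2, 0). Proof. exact: homX. Qed.
Let wX v : hom wth (vx v) (0, 2). Proof. exact: homX. Qed.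
Let wN f g : hom wth f g -> hom wth (- f) g. Proof. exact: homN. Qed.
Let wB u v : hom wth (vx u - vx v) (0, 2). Proof. by apply: homB; apply: wX. Qed.
Let wXX u v : hom wth (vx u * vx v) (0, 4).
Proof. exact: hom_cast (homM (wX u) (wX v)) _. Qed.
Let w1 : hom wth (1 : S) (0, 0). Proof. exact: hom1. Qed.

Lemma goodmf_arc_h l :
  goodmf wth dh (mf1 (0, 0) (-1, 1) (va p) (vx l.1 - vx l.2)) (pot_arc mk pot_h l).
Proof.
have -> : pot_arc mk pot_h l = va p * (vx l.1 - vx l.2) by rewrite mulrBr.
by apply: goodmf_mf1; [apply: hom_cast wa _|apply: hom_cast (wB _ _) _].
Qed.

Lemma good_arc_h l : good wth dh (arc_h l) (pot_arc mk pot_h l).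
Proof. exact/good_single/goodmf_arc_h. Qed.

Section Crossing.
Variable c : crossing p.
Let yi : S := vx (tl c).
Let yj : S := vx (tr c).
Let yk : S := vx (bl c).
Let yl : S := vx (br c).
Let W : S := pot_crossing mk pot_h c.

Lemma crossing_pot_h : W = va p * (yi - yk) + va p * (yj - yl).
Proof. by rewrite -[W]/(va p * yi + va p * yj - va p * yk - va p * yl); ring. Qed.

(** The relations between the local maps are those of H_n with [pi_] and u_1 replaced by a, and u_2
    and a_1 by 0. *)
Let potE : va p * (yi + yj - yk - yl) + 0 * (yi * yj - yk * yl)
  = va p * (yi - yk) + va p * (yj - yl).
Proof. ring. Qed.

Let a1E : (0 + 0) * (yi - yk) = va p + yi * 0 - va p.
Proof. ring. Qed.

Let wquad : hom wth (yi * yj - yk * yl) (0, 4).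
Proof. by apply: homB; apply: wXX. Qed.
Let wlin : hom wth (yi + yj - yk - yl) (0, 2).
Proof. by apply: homB; [apply: homB; [apply: homD|]|]; apply: wX. Qed.
Let wlin' : hom wth (- yi - yj + yk + yl) (0, 2).
Proof. by apply: homD; [apply: homD; [apply: homD; apply: wN|]|]; apply: wX. Qed.
Let wq' : hom wth (- yi + yk) (0, 2).
Proof. by apply: homD; [apply: wN|]; apply: wX. Qed.

Lemma goodmf_P0_h : goodmf wth dh (P0_h c) W.
Proof.
have [e0 e1] := P0_square (va p) (va p) yi yj yk yl; rewrite -crossing_pot_h in e0 e1.
by apply: goodmf_mf2 => //; apply: hom_cast (wN wa) _.
Qed.

Lemma goodmf_P1_h : goodmf wth dh (P1_h c) W.
Proof.
have [e0 e1] := P1_square potE; rewrite -crossing_pot_h in e0 e1.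
by apply: goodmf_mf2 => //; [apply: hom0|apply: hom0|apply: hom_cast (wN wa) _].
Qed.

Lemma good_crossing_h : tl c != bl c -> good wth dh (crossing_h c) W.
Proof.
move=> nik; have ik : yi - yk != 0.
  by apply: X_sub_neq0; rewrite (inj_eq lift_inj).
rewrite /crossing_h; case: ifP => _.
  have [e0 e1] := chi1_chain potE a1E ik; rewrite oppr0 in e0 e1.
  apply: good_arrow2 => //; try exact: (goodmf_shift _ goodmf_P0_h);
    try exact: (goodmf_shift _ goodmf_P1_h); exact: hom0.
have [e0 e1] := chi0_chain potE a1E ik.
apply: good_arrow2 => //; try exact: (goodmf_shift _ goodmf_P0_h); try exact: goodmf_P1_h.
- exact: hom0.
- exact: hom0.
- by apply: hom_cast (wN (wX _)) _.
- by apply: hom_cast (wN w1) _.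
Qed.

Lemma isolated_crossing_h : exists r : basis (crossing_h c), isolated r.
Proof.
have s0 : small (0 : S) := @small0 p.+1.
have sB u v : small (vx u - vx v : S) by apply: hom_small (wB u v).
have d1 (i j : 'I_2) : small (mx2 (va p) (yi * yj - yk * yl) 0 (- yi - yj + yk + yl) i j).
  apply: (mx2_ind (P := fun x _ _ => small x)) => //.
  - exact: hom_small wa.
  - exact: hom_small wquad.
  - exact: hom_small wlin'.
have d2 (i j : 'I_2) : small (mx2 (yi + yj - yk - yl) (yi * yj - yk * yl) 0 (- va p) i j).
  apply: (mx2_ind (P := fun x _ _ => small x)) => //.
  - exact: hom_small wlin.
  - exact: hom_small wquad.
  - exact: hom_small (wN wa).
rewrite /crossing_h; case: ifP => _.
  exists (inl (false, 1)) => -[[[] j]|[[] j]]; split; rewrite /= ?s0 //.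
  - exact: d2.
  - by rewrite /chi1_h /map2 /= mxE /=; case: ifP.
exists (inr (false, 0)) => -[[[] j]|[[] j]]; split; rewrite /= ?s0 //.
- by rewrite /chi0_h /map2 /= mxE /=; case: ifP.
- exact: d2.
Qed.
End Crossing.

Lemma isolated_arc_h l : exists r : basis (arc_h l), isolated r.
Proof.
exists false => -[]; split; rewrite /= ?small0 //.
  exact: hom_small (wB _ _).
exact: hom_small wa.
Qed.

Lemma exact_arc_h (tau : 'I_p.+1 -> 'I_p.+1) l C W g :
  (forall v, tau (tau v) = tau v) -> tau (mk l.1) = mk l.1 -> tau (mk l.2) != mk l.1 ->
  ker (xtau tau) W -> good wth dh (mf_tensor (arc_h l) C) W ->
  exactg wth (ker (xtau (merge tau (mk l.1) (mk l.2)))) C g ->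
  exactg wth (ker (xtau tau)) (mf_tensor (arc_h l) C) g.
Proof. by move=> idem t1 t2 kW gT ex; apply: exact_arc gT _ => //; rewrite subr0. Qed.

(** The a-degree is 0 throughout, so the crossings do not move the range of a-degrees left by the
    closing arcs. *)
Definition shifts_h c : seq G :=
  if positive c then [:: (0, -2); (0, 0)] else [:: (0, 2); (0, 0)].

Lemma exactg_shift0 I (M : mfact S G) C g :
  exactg wth I (mf_tensor (mf_single (mfshift 0 M)) C) g ->
  exactg wth I (mf_tensor (mf_single M) C) g.
Proof. by move=> ex z hz dz; apply: ex => // e; have := hz e; rewrite /= addr0. Qed.

Lemma exact_crossing_h (tau : 'I_p.+1 -> 'I_p.+1) c C WA W g :
  let i := mk (tl c) in let j := mk (tr c) in let k := mk (bl c) in let l := mk (br c) in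
  (forall v, tau (tau v) = tau v) -> (forall v, wth (tau v) = wth v) ->
  tau i = i -> tau j = j -> i != j -> tau k != i -> tau k != j -> tau l != i -> tau l != j ->
  ker (xtau tau) W -> W = pot_crossing mk pot_h c + WA -> good wth dh C WA ->
  (forall s, s \in shifts_h c ->
    exactg wth (ker (xtau (merge2 tau i j k l))) C (g - s) /\
    exactg wth (ker (xtau (merge2 tau i j l k))) C (g - s)) ->
  exactg wth (ker (xtau tau)) (mf_tensor (crossing_h c) C) g.
Proof.
move=> i j k l idem wtau ti tj nij tki tkj tli tlj kW EW gC ex.
have gT s M : goodmf wth dh M (pot_crossing mk pot_h c) ->
    good wth dh (mf_tensor (mf_single (mfshift s M)) C) W.
  by move=> gM; rewrite EW; apply: good_tensor => //; apply/good_single/goodmf_shift.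
have exP0 s : s \in shifts_h c ->
    exactg wth (ker (xtau tau)) (mf_tensor (mf_single (mfshift s (P0_h c))) C) g.
  move=> hs; apply: exact_P0 (gT _ _ (goodmf_P0_h c)) _ => //.
  by rewrite add0r; apply: (ex s hs).1.
have exP1 s : s \in shifts_h c -> s + (0, 2) \in shifts_h c ->
    exactg wth (ker (xtau tau)) (mf_tensor (mf_single (mfshift s (P1_h c))) C) g.
  move=> hs hs'; apply: (@exact_P1 _ _ wth dh _ idem wtau _ _ _ _ _ _ _ _ _ (0, 2) _ WA W _ _ _ _ _
    ti tj nij tki tkj tli tlj _ _ _ _ kW _ (gT _ _ (goodmf_P1_h c)) gC) => //.
  - by rewrite EW crossing_pot_h -mulrDr mul0r addr0 /vx; congr (_ * _ + _); ring.
  - by rewrite add0r; apply: (ex _ hs).2.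
  - by rewrite add0r -addrA -opprD; apply: (ex _ hs').1.
rewrite /crossing_h; move: exP0 exP1; rewrite /shifts_h; case: ifP => _ exP0 exP1.
  by apply: exact_arrow; [apply: exP1|apply: exP0].
by apply: exact_arrow; [apply: exP0|apply: exactg_shift0; apply: exP1].
Qed.
End TheoryHatFacts.

(** * Degree bounds for the closing arcs *)

Section Closing.

(** For the degrees in which the module itself is 0 modulo I. *)
Lemma exactg_trivial N (G : zmodType) (wt : 'I_N -> G) (I : {mpoly rat[N]} -> Prop) C g :
  ideal I ->
  (forall (e : basis C) f, hom wt f (g - gr e) -> I f) -> exactg wt I C g.
Proof.
move=> hI h z hz _; exists (fun _ => 0) => r.
apply: (idB hI); first exact: h (hz r).
by apply: (id_ap hI) => c; apply: id0.
Qed.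

Section N.
Variables n p : nat.
Hypothesis n2 : (2 <= n)%N.
Local Notation wt2 := (fun _ : 'I_p => 2 : int).
Local Notation S := {mpoly rat[p]}.

Lemma mwt2 (m : 'X_{1..p}) : mwt wt2 m = 2 * (\sum_(i < p) m i)%N%:Z.
Proof.
rewrite /mwt; elim/big_rec2: _ => [|i x y _ ->]; first by rewrite mulr0.
by rewrite PoszD mulrDr; congr (_ + _); rewrite -[LHS]mulr_natr (natz (m i)).
Qed.

Lemma gr_arcs_n ls (e : basis (mf_bigtensor [seq arc_n n l | l <- ls : seq ('I_p * 'I_p)])) :
  - (n%:Z - 1) * (size ls)%:Z <= gr e <= 0.
Proof.
elim: ls e => [|l ls IH] e; first by rewrite /= mulr0 lexx.
rewrite /=.
case: e => e1 e2 /=; have := IH e2.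
set x := gr e2; move: x => x; move: (size ls) => k.
by case: e1; rewrite /= intS mulrDr; nia.
Qed.

(** The quotient of (n + 1) x^n - [pi_ n x y] by x - y, taken term by term from x^n - x^s y^(n-s).
    It exists since [pi_ n x x] is (n + 1) x^n, the derivative of the potential. *)
Definition kappa (x y : S) : S :=
  \sum_(s < n.+1) x ^+ s * \sum_(i < n - s) x ^+ ((n - s).-1 - i) * y ^+ i.

Lemma kappaE x y : (x - y) * kappa x y = (n.+1)%:R * x ^+ n - pi_ n x y.
Proof.
rewrite /kappa /pi_ mulr_sumr.
have -> : (n.+1)%:R * x ^+ n = \sum_(s < n.+1) x ^+ n.
  by rewrite sumr_const card_ord mulr_natl.
rewrite -sumrB; apply: eq_bigr => s _.
rewrite mulrCA -subrXX mulrBr -exprD subnKC //.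
by have := ltn_ord s.
Qed.

Lemma hom_kappa x y : hom wt2 x 2 -> hom wt2 y 2 -> hom wt2 (kappa x y) (2 * (n%:Z - 1)).
Proof.
move=> hx hy; apply: hom_sum => s _; rewrite mulr_sumr; apply: hom_sum => i _.
apply: hom_cast (homM (homXn s hx) (homM (homXn ((n - s).-1 - i) hx) (homXn i hy))) _.
by have hi := ltn_ord i; have hs := ltn_ord s; clear -n2 hi hs; lia.
Qed.

(** Division by n + 1 writes x^n as a combination of the two entries of the arc. The coefficient of
    [pi_] is a constant, which forces the degree e of the homotopy: 1 - n + e = 0. *)
Lemma null_arcs_n ls l : l \in ls ->
  null_homotopic wt2 (mf_bigtensor [seq arc_n n l | l <- ls]) ('X_l.1 ^+ n) (n%:Z - 1).
Proof.
elim: ls => // l' ls IH; rewrite inE => /orP[/eqP <-|/IH h]; last first.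
  exact: null_tensor_r (good_arc_n n l') h.
have hx v : hom wt2 ('X_v : S) 2 by apply: homX.
have -> : 'X_l.1 ^+ n = (n.+1%:R^-1)%:MP * pi_ n 'X_l.1 'X_l.2
    + (n.+1%:R^-1 *: kappa 'X_l.1 'X_l.2) * ('X_l.1 - 'X_l.2) :> S.
  rewrite -mul_mpolyC -mulrA -mulrDr (mulrC (kappa _ _)) kappaE addrC subrK.
  rewrite mulrA -(mpolyC_nat p rat) -mpolyCM mulVf ?mul1r //.
  by rewrite pnatr_eq0.
apply: null_mf1.
  rewrite -[_%:MP]mulr1 mul_mpolyC; apply: homZ; apply: hom_cast (hom1 _) _.
  by clear; lia.
by apply: homZ; apply: hom_cast (hom_kappa (hx _) (hx _)) _; clear; lia.
Qed.

Lemma closing_bound_n (lev : 'I_p -> nat) tau ls g :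
  elimination wt2 lev tau [::] -> ker (xtau tau) (\sum_(l <- ls) pot_arc id (pot_n n (p := p)) l) ->
  uniq [seq l.1 | l <- ls] -> (forall l, l \in ls -> lev l.1 = 0%N) ->
  (forall v, lev v = 0%N -> v \in [seq l.1 | l <- ls]) ->
  (g < - (n%:Z - 1) * (size ls)%:Z) || ((n%:Z - 1) * (size ls)%:Z < g) ->
  exactg wt2 (ker (xtau tau)) (mf_bigtensor [seq arc_n n l | l <- ls]) g.
Proof.
move=> [idem wtau ltau base _ fin] kW un lev0 allv hg.
have gA : good wt2 (n%:Z + 1) (mf_bigtensor [seq arc_n n l | l <- ls])
    (\sum_(l <- ls) pot_arc id (pot_n n (p := p)) l).
  rewrite -[X in good _ _ _ X]addr0; apply: good_foldr; first exact: good_arc_n.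
  exact: good_unit.
have fixK v : v \in [seq l.1 | l <- ls] -> tau v = v.
  by case/mapP => l hl ->; apply/base/lev0.
case/orP: hg => hg.
  apply: exactg_trivial; first exact: ideal_ker.
  move=> e f hf; suff -> : f = 0 by rewrite /ker rmorph0.
  apply/eqP; rewrite -msupp_eq0; case E: (msupp f) => [//|m r].
  have := homE hf (_ : m \in msupp f); rewrite E mem_head mwt2 => /(_ isT).
  have /andP[h1 _] := gr_arcs_n e; have h2 := lt_le_trans hg h1 => h3.
  have neg (a b : int) (x : nat) : 2 * x%:Z = a - b -> a < b -> False by clear; lia.
  by case: (neg _ _ _ h3 h2).
(* In high degrees all the bottom variables are treated in turn, each for a shift by n - 1. *)
apply: (exact_mod_powers idem gA kW un fixK (n := n) (e := n%:Z - 1)).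
  by move=> v /mapP[l hl ->]; apply: null_arcs_n.
apply: exactg_trivial; first exact: ideal_monker.
move=> e f hf; apply/allP => m hm.
have hf' : hom wt2 (sub (xtau tau) f) (g + (n%:Z - 1) *+ size [seq l.1 | l <- ls] - gr e).
  by apply: hom_sub hf => v; apply: homX.
have := homE hf' hm; rewrite mwt2; have [m' _ Em] := msupp_tau hm.
apply: contra_eqT => /hasPn small_m.
(* As an image under tau the monomial involves bottom variables only, and outside the ideal each
   exponent is at most n - 1. With b arcs its degree is at most 2 (n - 1) b, whereas g + (n - 1) b -
   [gr e] is larger. *)
have : (\sum_(i < p) m i <= size [seq l.1 | l <- ls] * n.-1)%N.
  rewrite (bigID (mem [seq l.1 | l <- ls])) /= [X in (_ + X)%N]big1 ?addn0; last first.
    move=> v vK; rewrite Em mtauE big1 // => i /eqP ti.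
    case: (fin v); rewrite -?ti ?idem // => /allv; rewrite ti => h.
    by rewrite h in vK.
  rewrite -big_uniq //= -sum1_size big_distrl /= big_seq [X in (_ <= X)%N]big_seq.
  apply: leq_sum => v /small_m; rewrite -ltnNge mul1n.
  by case: (n) n2 => // k _; rewrite ltnS.
rewrite -[_ *+ size _]mulr_natr (natz (size _)) size_map => hx.
have {}hx : (\sum_(i < p) m i)%N%:Z <= (n%:Z - 1) * (size ls)%:Z.
  have -> : n%:Z - 1 = n.-1%:Z by clear -n2; lia.
  by rewrite -PoszM lez_nat mulnC.
have /andP[_ h0] := gr_arcs_n e; move: hx hg h0.
have lt (a b c : int) (x : nat) :
  x%:Z <= c -> c < a -> b <= 0 -> (2 * x%:Z != a + c - b) by clear; lia.
exact: lt.
Qed.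
End N.

Section Hat.
Variable p : nat.
Local Notation wth := (@wt_hat p).
Local Notation S := {mpoly rat[p.+1]}.
Local Notation mk := (lift ord0 : 'I_p -> 'I_p.+1).

Lemma mwt_h (m : 'X_{1..p.+1}) : (mwt wth m).1 = 2 * (m ord0)%:Z.
Proof.
have fstMn (x : int * int) k : (x *+ k).1 = x.1 *+ k.
  by elim: k => // k IH; rewrite !mulrS /= IH.
rewrite /mwt (big_morph fst (id1 := 0) (op1 := +%R)) //.
rewrite big_ord_recl big1 ?addr0; last by move=> i _; rewrite fstMn /= mul0rn.
by rewrite fstMn /= -[LHS]mulr_natr (natz (m ord0)).
Qed.

Lemma gr_arcs_h ls (e : basis (mf_bigtensor [seq arc_h l | l <- ls : seq ('I_p * 'I_p)])) :
  - (size ls)%:Z <= (gr e).1 <= 0.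
Proof.
elim: ls e => [|l ls IH] e //; rewrite /=.
case: e => e1 e2; have := IH e2; rewrite /=.
move: (gr e2) => x; move: (size ls) => k.
by case: e1; rewrite /=; lia.
Qed.

(** The first entry of an arc is a itself, so one arc suffices, with alpha = 1; this constant forces
    the degree (1, -1). *)
Lemma null_arcs_h ls : (0 < size ls)%N ->
  null_homotopic wth (mf_bigtensor [seq arc_h l | l <- ls]) ('X_ord0 ^+ 1) (1, -1).
Proof.
case: ls => // l ls _.
have -> : 'X_ord0 ^+ 1 = 1 * va p + 0 * (vx l.1 - vx l.2) :> S.
  by rewrite mul1r mul0r addr0.
apply: null_mf1; last exact: hom0.
by apply: hom_cast (hom1 _) _.
Qed.

Lemma closing_bound_h (lev : 'I_p.+1 -> nat) tau ls (g : int * int) :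
  elimination wth lev tau [::] -> ker (xtau tau) (\sum_(l <- ls) pot_arc mk (pot_h (p := p)) l) ->
  (0 < size ls)%N ->
  (g.1 < - (size ls)%:Z) || (0 <= g.1) ->
  exactg wth (ker (xtau tau)) (mf_bigtensor [seq arc_h l | l <- ls]) g.
Proof.
move=> [idem wtau ltau base _ fin] kW ls0 hg.
have gA : good wth (1, 1) (mf_bigtensor [seq arc_h l | l <- ls])
    (\sum_(l <- ls) pot_arc mk (pot_h (p := p)) l).
  rewrite -[X in good _ _ _ X]addr0; apply: good_foldr; first exact: good_arc_h.
  exact: good_unit.
have ta := fix_a wtau.
have neg (a b : int) (x : nat) : 2 * x%:Z = a - b -> a < b -> False by clear; lia.
case/orP: hg => hg.
  apply: exactg_trivial; first exact: ideal_ker.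
  move=> e f hf; suff -> : f = 0 by rewrite /ker rmorph0.
  apply/eqP; rewrite -msupp_eq0; case E: (msupp f) => [//|m r].
  have := homE hf (_ : m \in msupp f); rewrite E mem_head => /(_ isT) /(congr1 fst).
  rewrite mwt_h => h3.
  have /andP[h1 _] := gr_arcs_h e; have h2 := lt_le_trans hg h1.
  by case: (neg _ _ _ h3 h2).
apply: (exact_mod_powers idem gA kW (K := [:: ord0]) (n := 1) (e := (1, -1))) => //.
- by move=> v; rewrite inE => /eqP ->.
- by move=> v; rewrite inE => /eqP ->; apply: null_arcs_h.
apply: exactg_trivial; first exact: ideal_monker.
(* A monomial without a has a-degree 0, while here the a-degree is at least 1: g has a-degree at
   least 0, the homotopy adds 1, and the generators have a-degree at most 0. *)
move=> e f hf; apply/allP => m hm; rewrite /= orbF lt0n.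
have hf' : hom wth (sub (xtau tau) f) (g + (1, -1) *+ 1 - gr e).
  by apply: hom_sub hf => v; rewrite -[X in hom _ _ X]wtau homX.
have := homE hf' hm => /(congr1 fst); rewrite mwt_h => h3.
apply/eqP => m0; rewrite m0 mulr0 in h3.
have /andP[_ h0] := gr_arcs_h e.
have lt (a b : int) : 0 <= a -> b <= 0 -> 0 = a + 1 - b -> False by clear; lia.
exact: lt hg h0 h3.
Qed.
End Hat.
End Closing.

(** * Closed braids *)

Section Extrema.

Lemma int_max (P : int -> Prop) (k hi : int) :
  P k -> (forall m, P m -> m <= hi) -> exists m, is_max P m.
Proof.
move=> Pk hP; apply: NNPP => nomax.
have step (d : nat) : exists m, P m /\ k + d%:Z <= m.
  elim: d => [|d [m [Pm hm]]]; first by exists k; split=> //; lia.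
  apply: NNPP => no; apply: nomax; exists m; split=> // m' Pm'.
  rewrite leNgt; apply/negP => lt; apply: no; exists m'; split=> //; lia.
have [m [/hP h1 h2]] := step (absz (hi - k)).+1.
by lia.
Qed.

Lemma int_min (P : int -> Prop) (k lo : int) :
  P k -> (forall m, P m -> lo <= m) -> exists m, is_min P m.
Proof.
move=> Pk hP; have [|m|m [Pm hm]] := @int_max (fun m => P (- m)) (- k) (- lo).
- by rewrite opprK.
- by move/hP; rewrite lerNr.
by exists (- m); split=> // k'; rewrite lerNl => ?; apply: hm; rewrite opprK.
Qed.
End Extrema.

(** * Marks, levels and total potential of a closed braid *)

Section Braid.
Variables (b : nat) (B : braid_word b).
Local Notation m := (size B).
Local Notation p := (m.+1 * b)%N.

Definition unmark (k : 'I_p) : 'I_m.+1 * 'I_b := enum_val (cast_ord (esym (mxvec_cast m.+1 b)) k).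

Lemma markK t s : unmark (mark t s) = (t, s).
Proof. by rewrite /unmark /mark /mxvec_index cast_ordK enum_rankK. Qed.

Lemma unmarkK k : mark (unmark k).1 (unmark k).2 = k.
Proof. by rewrite /mark /mxvec_index -surjective_pairing enum_valK cast_ordKV. Qed.

Definition level (k : 'I_p) : nat := (unmark k).1.

Lemma level_mark t s : level (mark t s) = t.
Proof. by rewrite /level markK. Qed.

Definition crossing_at (t : 'I_m) : crossing p :=
  let: (e, i) := letter t in
  Crossing e (mark (above t) (strandL i)) (mark (above t) (strandR i))
             (mark (below t) (strandL i)) (mark (below t) (strandR i)).

Definition vertical_strands (t : 'I_m) : seq 'I_b :=
  [seq s <- enum 'I_b | s \notin [:: strandL (letter t).2; strandR (letter t).2]].

Definition vertical_arcs : seq ('I_p * 'I_p) :=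
  [seq (mark (above t) s, mark (below t) s) | t <- enum 'I_m, s <- vertical_strands t].

Definition closing_arcs : seq ('I_p * 'I_p) :=
  [seq (mark ord0 s, mark ord_max s) | s <- enum 'I_b].

Lemma crossings_braid : crossings (closed_braid B) = [seq crossing_at t | t <- enum 'I_m].
Proof. by apply: eq_map => t; rewrite /crossing_at; case: (letter t). Qed.

Lemma strandLR (i : 'I_b.-1) : strandL i != strandR i.
Proof. by rewrite -val_eqE /= neq_ltn ltnSn. Qed.

Lemma crossing_atE t : crossing_at t = Crossing (letter t).1
  (mark (above t) (strandL (letter t).2)) (mark (above t) (strandR (letter t).2))
  (mark (below t) (strandL (letter t).2)) (mark (below t) (strandR (letter t).2)).
Proof. by rewrite /crossing_at; case: (letter t). Qed.

Definition tops : seq 'I_p :=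
  flatten [seq [:: tl (crossing_at t); tr (crossing_at t)] | t <- enum 'I_m]
  ++ [seq l.1 | l <- vertical_arcs].

Lemma top_mem t s : mark (above t) s \in tops.
Proof.
rewrite mem_cat; case: (boolP (s \in [:: strandL (letter t).2; strandR (letter t).2])) => hs.
  apply/orP; left; apply/flattenP.
  exists [:: tl (crossing_at t); tr (crossing_at t)]; first by apply: map_f; rewrite mem_enum.
  by move: hs; rewrite crossing_atE !inE => /orP[] /eqP ->; rewrite eqxx ?orbT.
apply/orP; right; apply/mapP; exists (mark (above t) s, mark (below t) s) => //.
apply/allpairsPdep; exists t, s; split; rewrite ?mem_enum //.
by rewrite mem_filter hs mem_enum.
Qed.

Lemma size_vertical t : (size (vertical_strands t)).+2 = b.
Proof.
have un : uniq [:: strandL (letter t).2, strandR (letter t).2 & vertical_strands t].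
  rewrite /= inE negb_or strandLR filter_uniq ?enum_uniq //.
  by rewrite !mem_filter !inE !eqxx ?orbT.
have := card_uniqP un => /= <-; rewrite -[RHS]card_ord; apply: eq_card => s.
rewrite !inE mem_filter mem_enum !inE andbT.
by case: (s == _) => //=; case: (s == _).
Qed.

(** By counting: the list contains every mark above level 0, and each layer contributes 2 + (b - 2)
    entries, so it is as long as a list of these marks without repetition. *)
Lemma tops_uniq : uniq tops.
Proof.
pose all_marks := [seq mark (above t) s | t <- enum 'I_m, s <- enum 'I_b].
have un : uniq all_marks.
  apply: allpairs_uniq; rewrite ?enum_uniq // => -[t s] [t' s'] _ _ /=.
  move=> /(congr1 unmark); rewrite !markK => -[h ->].
  by congr (_, _); apply: val_inj; exact: h.
apply: (leq_size_uniq un).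
  by move=> _ /allpairsP[[t s] /= [_ _ ->]]; apply: top_mem.
rewrite size_allpairs !size_enum_ord size_cat size_map size_flatten size_allpairs_dep.
rewrite /shape -map_comp !sumnE !big_map -big_split /=.
rewrite (eq_bigr (fun _ => b)); last by move=> t _; rewrite add2n size_vertical.
by rewrite big_const_seq count_predT -enumT size_enum_ord iter_addn_0 mulnC.
Qed.

Lemma level_or_top k : k \in tops \/ level k = 0%N.
Proof.
case E: (unmark k) => [t s]; rewrite -(unmarkK k) E /=.
rewrite level_mark; case: (unliftP ord0 t) => [t' ->|->]; last by right.
by left; apply: top_mem.
Qed.

Lemma upward_crossing t :
  [&& (level (bl (crossing_at t)) < level (tl (crossing_at t)))%N,
      (level (bl (crossing_at t)) < level (tr (crossing_at t)))%N,
      (level (br (crossing_at t)) < level (tl (crossing_at t)))%N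
    & (level (br (crossing_at t)) < level (tr (crossing_at t)))%N].
Proof. by rewrite crossing_atE /= !level_mark /= /bump leq0n add1n ltnSn. Qed.

Lemma upward_arc l : l \in vertical_arcs -> (level l.2 < level l.1)%N.
Proof. by case/allpairsPdep => t [s [_ _ ->]] /=; rewrite !level_mark. Qed.

(** Each layer contributes the sum of P over the marks above it minus the sum over the marks below
    it. These differences telescope, and the closing arcs cancel what remains. *)
Lemma potential_braid (S : comNzRingType) (P : 'I_p -> S) :
  \sum_(t <- enum 'I_m) (P (tl (crossing_at t)) + P (tr (crossing_at t))
                         - P (bl (crossing_at t)) - P (br (crossing_at t)))
  + \sum_(l <- vertical_arcs ++ closing_arcs) (P l.1 - P l.2) = 0.
Proof.
rewrite big_cat /= addrA [X in _ + X + _]big_allpairs_dep /= -big_split /=.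
pose Q t := \sum_s P (mark t s).
rewrite (eq_bigr (fun t => Q (above t) - Q (below t))); last first.
  move=> t _; rewrite crossing_atE /= /Q -sumrB big_filter big_enum_cond /=.
  set L := strandL _; set R := strandR _.
  have LR : R != L by rewrite eq_sym strandLR.
  rewrite [RHS](bigD1 L) //= [X in _ = _ + X](bigD1 R) //=.
  rewrite (eq_bigl (fun s => (s != L) && (s != R))); last first.
    by move=> s; rewrite !inE negb_or.
  by ring.
rewrite big_enum /= big_map big_enum /= !sumrB -!/(Q _).
have e1 := big_ord_recl m Q; have e2 := big_ord_recr m Q; rewrite /= in e2.
have e : Q ord0 + \sum_(t < m) Q (above t) = \sum_(t < m) Q (below t) + Q ord_max.
  by rewrite -[LHS]e1 e2; congr (_ + _); apply: eq_bigr => t _; congr Q; apply: val_inj.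
have -> : \sum_(t < m) Q (above t) = \sum_(t < m) Q (below t) + Q ord_max - Q ord0.
  by rewrite -e addrC addKr.
by ring.
Qed.
End Braid.

(** * Bounds and nonvanishing for closed braids *)

Section Bounds.
Variables (b : nat) (B : braid_word b).
Local Notation m := (size B).
Local Notation p := (m.+1 * b)%N.
Local Notation cr := (@crossing_at b B).

Lemma crossing_at_neq t : tl (cr t) != bl (cr t).
Proof.
have /and4P[h _ _ _] := upward_crossing t.
by apply: contraTneq h => ->; rewrite ltnn.
Qed.

Lemma count_crossings a : count (fun t => a (positive (cr t))) (enum 'I_m)
  = count (fun x => a x.1) B.
Proof.
have eB : [seq letter t | t <- enum 'I_m] = B by apply: (map_tnth_enum (in_tuple B)).
by rewrite -[in RHS]eB count_map; apply: eq_count => t; rewrite /= crossing_atE.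
Qed.

Lemma closing_uniq : uniq [seq l.1 | l <- closing_arcs B].
Proof.
rewrite -map_comp map_inj_uniq ?enum_uniq // => s s' /(congr1 (@unmark b B)).
by rewrite !markK => -[].
Qed.

Lemma closing_level l : l \in closing_arcs B -> level l.1 = 0%N.
Proof. by case/mapP => s _ ->; rewrite level_mark. Qed.

Lemma level0_closing k : level k = 0%N -> k \in [seq l.1 | l <- closing_arcs B].
Proof.
rewrite /level -{2}(unmarkK k); case: (unmark k) => t s /= t0.
have -> : t = ord0 by apply: val_inj.
by rewrite -map_comp; apply/mapP; exists s; rewrite ?mem_enum.
Qed.

Lemma size_closing : size (closing_arcs B) = b.
Proof. by rewrite size_map size_enum_ord. Qed.

Section N.
Variable n : nat.
Hypothesis n2 : (2 <= n)%N.

Lemma C_nE : C_n n (closed_braid B) =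
  mf_bigtensor ([seq crossing_n n (cr t) | t <- enum 'I_m]
                ++ [seq arc_n n l | l <- vertical_arcs B ++ closing_arcs B]).
Proof. by rewrite /C_n crossings_braid -map_comp. Qed.

Lemma shift_sums_n (cs : seq 'I_m) s : s \in shift_sums cr (shifts_n n (p := p)) cs ->
  (n%:Z - 1) * (count (fun t => positive (cr t)) cs)%:Z
    - (n%:Z + 1) * (count (fun t => ~~ positive (cr t)) cs)%:Z <= s
  <= (n%:Z + 1) * (count (fun t => positive (cr t)) cs)%:Z
    - (n%:Z - 1) * (count (fun t => ~~ positive (cr t)) cs)%:Z.
Proof.
elim: cs s => [|t cs IH] s /=; first by rewrite inE => /eqP ->; rewrite !mulr0 subrr lexx.
case/allpairsP => -[s1 s2] /= [+ /IH + ->]; rewrite /shifts_n.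
move: (count _ _) (count _ _) => x y.
case: (positive _); rewrite !inE => /orP[] /eqP ->; rewrite /= ?add0n ?add1n ?intS; clear; nia.
Qed.

Lemma gcr_n t : good (fun _ : 'I_p => 2 : int) (n%:Z + 1) (crossing_n n (cr t))
  (pot_crossing id (pot_n n (p := p)) (cr t)).
Proof. exact/good_crossing_n/crossing_at_neq. Qed.

Lemma bound_n j k : H_n_nz n (closed_braid B) j k ->
  (n%:Z - 1) * (writhe B - b%:Z) - 2 * (c_neg B)%:Z <= k
  <= (n%:Z - 1) * (writhe B + b%:Z) + 2 * (c_pos B)%:Z.
Proof.
rewrite /H_n_nz C_nE => nz.
(* Both bounds are split into an extreme total shift of the crossings and the term (n - 1) b of the
   closing arcs. *)
have -> : (n%:Z - 1) * (writhe B - b%:Z) - 2 * (c_neg B)%:Z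
  = (n%:Z - 1) * (c_pos B)%:Z - (n%:Z + 1) * (c_neg B)%:Z - (n%:Z - 1) * b%:Z.
  by rewrite /writhe; ring.
have -> : (n%:Z - 1) * (writhe B + b%:Z) + 2 * (c_pos B)%:Z
  = (n%:Z + 1) * (c_pos B)%:Z - (n%:Z - 1) * (c_neg B)%:Z + (n%:Z - 1) * b%:Z.
  by rewrite /writhe; ring.
apply: contraT; rewrite negb_and -!ltNge => hk.
case: (@HH_bound _ _ _ _ j k _ nz).
apply: (exact_closure (mk := id) (lev := @level b B) (@sub_pot_n n p) _ gcr_n (good_arc_n n (p := p))
  (shifts := shifts_n n (p := p))) => //.
- by move=> tau c A WA W g i j' k' l idem wtau; apply: exact_crossing_n.
- by move=> tau l A W g; apply: exact_arc_n.
- by move=> t _; apply: upward_crossing.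
- by move=> l; apply: upward_arc.
- have := tops_uniq B; congr (is_true (uniq (_ ++ _))).
- by move=> v; have := level_or_top v; congr (_ \/ _).
- exact: (@potential_braid b B {mpoly rat[p]} (pot_n n (p := p))).
move=> tau s hel kW /shift_sums_n/andP[h1 h2].
have cp : c_pos B = count (fun t => positive (cr t)) (enum 'I_m).
  exact: esym (count_crossings id).
have cn : c_neg B = count (fun t => ~~ positive (cr t)) (enum 'I_m).
  exact: esym (count_crossings negb).
rewrite -cp -cn in h1 h2.
apply: closing_bound_n hel kW _ _ _ _ => //; first exact: closing_uniq.
- exact: closing_level.
- exact: level0_closing.
rewrite size_closing.
have aux (x y P M c r u : int) : (r < x * P - y * M - x * c) || (y * P - x * M + x * c < r) ->
    x * P - y * M <= u -> u <= y * P - x * M -> (r - u < - x * c) || (x * c < r - u).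
  rewrite mulNr; move: (x * P) (y * M) (y * P) (x * M) (x * c); clear; lia.
exact: aux hk h1 h2.
Qed.

Lemma exists_n : exists j k, H_n_nz n (closed_braid B) j k.
Proof.
rewrite /H_n_nz C_nE; apply: (HH_nz_closure gcr_n (good_arc_n n (p := p))).
- exact: (@potential_braid b B {mpoly rat[p]} (pot_n n (p := p))).
- by move=> t; apply: isolated_crossing_n.
- exact: isolated_arc_n.
Qed.
End N.

Section Hat.
Local Notation mk := (lift ord0 : 'I_p -> 'I_p.+1).

Definition level_h (v : 'I_p.+1) : nat := if unlift ord0 v is Some k then level k else 0%N.

Lemma level_h_mk k : level_h (mk k) = level k.
Proof. by rewrite /level_h liftK. Qed.

Lemma C_hE : C_h (closed_braid B) =
  mf_bigtensor ([seq crossing_h (cr t) | t <- enum 'I_m]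
                ++ [seq arc_h l | l <- vertical_arcs B ++ closing_arcs B]).
Proof. by rewrite /C_h crossings_braid -map_comp. Qed.

Lemma shift_sums_h (cs : seq 'I_m) s : s \in shift_sums cr (@shifts_h p) cs -> s.1 = 0.
Proof.
elim: cs s => [|t cs IH] s /=; first by rewrite inE => /eqP ->.
case/allpairsP => -[s1 s2] /= [+ /IH + ->]; rewrite /shifts_h /= => h ->.
by move: h; case: ifP => _; rewrite !inE => /orP[] /eqP ->.
Qed.

Lemma gcr_h t : good (@wt_hat p) (1, 1) (crossing_h (cr t))
  (pot_crossing mk (@pot_h p) (cr t)).
Proof. exact/good_crossing_h/crossing_at_neq. Qed.

Lemma tops_h : crossing_tops mk cr (enum 'I_m) ++ arc_tops mk (vertical_arcs B)
  = [seq mk k | k <- tops B].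
Proof.
rewrite /tops map_cat map_flatten /crossing_tops /arc_tops -!map_comp.
by congr (flatten _ ++ _).
Qed.

(** The range before the final shift by (w + b)/2. A strand provides a closing arc, on which a is
    null-homotopic. *)
Lemma bound_h (hb : (0 < b)%N) j k l : H_nz (closed_braid B) j k l ->
  - b%:Z <= k <= -1.
Proof.
rewrite /H_nz C_hE => nz.
apply: contraT; rewrite negb_and -!ltNge => hk.
case: (@HH_bound _ _ _ _ j (k, l) _ nz).
apply: (exact_closure (mk := mk) (lev := level_h) (@sub_pot_h p) _ gcr_h (@good_arc_h p)
  (shifts := @shifts_h p)) => //.
- by move=> tau c A WA W g; apply: exact_crossing_h.
- by move=> tau l' A W g; apply: exact_arc_h.
- by move=> t _; rewrite /upward !level_h_mk; apply: upward_crossing.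
- by move=> l' hl; rewrite !level_h_mk; apply: upward_arc.
- by rewrite tops_h map_inj_uniq ?tops_uniq //; apply: lift_inj.
- move=> v; rewrite tops_h; case: (unliftP ord0 v) => [k' ->|->].
    by rewrite level_h_mk mem_map; [apply: level_or_top|apply: lift_inj].
  by right; rewrite /level_h unlift_none.
- exact: (@potential_braid b B {mpoly rat[p.+1]} (fun k => @pot_h p (mk k))).
move=> tau s hel kW /shift_sums_h s0.
apply: closing_bound_h hel kW _ _; rewrite size_closing //= s0 subr0.
by move: hk; clear; lia.
Qed.

Lemma exists_h : exists j k l, H_nz (closed_braid B) j k l.
Proof.
have [j [[k l] h]] : exists j g, HH_nz (@wt_hat p) (C_h (closed_braid B)) j g.
  rewrite C_hE; apply: (HH_nz_closure gcr_h (@good_arc_h p)).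
  - exact: (@potential_braid b B {mpoly rat[p.+1]} (fun k => @pot_h p (mk k))).
  - by move=> t; apply: isolated_crossing_h.
  - exact: isolated_arc_h.
by exists j, k, l.
Qed.
End Hat.
End Bounds.

Theorem theorem1p1 (b : nat) (hb : (0 < b)%N) (B : braid_word b) :
  (exists gmin gmax : rat,
     [/\ is_hat_gmin B gmin, is_hat_gmax B gmax
       & [/\ ((writhe B)%:~R - b%:R) / 2 <= gmin, gmin <= gmax
           & gmax <= ((writhe B)%:~R + b%:R) / 2 - 1]]) /\
  (forall n : nat, (2 <= n)%N ->
   exists gmin gmax : int,
     [/\ is_gmin n B gmin, is_gmax n B gmax
       & [/\ (n%:Z - 1) * (writhe B - b%:Z) - 2 * (c_neg B)%:Z <= gmin, gmin <= gmax
           & gmax <= (n%:Z - 1) * (writhe B + b%:Z) + 2 * (c_pos B)%:Z]]).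
Proof.
split.
  pose P (k : int) := exists j l, H_nz (closed_braid B) j k l.
  pose c : rat := ((writhe B)%:~R + b%:R) / 2.
  have hP k : P k -> - b%:Z <= k <= -1 by case=> j [l]; apply: bound_h.
  have [j0 [k0 [l0 h0]]] := exists_h B.
  have P0 : P k0 by exists j0, l0.
  have [gmax [Pmax hmax]] := int_max P0 (fun k Pk => proj2 (andP (hP k Pk))).
  have [gmin [Pmin hmin]] := int_min P0 (fun k Pk => proj1 (andP (hP k Pk))).
  (* All degrees are translated by constants, so the extrema over the half-integers come from those
     of the integral degrees. *)
  have hatP k : (exists j l, hatH_nz B j k l) <-> exists2 k', P k' & k = k'%:~R + c.
    split=> [[j [l [j' [k' [l' [_ -> _ h]]]]]]|[k' [j [l h]] ->]].
      by exists k' => //; exists j', l'.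
    by exists (j%:~R - c), (l%:~R + c), j, k', l.
  have /andP[lo _] := hP _ Pmin; have /andP[_ hi] := hP _ Pmax.
  exists (gmin%:~R + c), (gmax%:~R + c); split.
  - split; first by apply/hatP; exists gmin.
    by move=> k /hatP[k' Pk' ->]; rewrite lerD2r ler_int; apply: hmin.
  - split; first by apply/hatP; exists gmax.
    by move=> k /hatP[k' Pk' ->]; rewrite lerD2r ler_int; apply: hmax.
  split.
  (* The lower end - b of the integral range becomes - b + (w + b)/2. *)
  - have -> : ((writhe B)%:~R - b%:R) / 2 = (- b%:Z)%:~R + c :> rat.
      by rewrite /c mulrNz -pmulrn; field.
    by rewrite lerD2r ler_int.
  - by rewrite lerD2r ler_int; apply: hmin.
  - by rewrite -/c addrC lerD2l; have := hi; rewrite -(ler_int rat).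
move=> n n2.
pose P (k : int) := exists j, H_n_nz n (closed_braid B) j k.
have hP k : P k -> (n%:Z - 1) * (writhe B - b%:Z) - 2 * (c_neg B)%:Z <= k
    <= (n%:Z - 1) * (writhe B + b%:Z) + 2 * (c_pos B)%:Z by case=> j; apply: bound_n.
have [j0 [k0 h0]] := exists_n B n2.
have P0 : P k0 by exists j0.
have [gmax [Pmax hmax]] := int_max P0 (fun k Pk => proj2 (andP (hP k Pk))).
have [gmin [Pmin hmin]] := int_min P0 (fun k Pk => proj1 (andP (hP k Pk))).
have /andP[lo _] := hP _ Pmin; have /andP[_ hi] := hP _ Pmax.
by exists gmin, gmax; split; split=> //; apply: hmin.
Qed.
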